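(* The quantum cyclotomic wreath algebra $H_{n+1}^f(A,z)$ is a Frobenius extension of $H_n^f(A,z)$ with trace map $\mathrm{tr}_{n+1}^f$.
   Context: Conventions. $\Bbbk$ is a commutative ring of characteristic not equal to two, $z\in\Bbbk$, and all tensor products are over $\Bbbk$. All algebras and modules are associative superalgebras and supermodules over $\Bbbk$; $\bar a$ is the parity of a homogeneous element $a$; $(a\otimes b)(c\otimes d)=(-1)^{\bar b\bar c}ac\otimes bd$. $A$ is a symmetric superalgebra: there is a parity-preserving linear map $\mathrm{tr}=\mathrm{tr}_A\colon A\to\Bbbk$ ($\Bbbk$ in parity zero) with $\mathrm{tr}(ab)=(-1)^{\bar a\bar b}\mathrm{tr}(ba)$ for homogeneous $a,b$, such that $a\mapsto(b\mapsto\mathrm{tr}(ab))$ is a parity-preserving isomorphism $A\to\mathrm{Hom}_\Bbbk(A,\Bbbk)$. $A$ is free over $\Bbbk$ with a homogeneous (necessarily finite) basis $B$, and dual basis $\{b^\vee\}$ given by $\mathrm{tr}(a^\vee b)=\delta_{a,b}$ for $a,b\in B$. Let $n\ge1$. For $a\in A$, $a_i=1^{\otimes(i-1)}\otimes a\otimes1^{\otimes(n-i)}\in A^{\otimes n}$; $t_{i,j}=\sum_{b\in B}b_ib_j^\vee$ for $1\le i\ne j\le n$. $S_n$ acts on $A^{\otimes n}$ by superpermutation of factors; $s_i=(i,i+1)$. $H_n(A,z)$ is the algebra generated by $A^{\otimes n}$ and even elements $T_1,\dots,T_{n-1}$ (free product) modulo: $T_iT_j=T_jT_i$ for $|i-j|>1$;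 $T_iT_{i+1}T_i=T_{i+1}T_iT_{i+1}$; $T_i^2=zt_{i,i+1}T_i+1$; $T_i\mathbf a=s_i(\mathbf a)T_i$ for $\mathbf a\in A^{\otimes n}$ (so $H_1(A,z)=A$). $H_n^{\mathrm{aff}}(A,z)$ is the free product of $\Bbbk[X_1^{\pm1},\dots,X_n^{\pm1}]$ ($X_i$ even) and $H_n(A,z)$ modulo: $T_iX_j=X_jT_i$ for $j\ne i,i+1$; $T_iX_iT_i=X_{i+1}$; $X_i\mathbf a=\mathbf aX_i$ for $\mathbf a\in A^{\otimes n}$. Cyclotomic quotients. Let $Z(A)=\{a: ab=(-1)^{\bar a\bar b}ba\ \forall b\in A\}$ and $Z(A)_0$ its even part. Identify $A$ with $A\otimes1^{\otimes(n-1)}\subseteq A^{\otimes n}$. Fix a monic polynomial $f=X_1^d+a_{(d-1)}X_1^{d-1}+\dots+a_{(0)}$ of degree $d\ge1$ with all $a_{(i)}\in Z(A)_0$ and $a_{(0)}$ invertible. $H_n^f(A,z)=H_n^{\mathrm{aff}}(A,z)/\langle f\rangle$, with $\langle f\rangle$ the two-sided ideal generated by $f$. The subalgebra of $H_{n+1}^f(A,z)$ generated by $X_1,\dots,X_n$, $A^{\otimes n}\otimes1$, $T_1,\dots,T_{n-1}$ is isomorphic to (and identified with) $H_n^f(A,z)$. Partial trace. Let $A_{n+1}=1^{\otimes n}\otimes A\subseteq A^{\otimes(n+1)}$. There is a decomposition of $(H_n^f(A,z),H_n^f(A,z))$-bimodules $$H_{n+1}^f(A,z)=A_{n+1}H_n^f(A,z)\oplus\bigoplus_{r=1}^{d-1}X_{n+1}^rA_{n+1}H_n^f(A,z)\oplus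 H_n^f(A,z)T_nH_n^f(A,z).$$ The map $\mathrm{tr}_{n+1}^f\colon H_{n+1}^f(A,z)\to H_n^f(A,z)$ is the bimodule homomorphism given by projection onto the first summand followed by the (well-defined) map $A_{n+1}H_n^f(A,z)\to H_n^f(A,z)$, $a_{n+1}\alpha\mapsto\mathrm{tr}_A(a)\alpha$, for $a\in A$, $\alpha\in H_n^f(A,z)$. Frobenius extension. For an inclusion of superalgebras $R\subseteq S$ and a parity-preserving $(R,R)$-bimodule homomorphism $\theta\colon S\to R$, $S$ is a Frobenius extension of $R$ with trace map $\theta$ if $S$ is finitely generated and projective as a right $R$-module and $s\mapsto(t\mapsto\theta(st))$ is an isomorphism from $S$ to the module of right $R$-linear maps $S\to R$. *)

(* Defs.v *)
From HB Require Import structures.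
From mathcomp Require Import all_boot perm all_algebra.
From mathcomp Require Import finmap.
From mathcomp Require Import boolp classical_sets.
From mathcomp.multinomials Require Import monalg.

Set Implicit Arguments.
Unset Strict Implicit.
Unset Printing Implicit Defensive.

Import GRing.Theory.
Local Open Scope ring_scope.
Local Open Scope quotient_scope.

(* [par false] and [par true] are the even and odd parts.  Algebras are given
   by a central structure map [eta : k -> R] rather than by [algType k], so that
   the definition also applies to presented rings, which are not a priori
   nontrivial. *)
Record superalgebra (k : comNzRingType) (R : pzRingType) (eta : k -> R)
    (par : bool -> R -> Prop) : Prop := Superalgebra {
  scal_morph : zmod_morphism eta /\ monoid_morphism eta;
  scal_central : forall c x, eta c * x = x * eta c;
  par0 : forall p, par p 0;
  parZD : forall p c x y, par p x -> par p y -> par p (eta c * x + y);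
  par_decomp : forall x, exists x0 x1,
    [/\ par false x0, par true x1 & x = x0 + x1];
  par_direct : forall x, par false x -> par true x -> x = 0;
  par1 : par false 1;
  parM : forall p q x y, par p x -> par q y -> par (p (+) q) (x * y)
}.

HB.mixin Record isSuperalgebra (k : comNzRingType) A of GRing.Algebra k A := {
  homog : bool -> A -> Prop;
  homogP : superalgebra (in_alg A) homog
}.

#[short(type="superalgType")]
HB.structure Definition SuperAlgebra (k : comNzRingType) :=
  {A of isSuperalgebra k A & GRing.Algebra k A}.

Section IdealQuotient.
Variables (R : pzRingType) (S : R -> Prop).

Inductive ideal_gen : R -> Prop :=
| ideal_gen_in x : S x -> ideal_gen x
| ideal_gen0 : ideal_gen 0
| ideal_genD x y : ideal_gen x -> ideal_gen y -> ideal_gen (x + y)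
| ideal_genMl a x : ideal_gen x -> ideal_gen (a * x)
| ideal_genMr x a : ideal_gen x -> ideal_gen (x * a).

Definition ideal_eq : rel R := fun x y => `[< ideal_gen (x - y) >].

Lemma ideal_genN x : ideal_gen x -> ideal_gen (- x).
Proof. by rewrite -mulN1r; apply: ideal_genMl. Qed.

Lemma ideal_eq_refl : reflexive ideal_eq.
Proof. by move=> x; apply/asboolP; rewrite subrr; exact: ideal_gen0. Qed.

Lemma ideal_eq_sym : symmetric ideal_eq.
Proof.
suff sub x y : ideal_eq x y -> ideal_eq y x by move=> x y; apply/idP/idP => /sub.
by move=> /asboolP/ideal_genN; rewrite opprB => ?; apply/asboolP.
Qed.

Lemma ideal_eq_trans : transitive ideal_eq.
Proof.
move=> y x z /asboolP xy /asboolP yz; apply/asboolP.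
by rewrite -(subrKA y); apply: ideal_genD.
Qed.

Canonical ideal_equiv :=
  EquivRel ideal_eq ideal_eq_refl ideal_eq_sym ideal_eq_trans.

Definition quot_ring := {eq_quot ideal_equiv}.
HB.instance Definition _ := Choice.on quot_ring.
HB.instance Definition _ : EqQuotient _ ideal_equiv quot_ring :=
  EqQuotient.on quot_ring.

Definition quot_pi (x : R) : quot_ring := \pi_quot_ring x.

Lemma quot_piP x y : quot_pi x = quot_pi y <-> ideal_gen (x - y).
Proof.
split; first by move=> /eqP; rewrite /quot_pi eqmodE => /asboolP.
by move=> xy; apply/eqP; rewrite /quot_pi eqmodE; apply/asboolP.
Qed.

Lemma quot_piK x : quot_pi (repr x) = x.
Proof. exact: reprK. Qed.

Lemma quot_ind (P : quot_ring -> Prop) : (forall x, P (quot_pi x)) -> forall x, P x.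
Proof. by move=> Ppi x; rewrite -(quot_piK x). Qed.

Lemma quot_repr x : ideal_gen (repr (quot_pi x) - x).
Proof. by apply/quot_piP; rewrite quot_piK. Qed.

Definition quot0 := quot_pi 0.
Definition quot1 := quot_pi 1.
Definition quotN (x : quot_ring) := quot_pi (- repr x).
Definition quotD (x y : quot_ring) := quot_pi (repr x + repr y).
Definition quotM (x y : quot_ring) := quot_pi (repr x * repr y).

Lemma quotNE x : quotN (quot_pi x) = quot_pi (- x).
Proof.
by apply/quot_piP; rewrite opprK addrC -opprB; apply/ideal_genN/quot_repr.
Qed.

Lemma quotDE x y : quotD (quot_pi x) (quot_pi y) = quot_pi (x + y).
Proof. by apply/quot_piP; rewrite opprD addrACA; apply/ideal_genD; apply: quot_repr. Qed.

Lemma quotME x y : quotM (quot_pi x) (quot_pi y) = quot_pi (x * y).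
Proof.
apply/quot_piP; set x' := repr _; set y' := repr _.
have -> : x' * y' - x * y = (x' - x) * y' + x * (y' - y).
  by rewrite mulrBl mulrBr addrA subrK.
by apply: ideal_genD; [apply: ideal_genMr|apply: ideal_genMl]; exact: quot_repr.
Qed.

Fact quotDA : associative quotD.
Proof. by do 3![elim/quot_ind=> ?]; rewrite !quotDE addrA. Qed.
Fact quotDC : commutative quotD.
Proof. by do 2![elim/quot_ind=> ?]; rewrite !quotDE addrC. Qed.
Fact quot0D : left_id quot0 quotD.
Proof. by elim/quot_ind=> ?; rewrite /quot0 !quotDE add0r. Qed.
Fact quotND : left_inverse quot0 quotN quotD.
Proof. by elim/quot_ind=> ?; rewrite quotNE quotDE addNr. Qed.
Fact quotMA : associative quotM.
Proof. by do 3![elim/quot_ind=> ?]; rewrite !quotME mulrA. Qed.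
Fact quot1M : left_id quot1 quotM.
Proof. by elim/quot_ind=> ?; rewrite /quot1 !quotME mul1r. Qed.
Fact quotM1 : right_id quot1 quotM.
Proof. by elim/quot_ind=> ?; rewrite /quot1 !quotME mulr1. Qed.
Fact quotMDl : left_distributive quotM quotD.
Proof. by do 3![elim/quot_ind=> ?]; rewrite !(quotME, quotDE) mulrDl. Qed.
Fact quotMDr : right_distributive quotM quotD.
Proof. by do 3![elim/quot_ind=> ?]; rewrite !(quotME, quotDE) mulrDr. Qed.

HB.instance Definition _ :=
  GRing.isZmodule.Build quot_ring quotDA quotDC quot0D quotND.
HB.instance Definition _ :=
  GRing.Zmodule_isPzRing.Build quot_ring quotMA quot1M quotM1 quotMDl quotMDr.

Fact quot_pi_zmod : zmod_morphism quot_pi.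
Proof. by move=> x y; rewrite -quotDE -quotNE. Qed.
Fact quot_pi_monoid : monoid_morphism quot_pi.
Proof. by split=> // x y; rewrite -quotME. Qed.
HB.instance Definition _ := GRing.isZmodMorphism.Build _ _ quot_pi quot_pi_zmod.
HB.instance Definition _ := GRing.isMonoidMorphism.Build _ _ quot_pi quot_pi_monoid.

Lemma quot_pi_rel x : S x -> quot_pi x = 0.
Proof. by move=> Sx; apply/quot_piP; rewrite subr0; exact: ideal_gen_in. Qed.

Section Lift.
Variables (E : pzRingType) (f : {rmorphism R -> E}).

Definition quot_lift (x : quot_ring) : E := f (repr x).

Hypothesis f0 : forall x, S x -> f x = 0.

Lemma quot_liftE x : quot_lift (quot_pi x) = f x.
Proof.
apply/eqP; rewrite -subr_eq0 -rmorphB; apply/eqP.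
elim: (quot_repr x) => [y /f0 //||y z _ fy _ fz|a y _ fy|y a _ fy].
- by rewrite rmorph0.
- by rewrite rmorphD fy fz addr0.
- by rewrite rmorphM fy mulr0.
- by rewrite rmorphM fy mul0r.
Qed.

Lemma quot_lift_morph : zmod_morphism quot_lift /\ monoid_morphism quot_lift.
Proof.
split; first by do 2![elim/quot_ind=> ?]; rewrite -rmorphB !quot_liftE rmorphB.
split; first by rewrite -(rmorph1 quot_pi) quot_liftE rmorph1.
by do 2![elim/quot_ind=> ?]; rewrite -rmorphM !quot_liftE rmorphM.
Qed.
End Lift.

End IdealQuotient.

Lemma malg_scalerAr (k : comNzRingType) (K : monomType) (c : k)
    (x y : {malg k[K]}) : c *: (x * y) = x * (c *: y).
Proof.
apply/malgP=> w; rewrite mcoeffZ mcoeffMl.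
rewrite (mcoeffMlw _ (fsubset_refl (msupp x)) (msuppZ_le c y)).
rewrite mulr_sumr; apply: eq_bigr => u _.
rewrite mulr_sumr; apply: eq_bigr => v _.
by rewrite mcoeffZ mulrnAr mulrCA.
Qed.

Section FreeAlgebra.
Variables (k : comNzRingType) (G : choiceType).

Definition free_alg := {malg k[{fmonom G}]}.
HB.instance Definition _ := GRing.Lalgebra.on free_alg.

Definition free_gen (x : G) : free_alg := << fmu x >>.

HB.instance Definition _ := GRing.Lalgebra_isAlgebra.Build k free_alg (@malg_scalerAr k _).

Section Eval.
Variables (E : pzRingType) (eta : {rmorphism k -> E}) (h : G -> E).

Definition free_eval (g : free_alg) : E :=
  \sum_(w <- msupp g) eta g@_w * \prod_(x <- (w : seq G)) h x.

Lemma free_evalEw (d : {fset {fmonom G}}) (g : free_alg) : (msupp g `<=` d)%fset ->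
  free_eval g = \sum_(w <- d) eta g@_w * \prod_(x <- (w : seq G)) h x.
Proof.
move=> le; rewrite [LHS](big_fset_incl _ le) => //= x xd /mcoeff_outdom ->.
by rewrite rmorph0 mul0r.
Qed.

Lemma free_evalD g1 g2 : free_eval (g1 + g2) = free_eval g1 + free_eval g2.
Proof.
pose d := (msupp g1 `|` msupp g2)%fset.
rewrite !(@free_evalEw d) ?msuppD_le ?fsubsetUl ?fsubsetUr //.
by rewrite -big_split; apply: eq_bigr => w _; rewrite mcoeffD rmorphD mulrDl.
Qed.

Lemma free_evalZ c g : free_eval (c *: g) = eta c * free_eval g.
Proof.
rewrite (@free_evalEw (msupp g)) ?msuppZ_le // mulr_sumr.
by apply: eq_bigr => w _; rewrite mcoeffZ rmorphM mulrA.
Qed.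

Lemma free_evalU c (w : {fmonom G}) :
  free_eval << c *g w >> = eta c * \prod_(x <- (w : seq G)) h x.
Proof.
by rewrite (@free_evalEw [fset w]%fset) ?msuppU_le // big_seq_fset1 mcoeffUU.
Qed.

Lemma free_eval_gen x : free_eval (free_gen x) = h x.
Proof. by rewrite free_evalU rmorph1 mul1r fmU big_seq1. Qed.

Hypothesis eta_central : forall c x, eta c * x = x * eta c.

Lemma free_eval_morph : zmod_morphism free_eval /\ monoid_morphism free_eval.
Proof.
have ev1 : free_eval 1 = 1 by rewrite free_evalU rmorph1 mul1r fm1 big_nil.
have evN g : free_eval (- g) = - free_eval g.
  by rewrite -scaleN1r free_evalZ rmorphN rmorph1 mulN1r.
split; first by move=> x y; rewrite free_evalD evN.
split=> // x y.
have ev0 : free_eval 0 = 0 by rewrite -(scale0r 1) free_evalZ rmorph0 mul0r.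
rewrite malgME (big_morph _ free_evalD ev0) [free_eval x]/free_eval mulr_suml.
apply: eq_bigr => u _; rewrite (big_morph _ free_evalD ev0) mulr_sumr.
apply: eq_bigr => v _.
rewrite free_evalU fmM big_cat rmorphM /= -!mulrA; congr (_ * _).
by rewrite !mulrA eta_central.
Qed.
End Eval.
End FreeAlgebra.

Definition upd (T : Type) n (a : 'I_n -> T) (i : 'I_n) (x : T) : 'I_n -> T :=
  fun j => if j == i then x else a j.

Definition at_pos (A : pzRingType) n (i : 'I_n) (a : A) : 'I_n -> A :=
  upd (fun=> 1) i a.

(* [gen_ten a] is the pure tensor a_1 (x) ... (x) a_n; positions are numbered
   from 0, so [gen_X i] is X_{i+1} and [gen_T i] is T_{i+1}. *)
Inductive aff_gens (A : Type) n :=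
| gen_ten of 'I_n -> A
| gen_X of 'I_n
| gen_Xinv of 'I_n
| gen_T of 'I_n.-1.
Arguments gen_X {A n}.
Arguments gen_Xinv {A n}.
Arguments gen_T {A n}.

HB.instance Definition _ (A : Type) n := gen_eqMixin (aff_gens A n).
HB.instance Definition _ (A : Type) n := gen_choiceMixin (aff_gens A n).

(* [b] is the basis of A and [bd] its dual basis. *)
Section QuantumWreath.
Variables (k : comNzRingType) (A : superalgType k).
Variables (B : finType) (b bd : B -> A) (z : k).

Local Notation free n := (free_alg k (aff_gens A n)).
Local Notation ten a := (free_gen k (gen_ten a)).
Local Notation X i := (free_gen k (gen_X i)).
Local Notation Y i := (free_gen k (gen_Xinv i)).
Local Notation T i := (free_gen k (gen_T i)).

Definition teleporter n (i j : 'I_n) : free n :=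
  \sum_(x : B) ten (at_pos i (b x)) * ten (at_pos j (bd x)).

(* The first three relations present the superalgebra A^{(x)n} on its pure
   tensors (multilinearity, unit, and the sign rule on homogeneous tensors); the
   next four present H_n(A,z) over it; the rest adjoin the Laurent polynomials
   and give H_n^aff(A,z).  Relations involving general tensors follow by
   linearity from those for homogeneous entries. *)
Inductive aff_rel n : free n -> free n -> Prop :=
| rel_ten_lin (i : 'I_n) (c : k) (x y : A) (a : 'I_n -> A) :
    aff_rel (ten (upd a i (c *: x + y)))
            (c *: ten (upd a i x) + ten (upd a i y))
| rel_ten1 :
    aff_rel (ten (fun=> 1)) 1
| rel_tenM (p q : 'I_n -> bool) (a c : 'I_n -> A) :
    (forall i, homog (p i) (a i)) -> (forall i, homog (q i) (c i)) ->
    aff_rel (ten a * ten c)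
            ((-1) ^+ (\sum_(i < n) \sum_(j < n | (j < i)%N) (p i && q j)) *:
             ten (fun i => a i * c i))
| rel_TT (i j : 'I_n.-1) : (i.+1 < j)%N ->
    aff_rel (T i * T j) (T j * T i)
| rel_braid (i j : 'I_n.-1) : j = i.+1 :> nat ->
    aff_rel (T i * T j * T i) (T j * T i * T j)
| rel_quad (i : 'I_n.-1) (l u : 'I_n) : l = i :> nat -> u = i.+1 :> nat ->
    aff_rel (T i ^+ 2) (z *: (teleporter l u * T i) + 1)
| rel_Tten (i : 'I_n.-1) (l u : 'I_n) (p q : bool) (a : 'I_n -> A) :
    l = i :> nat -> u = i.+1 :> nat -> homog p (a l) -> homog q (a u) ->
    aff_rel (T i * ten a)
            ((-1) ^+ (p && q) *: ten (fun j => a (tperm l u j)) * T i)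
| rel_XY (j : 'I_n) :
    aff_rel (X j * Y j) 1
| rel_YX (j : 'I_n) :
    aff_rel (Y j * X j) 1
| rel_XX (i j : 'I_n) :
    aff_rel (X i * X j) (X j * X i)
| rel_TX (i : 'I_n.-1) (j : 'I_n) : j <> i :> nat -> j <> i.+1 :> nat ->
    aff_rel (T i * X j) (X j * T i)
| rel_TXT (i : 'I_n.-1) (l u : 'I_n) : l = i :> nat -> u = i.+1 :> nat ->
    aff_rel (T i * X l * T i) (X u)
| rel_Xten (j : 'I_n) (a : 'I_n -> A) :
    aff_rel (X j * ten a) (ten a * X j).

Definition aff_relator n (x : free n) : Prop :=
  exists u v, aff_rel u v /\ x = u - v.

Definition aff_alg n := quot_ring (@aff_relator n).
HB.instance Definition _ n := GRing.PzRing.on (aff_alg n).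

Definition aff_gen n (g : aff_gens A n) : aff_alg n :=
  quot_pi (@aff_relator n) (free_gen k g).

(* [f] lists the coefficients a_(0), ..., a_(d-1); the leading one is 1. *)
Variables (d : nat) (f : 'I_d -> A).

Definition cyc_poly n (i0 : 'I_n) : aff_alg n :=
  aff_gen (gen_X i0) ^+ d +
  \sum_(i < d) aff_gen (gen_ten (at_pos i0 (f i))) * aff_gen (gen_X i0) ^+ i.

(* For n >= 1 there is exactly one [i0], the first position. *)
Definition cyc_relator n (x : aff_alg n) : Prop :=
  exists2 i0 : 'I_n, i0 = 0%N :> nat & x = cyc_poly i0.

Definition cyc_alg n := quot_ring (@cyc_relator n).
HB.instance Definition _ n := GRing.PzRing.on (cyc_alg n).

Definition cyc_pi n : free n -> cyc_alg n :=
  quot_pi (@cyc_relator n) \o quot_pi (@aff_relator n).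
HB.instance Definition _ n := GRing.RMorphism.on (@cyc_pi n).

Definition cyc_gen n (g : aff_gens A n) : cyc_alg n := cyc_pi (free_gen k g).

Definition cyc_scal n : k -> cyc_alg n := @cyc_pi n \o in_alg (free n).
HB.instance Definition _ n := GRing.RMorphism.on (@cyc_scal n).

Lemma cyc_ind n (P : cyc_alg n -> Prop) : (forall x, P (cyc_pi x)) -> forall x, P x.
Proof. by move=> H; elim/quot_ind; elim/quot_ind. Qed.

Lemma cyc_scal_central n c (x : cyc_alg n) : cyc_scal n c * x = x * cyc_scal n c.
Proof.
elim/cyc_ind: x => x; rewrite /cyc_scal /= -!rmorphM.
by rewrite mulr_algl mulr_algr.
Qed.

Lemma cyc_piM n (x y : free n) : cyc_pi (x * y) = cyc_pi x * cyc_pi y.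
Proof. exact: rmorphM. Qed.

Lemma cyc_piD n (x y : free n) : cyc_pi (x + y) = cyc_pi x + cyc_pi y.
Proof. exact: rmorphD. Qed.

Lemma cyc_pi1 n : @cyc_pi n 1 = 1.
Proof. exact: rmorph1. Qed.

Lemma cyc_piZ n c (x : free n) : cyc_pi (c *: x) = cyc_scal n c * cyc_pi x.
Proof. by rewrite -mulr_algl rmorphM. Qed.

Lemma cyc_rel_pi n (x y : free n) : aff_rel x y -> cyc_pi x = cyc_pi y.
Proof.
move=> xy; apply/eqP; rewrite -subr_eq0 -rmorphB; apply/eqP.
have xy0 : quot_pi (@aff_relator n) (x - y) = 0.
  by apply: quot_pi_rel; exists x, y.
by change (quot_pi (@cyc_relator n) (quot_pi _ (x - y)) = 0); rewrite xy0 rmorph0.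
Qed.

Lemma cyc_gen_aff n g : cyc_gen g = quot_pi (@cyc_relator n) (aff_gen g).
Proof. by []. Qed.

Lemma cyc_relE n (i0 : 'I_n) : i0 = 0%N :> nat ->
  cyc_gen (gen_X i0) ^+ d +
  \sum_(i < d) cyc_gen (gen_ten (at_pos i0 (f i))) * cyc_gen (gen_X i0) ^+ i = 0
    :> cyc_alg n.
Proof.
move=> i0E; have : quot_pi (@cyc_relator n) (cyc_poly i0) = 0.
  by apply: quot_pi_rel; exists i0.
move=> f0; apply: etrans f0; rewrite /cyc_poly rmorphD rmorphXn rmorph_sum /=.
by rewrite -cyc_gen_aff; under [in RHS]eq_bigr do rewrite rmorphM rmorphXn /= -!cyc_gen_aff.
Qed.

(* The X_i and T_i are even, and A^{(x)n} has its tensor product parity. *)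
Inductive cyc_homog n : bool -> cyc_alg n -> Prop :=
| cyc_homog0 p : cyc_homog p 0
| cyc_homogD p x y : cyc_homog p x -> cyc_homog p y -> cyc_homog p (x + y)
| cyc_homog_scal c : cyc_homog false (cyc_scal n c)
| cyc_homogM p q x y :
    cyc_homog p x -> cyc_homog q y -> cyc_homog (p (+) q) (x * y)
| cyc_homog_ten (p : 'I_n -> bool) (a : 'I_n -> A) :
    (forall i, homog (p i) (a i)) ->
    cyc_homog (odd (\sum_(i < n) p i)) (cyc_gen (gen_ten a))
| cyc_homog_X i : cyc_homog false (cyc_gen (gen_X i))
| cyc_homog_Xinv i : cyc_homog false (cyc_gen (gen_Xinv i))
| cyc_homog_T i : cyc_homog false (cyc_gen (gen_T i)).

Section Inclusion.
Variable n : nat.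

Definition ext_last (T : Type) (t : T) (a : 'I_n -> T) : 'I_n.+1 -> T :=
  fun i => if unlift ord_max i is Some j then a j else t.

(* The inclusion sends a to a (x) 1 and fixes the X_j and T_i. *)
Definition incl_gen (g : aff_gens A n) : aff_gens A n.+1 :=
  match g with
  | gen_ten a => gen_ten (ext_last 1 a)
  | gen_X j => gen_X (lift ord_max j)
  | gen_Xinv j => gen_Xinv (lift ord_max j)
  | gen_T i => gen_T (n := n.+1) (widen_ord (leq_pred n) i)
  end.

Definition incl_free : free n -> cyc_alg n.+1 :=
  free_eval (@cyc_scal n.+1) (@cyc_gen n.+1 \o incl_gen).

Lemma incl_free_morph : zmod_morphism incl_free /\ monoid_morphism incl_free.
Proof. by apply: free_eval_morph => c x; exact: cyc_scal_central. Qed.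
HB.instance Definition _ := GRing.isZmodMorphism.Build _ _ incl_free incl_free_morph.1.
HB.instance Definition _ := GRing.isMonoidMorphism.Build _ _ incl_free incl_free_morph.2.

Lemma incl_freeZ c x : incl_free (c *: x) = cyc_scal n.+1 c * incl_free x.
Proof. exact: free_evalZ. Qed.

Lemma incl_free_gen g : incl_free (free_gen k g) = cyc_gen (incl_gen g).
Proof. exact: free_eval_gen. Qed.

Lemma ext_lift T (t : T) a j : ext_last t a (lift ord_max j) = a j.
Proof. by rewrite /ext_last liftK. Qed.

Lemma ext_max T (t : T) a : ext_last t a ord_max = t.
Proof. by rewrite /ext_last unlift_none. Qed.

Lemma widen_lift (j : 'I_n) : widen_ord (leqnSn n) j = lift ord_max j.
Proof. by apply: val_inj; rewrite /= /bump leqNgt ltn_ord. Qed.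

Lemma lift_maxE (j : 'I_n) : lift ord_max j = j :> nat.
Proof. by rewrite -widen_lift. Qed.

Lemma ext_funext T (g h : 'I_n.+1 -> T) :
  (forall j, g (lift ord_max j) = h (lift ord_max j)) -> g ord_max = h ord_max ->
  g = h.
Proof. by move=> gh gh'; apply/funext => i; case: (unliftP ord_max i) => [j|] ->. Qed.

Lemma ext_upd (a : 'I_n -> A) i x :
  ext_last 1 (upd a i x) = upd (ext_last 1 a) (lift ord_max i) x.
Proof.
apply: ext_funext => [j|]; rewrite /upd; last by rewrite !ext_max eq_liftF.
by rewrite !ext_lift (inj_eq lift_inj).
Qed.

Lemma ext_at (i : 'I_n) (x : A) : ext_last 1 (at_pos i x) = at_pos (lift ord_max i) x.
Proof.
rewrite /at_pos ext_upd; congr upd.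
by apply: ext_funext => [j|]; rewrite ?ext_lift ?ext_max.
Qed.

Lemma ext_homog (p : 'I_n -> bool) (a : 'I_n -> A) :
  (forall i, homog (p i) (a i)) -> forall i, homog (ext_last false p i) (ext_last 1 a i).
Proof.
move=> pa i; case: (unliftP ord_max i) => [j|] ->; rewrite ?ext_lift ?ext_max //.
exact: par1 homogP.
Qed.

Let sim (x : free n) (x' : free n.+1) := incl_free x = cyc_pi x'.

Let simM x y x' y' : sim x x' -> sim y y' -> sim (x * y) (x' * y').
Proof. by rewrite /sim (rmorphM incl_free) /= cyc_piM => -> ->. Qed.
Let simD x y x' y' : sim x x' -> sim y y' -> sim (x + y) (x' + y').
Proof. by rewrite /sim (rmorphD incl_free) /= cyc_piD => -> ->. Qed.
Let simZ c x x' : sim x x' -> sim (c *: x) (c *: x').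
Proof. by rewrite /sim incl_freeZ cyc_piZ => ->. Qed.
Let sim1 : sim 1 1.
Proof. by rewrite /sim (rmorph1 incl_free) cyc_pi1. Qed.
Let simG g g' : incl_gen g = g' -> sim (free_gen k g) (free_gen k g').
Proof. by move=> <-; exact: incl_free_gen. Qed.

Let sim_teleporter (l u : 'I_n) :
  sim (teleporter l u) (teleporter (lift ord_max l) (lift ord_max u)).
Proof.
apply: (big_ind2 sim) => [|x x' y y'|x _].
- by rewrite /sim (rmorph0 incl_free) -(scale0r 1) cyc_piZ (rmorph0 (cyc_scal _)) mul0r.
- exact: simD.
- by apply: simM; apply: simG; rewrite /= ext_at.
Qed.

Let sim_rel x y x' y' :
  sim x x' -> sim y y' -> aff_rel x' y' -> incl_free x = incl_free y.
Proof. by rewrite /sim => -> -> /cyc_rel_pi. Qed.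

Lemma incl_free_rel x y : aff_rel x y -> incl_free x = incl_free y.
Proof.
case.
- move=> i c {}x {}y a.
  apply: sim_rel (simG _) (simD (simZ c (simG _)) (simG _))
    (rel_ten_lin (lift ord_max i) c x y (ext_last 1 a)) => /=; by rewrite ext_upd.
- apply: sim_rel (simG _) sim1 (rel_ten1 _) => /=; congr gen_ten.
  by apply: ext_funext => [j|]; rewrite ?ext_lift ?ext_max.
- move=> p q a c pa qc.
  apply: sim_rel (simM (simG _) (simG _)) (simZ _ (simG (erefl _))) _ => /=; [by []..|].
  have -> : (\sum_(i < n) \sum_(j < n | (j < i)%N) (p i && q j)
             = \sum_(i < n.+1) \sum_(j < n.+1 | (j < i)%N)
               (ext_last false p i && ext_last false q j))%N.
    rewrite [RHS]big_ord_recr /= [V in (_ + V)%N]big1 ?addn0; last first.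
      by move=> j _; rewrite ext_max.
    apply: eq_bigr => i _; rewrite [RHS]big_mkcond big_ord_recr /=.
    rewrite ltnNge ltnW //= addn0 [LHS]big_mkcond /=; apply: eq_bigr => j _.
    by rewrite !widen_lift !ext_lift.
  have -> : ext_last 1 (fun i => a i * c i)
            = (fun i => ext_last 1 a i * ext_last 1 c i).
    by apply: ext_funext => [j|]; rewrite ?ext_lift ?ext_max ?mulr1.
  exact: rel_tenM (ext_homog pa) (ext_homog qc).
- move=> i j ij.
  by apply: sim_rel (simM (simG _) (simG _)) (simM (simG _) (simG _)) (rel_TT _).
- move=> i j ij.
  by apply: sim_rel (simM (simM (simG _) (simG _)) (simG _))
    (simM (simM (simG _) (simG _)) (simG _)) (rel_braid _).
- move=> i l u li ui; rewrite expr2.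
  apply: sim_rel (simM (simG (erefl _)) (simG (erefl _)))
    (simD (simZ z (simM (sim_teleporter l u) (simG (erefl _)))) sim1) _.
  by rewrite -expr2; apply: rel_quad; rewrite lift_maxE.
- move=> i l u p q a li ui pa qa.
  apply: sim_rel (simM (simG (erefl _)) (simG (erefl _)))
    (simM (simZ _ (simG (erefl _))) (simG (erefl _))) _ => /=.
  have -> : ext_last 1 (fun j => a (tperm l u j))
      = (fun j => ext_last 1 a (tperm (lift ord_max l) (lift ord_max u) j)).
    apply: ext_funext => [j|]; rewrite ?ext_lift ?ext_max.
      by rewrite -(inj_tperm _ _ _ (@lift_inj _ ord_max)) ext_lift.
    by rewrite tpermD ?ext_max // eq_sym eq_liftF.
  by apply: rel_Tten; rewrite ?lift_maxE ?ext_lift.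
- by move=> j; apply: sim_rel (simM (simG _) (simG _)) sim1 (rel_XY _).
- by move=> j; apply: sim_rel (simM (simG _) (simG _)) sim1 (rel_YX _).
- move=> i j.
  by apply: sim_rel (simM (simG _) (simG _)) (simM (simG _) (simG _)) (rel_XX _ _).
- move=> i j ji ji1.
  apply: sim_rel (simM (simG (erefl _)) (simG (erefl _)))
    (simM (simG (erefl _)) (simG (erefl _))) _ => /=.
  by apply: rel_TX; rewrite lift_maxE.
- move=> i l u li ui.
  apply: sim_rel (simM (simM (simG (erefl _)) (simG (erefl _))) (simG (erefl _)))
    (simG (erefl _)) _ => /=.
  by apply: rel_TXT; rewrite lift_maxE.
- move=> j a.
  by apply: sim_rel (simM (simG _) (simG _)) (simM (simG _) (simG _)) (rel_Xten _ _).
Qed.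

Lemma incl_free_relator x : aff_relator x -> incl_free x = 0.
Proof. by move=> [u [v [uv ->]]]; rewrite rmorphB /= (incl_free_rel uv) subrr. Qed.

Definition incl_aff : aff_alg n -> cyc_alg n.+1 := quot_lift incl_free.
Lemma incl_aff_morph : zmod_morphism incl_aff /\ monoid_morphism incl_aff.
Proof. exact/quot_lift_morph/incl_free_relator. Qed.
HB.instance Definition _ := GRing.isZmodMorphism.Build _ _ incl_aff incl_aff_morph.1.
HB.instance Definition _ := GRing.isMonoidMorphism.Build _ _ incl_aff incl_aff_morph.2.

Lemma incl_aff_gen g : incl_aff (aff_gen g) = cyc_gen (incl_gen g).
Proof. exact: etrans (quot_liftE incl_free_relator _) (incl_free_gen g). Qed.

Lemma incl_aff_relator x : cyc_relator x -> incl_aff x = 0.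
Proof.
move=> [i0 i00 ->]; apply: etrans (@cyc_relE _ (lift ord_max i0) _); last first.
  by rewrite lift_maxE.
rewrite /cyc_poly (rmorphD incl_aff) (rmorphXn incl_aff) (rmorph_sum incl_aff) /=.
rewrite incl_aff_gen /=; congr (_ + _); apply: eq_bigr => i _.
by rewrite (rmorphM incl_aff) (rmorphXn incl_aff) /= !incl_aff_gen /= ext_at.
Qed.

Definition cyc_incl : cyc_alg n -> cyc_alg n.+1 := quot_lift incl_aff.
Lemma cyc_incl_morph : zmod_morphism cyc_incl /\ monoid_morphism cyc_incl.
Proof. exact/quot_lift_morph/incl_aff_relator. Qed.
HB.instance Definition _ := GRing.isZmodMorphism.Build _ _ cyc_incl cyc_incl_morph.1.
HB.instance Definition _ := GRing.isMonoidMorphism.Build _ _ cyc_incl cyc_incl_morph.2.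

Lemma cyc_incl_pi x : cyc_incl (cyc_pi x) = incl_free x.
Proof.
apply: etrans (quot_liftE incl_aff_relator _) _.
exact: quot_liftE incl_free_relator _.
Qed.

Lemma cyc_incl_gen g : cyc_incl (cyc_gen g) = cyc_gen (incl_gen g).
Proof. exact: etrans (cyc_incl_pi _) (incl_free_gen g). Qed.

Lemma cyc_incl_scal c : cyc_incl (cyc_scal n c) = cyc_scal n.+1 c.
Proof.
apply: etrans (cyc_incl_pi _) _.
by rewrite incl_freeZ (rmorph1 incl_free) mulr1.
Qed.

End Inclusion.

Section PartialTrace.
Variables (tr : A -> k) (n : nat).

(* [AH_sum] and [HTH_sum] describe the general elements of A_{n+1} H_n^f and
   H_n^f T_n H_n^f, with n shifted by one. *)
Definition AH_sum (s : seq (A * cyc_alg n.+1)) : cyc_alg n.+2 :=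
  \sum_(p <- s) cyc_gen (gen_ten (at_pos ord_max p.1)) * cyc_incl p.2.

Definition HTH_sum (s : seq (cyc_alg n.+1 * cyc_alg n.+1)) : cyc_alg n.+2 :=
  \sum_(p <- s) cyc_incl p.1 * cyc_gen (gen_T (n := n.+2) ord_max) * cyc_incl p.2.

Definition ptrace_graph (x : cyc_alg n.+2) (y : cyc_alg n.+1) : Prop :=
  exists (s0 : seq (A * cyc_alg n.+1)) (s : nat -> seq (A * cyc_alg n.+1))
         (t : seq (cyc_alg n.+1 * cyc_alg n.+1)),
    x = AH_sum s0
        + \sum_(1 <= r < d) cyc_gen (gen_X ord_max) ^+ r * AH_sum (s r)
        + HTH_sum t
    /\ y = \sum_(p <- s0) cyc_scal n.+1 (tr p.1) * p.2.

(* By the direct sum decomposition of H_{n+1}^f, [ptrace_graph] is the graph of a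
   function; [xget] turns it into that function. *)
Definition ptrace (x : cyc_alg n.+2) : cyc_alg n.+1 :=
  xget 0 [set y | ptrace_graph x y]%classic.

End PartialTrace.

End QuantumWreath.

Section SymmetricSuperalgebra.
Variables (k : comNzRingType) (A : superalgType k).

Record symmetric_superalgebra (tr : {scalar A}) : Prop := SymmetricSuperalgebra {
  tr_even : forall x, homog true x -> tr x = 0;
  tr_supersym : forall p q x y, homog p x -> homog q y ->
    tr (x * y) = (-1) ^+ (p && q) * tr (y * x);
  tr_iso : forall phi : {scalar A}, exists! x, forall y, phi y = tr (x * y)
}.

Definition homogeneous_basis (B : finType) (b : B -> A) : Prop :=
  (forall i, exists p, homog p (b i)) /\
  (forall x, exists! c : {ffun B -> k}, x = \sum_i c i *: b i).

Definition super_center (p : bool) (x : A) : Prop :=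
  homog p x /\
  forall q y, homog q y -> x * y = (-1) ^+ (p && q) * (y * x).

End SymmetricSuperalgebra.

Section Modules.
Variables (R : pzRingType).

Definition fin_generated (M : lmodType R) : Prop :=
  exists (m : nat) (g : 'I_m -> M), forall x, exists c : 'I_m -> R,
    x = \sum_(i < m) c i *: g i.

Definition projective (M : lmodType R) : Prop :=
  forall (N N' : lmodType R) (g : {linear N -> N'}) (h : {linear M -> N'}),
    (forall y, exists x, g x = y) ->
    exists h' : {linear M -> N}, forall x, g (h' x) = h x.

End Modules.

(* S as a right R-module along i, i.e. as a left module over R^c. *)
Definition right_restr (R S : pzRingType) of {rmorphism R -> S} : Type := S.

Section RightRestriction.
Variables (R S : pzRingType) (i : {rmorphism R -> S}).

HB.instance Definition _ := GRing.Zmodule.copy (right_restr i) S.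

Definition right_scale (r : R^c) (s : right_restr i) : right_restr i :=
  (s : S) * i r.

Fact right_scaleA r r' s : right_scale r (right_scale r' s) = right_scale (r * r') s.
Proof. by rewrite /right_scale -mulrA -rmorphM. Qed.
Fact right_scale1 : left_id 1 right_scale.
Proof. by move=> s; rewrite /right_scale rmorph1 mulr1. Qed.
Fact right_scaleDr : right_distributive right_scale +%R.
Proof. by move=> r s s'; rewrite /right_scale mulrDl. Qed.
Fact right_scaleDl s : {morph right_scale^~ s : r r' / r + r'}.
Proof. by move=> r r'; rewrite /right_scale rmorphD mulrDr. Qed.
HB.instance Definition _ := GRing.Zmodule_isLmodule.Build R^c (right_restr i)
  right_scaleA right_scale1 right_scaleDr right_scaleDl.

Definition right_linear (phi : S -> R) : Prop :=
  forall s t r, phi (s * i r + t) = phi s * r + phi t.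

End RightRestriction.

(* For every s, right R-linearity of t |-> theta (s * t) follows from
   [frob_trD] and [frob_trMr], so [frob_iso] says that s |-> theta (s * _) is a
   bijection from S onto the right R-linear maps S -> R. *)
Record frobenius_extension (k : comNzRingType) (R S : pzRingType)
    (etaR : k -> R) (etaS : k -> S)
    (parR : bool -> R -> Prop) (parS : bool -> S -> Prop)
    (i : {rmorphism R -> S}) (theta : S -> R) : Prop := FrobeniusExtension {
  frob_superR : superalgebra etaR parR;
  frob_superS : superalgebra etaS parS;
  frob_incl_inj : injective i;
  frob_incl_scal : forall c, i (etaR c) = etaS c;
  frob_incl_par : forall p x, parR p x -> parS p (i x);
  frob_trD : {morph theta : s t / s + t};
  frob_trMl : forall r s, theta (i r * s) = r * theta s;
  frob_trMr : forall s r, theta (s * i r) = theta s * r;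
  frob_tr_par : forall p s, parS p s -> parR p (theta s);
  frob_fg : fin_generated (right_restr i : lmodType R^c);
  frob_proj : projective (right_restr i : lmodType R^c);
  frob_iso : forall phi : S -> R, right_linear i phi ->
    exists! s, forall t, phi t = theta (s * t)
}.

(* Main.v *)
(* H = H_{n+1}^f embeds in H' = H_{n+2}^f (strands numbered from 0), and the module
   H' should be free on e_{i,s,y} = X_i^s (b_y)_i T_i ... T_n with 0 <= i <= n+1,
   0 <= s < d.  That these elements span, on either side, follows from the Demazure
   relations between T_i and X_i^s, X_{i+1}^s.

   No basis theorem is assumed: the partial trace is constructed from an explicit
   representation of H' by (n+2) x (n+2) matrices over polynomials mod f with
   coefficients in matrices over H, which models the right H-module H'.  It yields an
   (H, H)-bilinear map theta : H' -> H with theta(T_n) = 0 and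
   theta(T_n ... T_0 X_0^r a_0 T_0 ... T_n) = delta_{r,0} tr(a) for r < d and
   - tr(f_0 a) for r = d.  By induction on m the same values are obtained for
   theta(T_n ... T_m X_m^r a_m T_m ... T_n), and the mixed products between different
   strands vanish; at m = n+1 this shows that theta is the partial trace.

   Consequently the elements T_n ... T_i (b_y^vee)_i (for s = 0) and
   - T_n ... T_i X_i^(d-s) (f_0^-1 b_y^vee)_i (for s > 0) pair with the e_{i,s,y}
   through a matrix that is unitriangular with respect to s.  Two spanning families
   with a unitriangular pairing give dual bases, hence projectivity and the Frobenius
   isomorphism. *)
Require Import Defs.
From HB Require Import structures.
From mathcomp Require Import all_boot perm all_algebra.
From mathcomp Require Import finmap boolp classical_sets zify.
From mathcomp.multinomials Require Import monalg.

Set Implicit Arguments.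
Unset Strict Implicit.
Unset Printing Implicit Defensive.

Import GRing.Theory.
Local Open Scope ring_scope.

(** * Parity and dual bases in A *)

(** Two circularities shape the argument. A model of H' over H would normally rest on a basis of H,
    and the sign rule between the new copy of A and H would use that the two parities of H are
    independent, which is itself part of the claim. Both are avoided by defining maps through
    presentations only: a morphism out of H or H' is obtained by checking the list [wreath_rep],
    whose generators are the copies of A, the T_i and X_0 (strands numbered from 0). Matrices of
    size [#|B|] over H stand for A (x) H. An odd element of H acts there together with the parity
    operator of A, so that it supercommutes with left multiplication by A. This twist is defined on
    generators, and the same twist with a 2 x 2 flip shows that an element of H which is both even
    and odd is zero. In the model of H' the hard generator is X_0. Moving it past T_0 produces the
    operator p(X) |-> X p(y) - y p(X), where y is the action of X_0 in H on the right. This is why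
    the substitution X := y occurs as an operator. The relation between X_0 and T_0 then comes down
    to a commutation identity for T_0 and the powers of y in H. *)

Section SuperalgebraParts.
Variables (k : comNzRingType) (A : superalgType k).
Implicit Types x y : A.

Lemma homog0 p : homog p (0 : A).
Proof. exact: par0 homogP p. Qed.

Lemma homog1 : homog false (1 : A).
Proof. exact: par1 homogP. Qed.

Lemma homogZD p c x y : homog p x -> homog p y -> homog p (c *: x + y).
Proof. by move=> px py; have := parZD homogP c px py; rewrite /= mulr_algl. Qed.

Lemma homogD p x y : homog p x -> homog p y -> homog p (x + y).
Proof. by move=> px py; rewrite -[x]scale1r; apply: homogZD. Qed.

Lemma homogZ p c x : homog p x -> homog p (c *: x).
Proof. by move=> px; have := homogZD c px (homog0 p); rewrite addr0. Qed.

Lemma homogN p x : homog p x -> homog p (- x).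
Proof. by rewrite -scaleN1r; exact: homogZ. Qed.

Lemma homogB p x y : homog p x -> homog p y -> homog p (x - y).
Proof. by move=> px py; apply: homogD => //; apply: homogN. Qed.

Lemma homogM p q x y : homog p x -> homog q y -> homog (p (+) q) (x * y).
Proof. by move=> px qy; exact: (parM homogP px qy). Qed.

Lemma homog_part_exists x :
  exists y : A * A, [/\ homog false y.1, homog true y.2 & x = y.1 + y.2].
Proof. by have [x0 [x1 ?]] := par_decomp homogP x; exists (x0, x1). Qed.

Definition part (p : bool) x : A :=
  let y := sval (cid (homog_part_exists x)) in if p then y.2 else y.1.

Lemma part_homog p x : homog p (part p x).
Proof. by rewrite /part; case: cid => y /= [? ? _]; case: p. Qed.

Lemma part_sum x : part false x + part true x = x.
Proof. by rewrite /part; case: cid => y /= [? ? ->]. Qed.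

Lemma part_uniq x y0 y1 :
  homog false y0 -> homog true y1 -> x = y0 + y1 -> forall p, part p x = if p then y1 else y0.
Proof.
move=> h0 h1 xE.
have E : part false x - y0 = y1 - part true x.
  by apply/eqP; rewrite subr_eq addrAC eq_sym subr_eq addrC part_sum xE addrC.
have Z : part false x - y0 = 0.
  apply: (par_direct homogP); first exact: homogB (part_homog _ _) h0.
  by rewrite E; apply: homogB h1 (part_homog _ _).
case; last by apply/eqP; rewrite -subr_eq0 Z.
by apply/esym/eqP; rewrite -subr_eq0 -E Z.
Qed.

Lemma part_id p x : homog p x -> part p x = x.
Proof.
case: p => px.
  by rewrite (part_uniq (homog0 _) px (esym (add0r x))).
by rewrite (part_uniq px (homog0 _) (esym (addr0 x))).
Qed.

Lemma part_neq p x : homog p x -> part (~~ p) x = 0.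
Proof.
case: p => px.
  by rewrite (part_uniq (homog0 _) px (esym (add0r x))).
by rewrite (part_uniq px (homog0 _) (esym (addr0 x))).
Qed.

Lemma partP p c x y : part p (c *: x + y) = c *: part p x + part p y.
Proof.
rewrite (part_uniq (y0 := c *: part false x + part false y)
  (y1 := c *: part true x + part true y)); first by case: p.
- exact: homogZD (part_homog _ _) (part_homog _ _).
- exact: homogZD (part_homog _ _) (part_homog _ _).
- by rewrite addrACA -scalerDr !part_sum.
Qed.

End SuperalgebraParts.

Section SymmetricSuperalgebra.
Variables (k : comNzRingType) (A : superalgType k).
Variables (tr : {scalar A}) (symA : symmetric_superalgebra tr).
Variables (B : finType) (b bd : B -> A) (basis_b : homogeneous_basis b).
Hypothesis dual_bd : forall i j, tr (bd i * b j) = (i == j)%:R.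

Lemma tr_sum (I : finType) (g : I -> A) : tr (\sum_i g i) = \sum_i tr (g i).
Proof. exact: raddf_sum. Qed.

Lemma trZ c x : tr (c *: x) = c * tr x.
Proof. exact: linearZ. Qed.

Lemma basis_coord x : x = \sum_i tr (bd i * x) *: b i.
Proof.
have [c [xE _]] := basis_b.2 x; rewrite {1}xE; apply: eq_bigr => i _.
congr (_ *: _); rewrite xE mulr_sumr tr_sum (bigD1 i) //= -scalerAr trZ dual_bd eqxx mulr1.
by rewrite big1 ?addr0 // => j /negPf ji; rewrite -scalerAr trZ dual_bd eq_sym ji mulr0.
Qed.

(** Both [x] and 0 represent the zero functional, and [tr_iso] contains uniqueness. *)
Lemma tr_nondeg x : (forall i, tr (x * b i) = 0) -> x = 0.
Proof.
move=> x0; have xy0 y : tr (x * y) = 0.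
  rewrite [y]basis_coord mulr_sumr tr_sum big1 // => i _.
  by rewrite -scalerAr trZ x0 mulr0.
pose phi : {scalar A} := \0.
have [u [_ uniq_u]] := tr_iso symA phi.
rewrite -(uniq_u x) => [|y]; last by rewrite xy0.
by apply: uniq_u => y; rewrite mul0r linear0.
Qed.

Lemma dual_coord x : x = \sum_i tr (x * b i) *: bd i.
Proof.
apply/eqP; rewrite -subr_eq0; apply/eqP/tr_nondeg => j.
rewrite mulrBl raddfB /= mulr_suml tr_sum (bigD1 j) //= -scalerAl trZ dual_bd eqxx mulr1.
rewrite big1 ?addr0 ?subrr // => i /negPf ij.
by rewrite -scalerAl trZ dual_bd ij mulr0.
Qed.

Definition bpar i : bool := `[< homog true (b i) >].

Lemma bpar_homog i : homog (bpar i) (b i).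
Proof.
rewrite /bpar; case: asboolP => // nh.
by have [[] //] := basis_b.1 i.
Qed.

Lemma tr_odd p x : homog p x -> p -> tr x = 0.
Proof. by case: p => // px _; apply: (tr_even symA). Qed.

(** The part of the wrong parity pairs to zero with every [b j]. If [b j] has the parity of [b i],
    the product is odd. Otherwise the other part of [bd i] gives an odd product, and the full
    pairing is zero because [i != j]. *)
Lemma bd_homog i : homog (bpar i) (bd i).
Proof.
set p := bpar i.
suff z0 : part (~~ p) (bd i) = 0.
  rewrite -(part_sum (bd i)); move: z0 (part_homog p (bd i)).
  by case: p => /= ->; rewrite ?addr0 ?add0r.
apply: tr_nondeg => j; have [e|ne] := eqVneq (bpar j) p.
  by apply: (tr_odd (homogM (part_homog (~~ p) (bd i)) (bpar_homog j))); rewrite e; case: (p).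
have := dual_bd i j; have /negPf -> : i != j by apply: contraNneq ne => <-.
have e : bpar j = ~~ p by case: (bpar j) (p) ne => [] [].
rewrite -{1}(part_sum (bd i)) mulrDl raddfD /=.
have := homogM (part_homog p (bd i)) (bpar_homog j); rewrite e => ho.
have := tr_odd ho; rewrite addbN addbb => /(_ isT).
by case: (p) => /= ->; rewrite ?addr0 ?add0r.
Qed.

(** Up to a sign, [b] is dual to [bd]. Supersymmetry turns the coefficient into a coordinate of
    [bd i], and unequal parities make both vanish. *)
Lemma dual_dual i : \sum_j (-1) ^+ bpar j * tr (bd i * bd j) *: b j = bd i.
Proof.
rewrite [RHS]basis_coord; apply: eq_bigr => j _; congr (_ *: _).
rewrite (tr_supersym symA (bd_homog j) (bd_homog i)).
have [|ne] := eqVneq (bpar i) (bpar j); first by move=> ->; rewrite andbb.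
rewrite (tr_odd (homogM (bd_homog i) (bd_homog j))) ?mulr0 //.
by case: (bpar i) (bpar j) ne => [] [].
Qed.

End SymmetricSuperalgebra.

Lemma comm_sign (R : pzRingType) (x : R) m : GRing.comm x ((-1) ^+ m).
Proof. exact/commrX/commrN1. Qed.

(** * Copies of A in a ring and their teleporters *)

Section AlgebraMaps.
Variables (k : comNzRingType) (A : superalgType k).
Variables (R : pzRingType) (eta : k -> R).

Record alg_map (g : A -> R) : Prop := AlgMap {
  alg_mapP : forall c x y, g (c *: x + y) = eta c * g x + g y;
  alg_map1 : g 1 = 1;
  alg_mapM : forall x y, g (x * y) = g x * g y
}.

Definition supercomm (g h : A -> R) : Prop := forall p q x y,
  homog p x -> homog q y -> g x * h y = (-1) ^+ (p && q) * (h y * g x).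

Lemma supercomm_sym g h : supercomm g h -> supercomm h g.
Proof.
by move=> gh p q x y px qy; rewrite (gh q p y x qy px) mulrA -signr_addb andbC addbb mul1r.
Qed.

End AlgebraMaps.

Section AlgebraMapTheory.
Variables (k : comNzRingType) (A : superalgType k).
Variables (R : pzRingType) (eta : {rmorphism k -> R}).
Variables (g : A -> R) (gP : alg_map eta g).

Lemma alg_map0 : g 0 = 0.
Proof.
have := alg_mapP gP 1 0 0; rewrite scaler0 addr0 rmorph1 mul1r => e.
by apply: (addrI (g 0)); rewrite addr0 -e.
Qed.

Lemma alg_mapD x y : g (x + y) = g x + g y.
Proof. by have := alg_mapP gP 1 x y; rewrite scale1r rmorph1 mul1r. Qed.

Lemma alg_mapZ c x : g (c *: x) = eta c * g x.
Proof. by have := alg_mapP gP c x 0; rewrite alg_map0 !addr0. Qed.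

Lemma alg_mapN x : g (- x) = - g x.
Proof. by rewrite -scaleN1r alg_mapZ rmorphN rmorph1 mulN1r. Qed.

Lemma alg_map_sum (I : finType) (F : I -> A) : g (\sum_i F i) = \sum_i g (F i).
Proof. exact: (big_morph g alg_mapD alg_map0). Qed.

Lemma alg_map_part x : g x = g (part false x) + g (part true x).
Proof. by rewrite -alg_mapD part_sum. Qed.

End AlgebraMapTheory.

Lemma alg_map_intertwine (k : comNzRingType) (A : superalgType k) (R : pzRingType)
    (eta : {rmorphism k -> R}) (c : R) (g h : A -> R) :
  alg_map eta g -> alg_map eta h -> (forall p x, homog p x -> c * g x = h x * c) ->
  forall x, c * g x = h x * c.
Proof.
move=> gP hP H x; rewrite (alg_map_part gP) (alg_map_part hP) mulrDr mulrDl.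
by rewrite !(H _ _ (part_homog _ _)).
Qed.

Lemma alg_map_homog (k : comNzRingType) (A : superalgType k) (R : pzRingType)
    (eta : {rmorphism k -> R}) (g : A -> R) :
  (forall c x y, g (c *: x + y) = eta c * g x + g y) -> g 1 = 1 ->
  (forall p q x y, homog p x -> homog q y -> g (x * y) = g x * g y) -> alg_map eta g.
Proof.
move=> gL g1 gM.
have D x y : g (x + y) = g x + g y by have := gL 1 x y; rewrite scale1r rmorph1 mul1r.
split=> // x y; rewrite -(part_sum x) -(part_sum y) mulrDl !mulrDr !D mulrDl !mulrDr.
by rewrite !(gM _ _ _ _ (part_homog _ _) (part_homog _ _)).
Qed.

Section Teleporters.
Variables (k : comNzRingType) (A : superalgType k).
Variables (tr : {scalar A}) (symA : symmetric_superalgebra tr).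
Variables (B : finType) (b bd : B -> A) (basis_b : homogeneous_basis b).
Hypothesis dual_bd : forall i j, tr (bd i * b j) = (i == j)%:R.
Variables (R : pzRingType) (eta : {rmorphism k -> R}).
Hypothesis etaC : forall c x, eta c * x = x * eta c.
Implicit Types g h l : A -> R.

(** The teleporter between two arbitrary maps of A into the same ring, so that one computation
    serves both for two strands and for a strand and the extra copy [al]. *)
Definition tele g h : R := \sum_x g (b x) * h (bd x).

(** Expanding [a * b x] in the basis and [bd y * a] in the dual basis produces the same structure
    constants tr(b_y^vee a b_x). *)
Lemma teleMl g h a : alg_map eta g -> alg_map eta h -> g a * tele g h = tele g h * h a.
Proof.
move=> gP hP; rewrite mulr_sumr mulr_suml.
transitivity (\sum_x \sum_y eta (tr (bd y * (a * b x))) * (g (b y) * h (bd x))).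
  apply: eq_bigr => x _; rewrite mulrA -(alg_mapM gP) {1}(basis_coord basis_b dual_bd (a * b x)).
  rewrite (alg_map_sum gP) mulr_suml; apply: eq_bigr => y _.
  by rewrite (alg_mapZ gP) -mulrA.
rewrite exchange_big; apply: eq_bigr => y _.
rewrite -mulrA -(alg_mapM hP) {1}(dual_coord symA basis_b dual_bd (bd y * a)).
rewrite (alg_map_sum hP) mulr_sumr; apply: eq_bigr => x _.
by rewrite (alg_mapZ hP) !mulrA -etaC.
Qed.

Lemma tele_sym g h : alg_map eta g -> alg_map eta h -> supercomm g h -> tele h g = tele g h.
Proof.
move=> gP hP gh.
transitivity (\sum_x \sum_y eta ((-1) ^+ bpar b x * tr (bd y * bd x)) * (g (b y) * h (b x))).
  apply: eq_bigr => x _.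
  rewrite (supercomm_sym gh (bpar_homog basis_b x) (bd_homog symA basis_b dual_bd x)) andbb.
  rewrite {1}(basis_coord basis_b dual_bd (bd x)) (alg_map_sum gP) mulr_suml mulr_sumr.
  apply: eq_bigr => y _; rewrite (alg_mapZ gP) rmorphM rmorph_sign !mulrA.
  by [].
rewrite exchange_big; apply: eq_bigr => y _.
rewrite -{2}(dual_dual symA basis_b dual_bd y) (alg_map_sum hP) mulr_sumr.
by apply: eq_bigr => x _; rewrite (alg_mapZ hP) !mulrA etaC.
Qed.

Lemma teleMr g h a : alg_map eta g -> alg_map eta h -> supercomm g h ->
  h a * tele g h = tele g h * g a.
Proof. by move=> gP hP gh; rewrite -(tele_sym gP hP gh) teleMl. Qed.

Lemma tele_comm q c g h :
  (forall p x, homog p x -> c * g x = (-1) ^+ (p && q) * (g x * c)) ->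
  (forall p x, homog p x -> c * h x = (-1) ^+ (p && q) * (h x * c)) ->
  GRing.comm c (tele g h).
Proof.
move=> cg ch; rewrite /GRing.comm mulr_sumr mulr_suml; apply: eq_bigr => x _.
rewrite mulrA (cg _ _ (bpar_homog basis_b x)) -!mulrA.
rewrite (ch _ _ (bd_homog symA basis_b dual_bd x)).
by rewrite [g (b x) * _]mulrA (comm_sign (g (b x))) !mulrA -expr2 sqrr_sign mul1r.
Qed.

Lemma tele_comm0 c g h : (forall x, GRing.comm c (g x)) -> (forall x, GRing.comm c (h x)) ->
  GRing.comm c (tele g h).
Proof. by move=> cg ch; apply: (@tele_comm false) => p x _; rewrite andbF expr0 mul1r; [exact: cg|exact: ch]. Qed.

Lemma supercomm_tele g h l a : alg_map eta g ->
  supercomm g h -> supercomm g l -> GRing.comm (g a) (tele h l).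
Proof.
move=> gP gh gl; rewrite (alg_map_part gP).
have H p : GRing.comm (g (part p a)) (tele h l).
  apply: (@tele_comm p) => q x qx; rewrite andbC; first exact: gh (part_homog _ _) qx.
  exact: gl (part_homog _ _) qx.
by apply/commr_sym/commrD; apply/commr_sym/H.
Qed.

(** Termwise, the image under [g] of a dual basis vector is not moved: [g (b x)] absorbed by the
    teleporter reappears as [h (b x)], which with [l (bd x)] rebuilds the teleporter of [h] and
    [l]. *)
Lemma tele_tele g h l : alg_map eta g -> alg_map eta h -> alg_map eta l ->
    supercomm g h -> supercomm g l -> supercomm h l ->
  tele g h * tele g l = tele h l * tele g h.
Proof.
move=> gP hP lP gh gl hl; rewrite mulr_sumr mulr_suml; apply: eq_bigr => x _.
rewrite mulrA -(teleMr _ gP hP gh) -!mulrA; congr (_ * _).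
by apply/esym/supercomm_tele => //; apply: supercomm_sym.
Qed.

Lemma super_center_tele g h a : alg_map eta g -> alg_map eta h -> supercomm g h ->
  super_center false a -> h a * tele g h = tele g h * h a.
Proof.
move=> gP hP gh [a0 aC]; rewrite mulr_sumr mulr_suml; apply: eq_bigr => x _.
rewrite mulrA (supercomm_sym gh a0 (bpar_homog basis_b x)) expr0 mul1r -!mulrA -!(alg_mapM hP).
by rewrite (aC _ _ (bd_homog symA basis_b dual_bd x)) expr0 mul1r.
Qed.

End Teleporters.

(** * A reduced presentation of the cyclotomic algebra *)

Section WreathRep.
Variables (k : comNzRingType) (A : superalgType k).
Variables (B : finType) (b bd : B -> A) (z : k) (d : nat) (f : 'I_d -> A).

(* A presentation of H_{n+1}^f(A,z) by the n+1 copies of A, the T_i and X_1 only: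
   the elements [phi i a], [T i] and [x] stand for a_{i+1}, T_{i+1} and X_1. *)
Record wreath_rep (R : pzRingType) (eta : {rmorphism k -> R}) (n : nat)
    (phi : nat -> A -> R) (T : nat -> R) (x : R) : Prop := WreathRep {
  rep_eta : forall c y, eta c * y = y * eta c;
  rep_alg : forall i, (i <= n)%N -> alg_map eta (phi i);
  rep_sc : forall i j, (i <= n)%N -> (j <= n)%N -> i != j -> supercomm (phi i) (phi j);
  rep_TT : forall i j, (i.+1 < j)%N -> (j < n)%N -> T i * T j = T j * T i;
  rep_braid : forall i, (i.+1 < n)%N -> T i * T i.+1 * T i = T i.+1 * T i * T i.+1;
  rep_quad : forall i, (i < n)%N ->
    T i * T i = eta z * (tele b bd (phi i) (phi i.+1) * T i) + 1;
  rep_Tl : forall i a, (i < n)%N -> T i * phi i a = phi i.+1 a * T i;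
  rep_Tu : forall i a, (i < n)%N -> T i * phi i.+1 a = phi i a * T i;
  rep_Tphi : forall i j a, (i < n)%N -> (j <= n)%N -> j != i -> j != i.+1 ->
    T i * phi j a = phi j a * T i;
  rep_xT : forall i, (0 < i < n)%N -> x * T i = T i * x;
  rep_xTx : (0 < n)%N -> x * T 0 * x * T 0 = T 0 * x * T 0 * x;
  rep_xphi : forall i a, (i <= n)%N -> x * phi i a = phi i a * x;
  rep_f : x ^+ d + \sum_(r < d) phi 0%N (f r) * x ^+ r = 0
}.

Lemma alg_map_rmorph (R S : pzRingType) (eta : {rmorphism k -> R}) (eta' : {rmorphism k -> S})
    (L : {rmorphism R -> S}) (g : A -> R) :
  (forall c, L (eta c) = eta' c) -> alg_map eta g -> alg_map eta' (L \o g).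
Proof.
move=> Le gP; split=> [c x y||x y] /=.
- by rewrite (alg_mapP gP) rmorphD rmorphM Le.
- by rewrite (alg_map1 gP) rmorph1.
- by rewrite (alg_mapM gP) rmorphM.
Qed.

Lemma supercomm_rmorph (R S : pzRingType) (L : {rmorphism R -> S}) (g h : A -> R) :
  supercomm g h -> supercomm (L \o g) (L \o h).
Proof. by move=> gh p q x y px qy /=; rewrite -(rmorphM L) (gh p q x y px qy) !(rmorphM L) (rmorphXn L) (rmorphN1 L). Qed.

Lemma tele_rmorph (R S : pzRingType) (L : {rmorphism R -> S}) (g h : A -> R) :
  L (tele b bd g h) = tele b bd (L \o g) (L \o h).
Proof. by rewrite rmorph_sum; apply: eq_bigr => x _; rewrite rmorphM. Qed.

Lemma rep_rmorph (R S : pzRingType) (eta : {rmorphism k -> R}) (eta' : {rmorphism k -> S})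
    (L : {rmorphism R -> S}) n phi T x :
  (forall c, L (eta c) = eta' c) -> (forall c y, eta' c * y = y * eta' c) ->
  wreath_rep eta n phi T x -> wreath_rep eta' n (fun i => L \o phi i) (L \o T) (L x).
Proof.
move=> Le eC r; split => //=.
- by move=> i /(rep_alg r); apply: alg_map_rmorph.
- by move=> i j ni nj ij; apply/supercomm_rmorph/(rep_sc r).
- by move=> i j ij jn; rewrite -!rmorphM (rep_TT r).
- by move=> i n1; rewrite -!rmorphM (rep_braid r).
- by move=> i n1; rewrite -tele_rmorph -rmorphM (rep_quad r) // rmorphD !rmorphM rmorph1 Le.
- by move=> i a n1; rewrite -!rmorphM (rep_Tl r).
- by move=> i a n1; rewrite -!rmorphM (rep_Tu r).
- by move=> i j a *; rewrite -!rmorphM (rep_Tphi r).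
- by move=> i ?; rewrite -!rmorphM (rep_xT r).
- by move=> ?; rewrite -!rmorphM (rep_xTx r).
- by move=> i a ?; rewrite -!rmorphM (rep_xphi r).
rewrite -[RHS](rmorph0 L) -(rep_f r) rmorphD rmorphXn rmorph_sum; congr (_ + _).
by apply: eq_bigr => i _; rewrite rmorphM rmorphXn.
Qed.

End WreathRep.

(** * Braid relations and Jucys-Murphy elements *)

Section Words.
Variable R : pzRingType.
Implicit Types x y u v w : R.

Lemma word2 x y u v : x * y = u * v -> forall w, w * x * y = w * u * v.
Proof. by move=> e w; rewrite -!mulrA e. Qed.

Lemma word3 x y z u v t : x * y * z = u * v * t ->
  forall w, w * x * y * z = w * u * v * t.
Proof. by move=> e w; have := congr1 ( *%R w) e; rewrite !mulrA. Qed.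

Lemma word4 x y z s u v t r : x * y * z * s = u * v * t * r ->
  forall w, w * x * y * z * s = w * u * v * t * r.
Proof. by move=> e w; have := congr1 ( *%R w) e; rewrite !mulrA. Qed.

End Words.

Section JucysMurphy.
Variables (R : pzRingType) (n : nat) (T : nat -> R) (x : R).
Hypothesis TT : forall i j, (i.+1 < j)%N -> (j < n)%N -> T i * T j = T j * T i.
Hypothesis braid : forall i, (i.+1 < n)%N -> T i * T i.+1 * T i = T i.+1 * T i * T i.+1.
Hypothesis xT : forall i, (0 < i < n)%N -> x * T i = T i * x.

(** The Jucys-Murphy elements: T_i X_i T_i = X_{i+1} determines every X_i from X_0, so the reduced
    presentation keeps [x] alone. *)
Fixpoint JM i : R := if i is j.+1 then T j * JM j * T j else x.

Lemma TT_comm i j : (i < n)%N -> (j < n)%N -> j != i -> j.+1 != i -> i.+1 != j ->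
  GRing.comm (T i) (T j).
Proof.
move=> ni nj; case: (ltngtP i j) => // [ij _ _ h|ji _ h _].
  by apply: TT => //; lia.
by apply/commr_sym/TT => //; lia.
Qed.

Lemma JM_T_gt i j : (i < j)%N -> (j < n)%N -> GRing.comm (T j) (JM i).
Proof.
elim: i => [|i IH] ij nj /=; first by apply/commr_sym/xT/andP.
have TTij : GRing.comm (T j) (T i) by apply: TT_comm => //; lia.
by apply: commrM => //; apply: commrM => //; apply: IH => //; apply: ltnW.
Qed.

(** The case with content is T_j against X_{j+2} = T_{j+1} T_j X_j T_j T_{j+1}: the braid relation
    turns T_j into T_{j+1}, which passes X_j, and a second braid relation turns it back. *)
Lemma JM_T i j : (i <= n)%N -> (j < n)%N -> j != i -> j.+1 != i -> GRing.comm (T j) (JM i).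
Proof.
elim: i => [|i IH] ni nj ji j1i; first by apply: JM_T_gt => //; lia.
case: (ltnP i.+1 j) => [h|ij]; first exact: JM_T_gt.
have [e|ne] := eqVneq j.+1 i; last first.
  have TTij : GRing.comm (T j) (T i) by apply: TT_comm => //; lia.
  by rewrite /=; apply: commrM => //; apply: commrM => //; apply: IH; lia.
subst i; have br := braid ni; have c := JM_T_gt (ltnSn j) ni.
by rewrite /GRing.comm /= !mulrA br (word2 c) -(word3 br) -!mulrA.
Qed.

Hypothesis xTx : (0 < n)%N -> x * T 0 * x * T 0 = T 0 * x * T 0 * x.

(** The relation [xTx] is transported one strand upwards at a time by braid relations, using that
    T_{i+1} commutes with X_i. *)
Lemma JM_JM_S i : (i < n)%N -> GRing.comm (JM i) (JM i.+1).
Proof.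
elim: i => [|i IH] ni; first by rewrite /GRing.comm /= !mulrA xTx.
have c : GRing.comm (T i.+1) (JM i) by apply: JM_T_gt.
have br := braid ni.
have /= e : JM i * T i * JM i * T i = T i * JM i * T i * JM i.
  by have := IH (ltnW ni); rewrite /GRing.comm /= !mulrA.
rewrite /GRing.comm /= !mulrA.
transitivity (T i * T i.+1 * T i * JM i * T i * JM i * T i.+1 * T i).
  by rewrite (word3 br) -(word2 c) (word2 c) -(word3 br) (word4 e).
by rewrite br (word2 c) -(word2 c) -(word3 br).
Qed.

Lemma JM_JM i j : (i <= n)%N -> (j <= n)%N -> GRing.comm (JM i) (JM j).
Proof.
wlog ij : i j / (i <= j)%N => [H|].
  by case/orP: (leq_total i j) => ij ni nj; [|apply/commr_sym]; apply: H.
elim: j ij => [|j IH]; first by rewrite leqn0 => /eqP -> _ _; apply: commr_refl.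
rewrite leq_eqVlt => /predU1P[->|]; first by move=> _ _; apply: commr_refl.
rewrite ltnS leq_eqVlt => /predU1P[->|ij]; first by move=> _; apply: JM_JM_S.
move=> ni nj; have c : GRing.comm (JM i) (T j) by apply/commr_sym/JM_T_gt.
by apply: commrM => //; apply: commrM => //; apply: IH => //; apply: ltnW.
Qed.

End JucysMurphy.

Record alg_closed (k : comNzRingType) (R : pzRingType) (eta : {rmorphism k -> R})
    (P : R -> Prop) : Prop := AlgClosed {
  alg_closed_scal : forall c, P (eta c);
  alg_closedD : forall x y, P x -> P y -> P (x + y);
  alg_closedM : forall x y, P x -> P y -> P (x * y)
}.

Section AlgClosed.
Variables (k : comNzRingType) (R : pzRingType) (eta : {rmorphism k -> R}).
Variables (P : R -> Prop) (PP : alg_closed eta P).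

Lemma alg_closed0 : P 0.
Proof. by rewrite -(rmorph0 eta); apply: (alg_closed_scal PP). Qed.

Lemma alg_closed1 : P 1.
Proof. by rewrite -(rmorph1 eta); apply: (alg_closed_scal PP). Qed.

Lemma alg_closedN x : P x -> P (- x).
Proof.
move=> Px; rewrite -mulN1r -(rmorph1 eta) -rmorphN.
by apply: (alg_closedM PP) => //; apply: (alg_closed_scal PP).
Qed.

Lemma alg_closedB x y : P x -> P y -> P (x - y).
Proof. by move=> Px Py; apply: (alg_closedD PP) => //; apply: alg_closedN. Qed.

Lemma alg_closedX x m : P x -> P (x ^+ m).
Proof.
by move=> Px; elim: m => [|m IH]; [apply: alg_closed1|rewrite exprS; apply: (alg_closedM PP)].
Qed.

Lemma alg_closed_sum (I : Type) (r : seq I) (Q : pred I) (F : I -> R) :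
  (forall i, Q i -> P (F i)) -> P (\sum_(i <- r | Q i) F i).
Proof. by move=> H; apply: (big_ind P) => //; [apply: alg_closed0|apply: (alg_closedD PP)]. Qed.

Lemma alg_closed_prod (I : Type) (r : seq I) (Q : pred I) (F : I -> R) :
  (forall i, Q i -> P (F i)) -> P (\prod_(i <- r | Q i) F i).
Proof. by move=> H; apply: (big_ind P) => //; [apply: alg_closed1|apply: (alg_closedM PP)]. Qed.

End AlgClosed.

Section RepTheory.
Variables (k : comNzRingType) (A : superalgType k).
Variables (tr : {scalar A}) (symA : symmetric_superalgebra tr).
Variables (B : finType) (b bd : B -> A) (basis_b : homogeneous_basis b).
Hypothesis dual_bd : forall i j, tr (bd i * b j) = (i == j)%:R.
Variables (z : k) (d : nat) (f : 'I_d -> A).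
Variables (R : pzRingType) (eta : {rmorphism k -> R}) (n : nat).
Variables (phi : nat -> A -> R) (T : nat -> R) (x : R).
Hypothesis rep : wreath_rep b bd z f eta n phi T x.

Local Notation t i := (tele b bd (phi i) (phi i.+1)).

Lemma tele_conj (c : R) (g h g' h' : A -> R) :
  (forall a, c * g a = g' a * c) -> (forall a, c * h a = h' a * c) ->
  c * tele b bd g h = tele b bd g' h' * c.
Proof.
move=> cg ch; rewrite mulr_sumr mulr_suml; apply: eq_bigr => y _.
by rewrite mulrA cg -mulrA ch mulrA.
Qed.

Lemma rep_T_t i : (i < n)%N -> T i * t i = t i * T i.
Proof.
move=> ni; have [gi gs] := (rep_alg rep (ltnW ni), rep_alg rep ni).
have sc : supercomm (phi i) (phi i.+1) by apply: (rep_sc rep); lia.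
rewrite -[in RHS](tele_sym symA basis_b dual_bd (rep_eta rep) gi gs sc).
by apply: tele_conj => a; [apply: (rep_Tl rep)|apply: (rep_Tu rep)].
Qed.

Definition Tinv i : R := T i - eta z * t i.

Lemma T_Tinv i : (i < n)%N -> T i * Tinv i = 1.
Proof.
move=> ni; have e : T i * (eta z * t i) = eta z * (t i * T i).
  by rewrite mulrA -(rep_eta rep) -mulrA rep_T_t.
by rewrite mulrBr (rep_quad rep ni) e addrAC subrr add0r.
Qed.

Lemma Tinv_T i : (i < n)%N -> Tinv i * T i = 1.
Proof. by move=> ni; rewrite mulrBl (rep_quad rep ni) -!mulrA addrAC subrr add0r. Qed.

Hypothesis d_gt0 : (0 < d)%N.
Hypothesis f0_inv : forall i : 'I_d, i = 0%N :> nat -> exists u, f i * u = 1 /\ u * f i = 1.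

(** As a_(0) is invertible, f(x) = 0 can be solved for the inverse: x^-1 = - a_(0)^-1 (x^(d-1) +
    a_(d-1) x^(d-2) + ... + a_(1)). The formula also shows that the inverse lies in every subalgebra
    containing x and the first copy of A. *)
Lemma rep_x_inv_closed : exists y, [/\ x * y = 1, y * x = 1 &
  forall P, alg_closed eta P -> (forall a, P (phi 0 a)) -> P x -> P y].
Proof.
case: d d_gt0 f f0_inv (rep_f rep) => // d' _ f' f0' r.
have [u [fu uf]] := f0' ord0 erefl.
pose s := x ^+ d' + \sum_(r < d') phi 0 (f' (lift ord0 r)) * x ^+ r.
have c a : GRing.comm x (phi 0 a) by exact: (rep_xphi rep).
have sE : s * x = - phi 0 (f' ord0).
  move/eqP: r; rewrite big_ord_recl expr0 mulr1 addrCA addr_eq0 => /eqP ->.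
  rewrite opprK mulrDl exprSr mulr_suml; congr (_ + _); apply: eq_bigr => i _.
  by rewrite -mulrA -exprSr.
have xs : x * s = s * x.
  apply/commrD; first exact/commrX/commr_refl.
  by apply: commr_sum => i _; apply: commrM; [exact: c|exact/commrX/commr_refl].
have g0 := rep_alg rep (leq0n n).
exists (- (phi 0 u * s)); split.
- rewrite mulrN mulrA (c u) -mulrA xs sE mulrN opprK -(alg_mapM g0) uf.
  exact: (alg_map1 g0).
- by rewrite mulNr -mulrA sE mulrN opprK -(alg_mapM g0) uf (alg_map1 g0).
move=> P PP Pphi Px; apply: (alg_closedN PP); apply: (alg_closedM PP) => //.
apply: (alg_closedD PP); first exact: (alg_closedX PP).
by apply: (alg_closed_sum PP) => i _; apply: (alg_closedM PP) => //; exact: (alg_closedX PP).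
Qed.

Lemma rep_x_inv : exists2 y, x * y = 1 & y * x = 1.
Proof. by have [y [? ? _]] := rep_x_inv_closed; exists y. Qed.

End RepTheory.

(** * Pure tensors as ordered products *)

Section TensorProduct.
Variables (k : comNzRingType) (A : superalgType k).
Variables (R : pzRingType) (eta : {rmorphism k -> R}) (n : nat) (phi : nat -> A -> R).
Hypothesis etaC : forall c y, eta c * y = y * eta c.
Hypothesis phiP : forall i, (i <= n)%N -> alg_map eta (phi i).
Hypothesis phi_sc : forall i j, (i <= n)%N -> (j <= n)%N -> i != j -> supercomm (phi i) (phi j).
Implicit Types (a c : nat -> A) (p q : nat -> bool).

Definition pure m a : R := \prod_(0 <= i < m) phi i (a i).

Definition subst a i y : nat -> A := fun j => if j == i then y else a j.

Lemma pureS m a : pure m.+1 a = pure m a * phi m (a m).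
Proof. by rewrite /pure big_nat_recr. Qed.

Lemma eq_pure m a c : (forall i, (i < m)%N -> a i = c i) -> pure m a = pure m c.
Proof.
by move=> e; rewrite /pure !big_nat; apply: eq_bigr => i /andP[_ im]; rewrite e.
Qed.

Lemma pure1 m : (m <= n.+1)%N -> pure m (fun=> 1) = 1.
Proof.
elim: m => [|m IH] nm; first by rewrite /pure big_geq.
by rewrite pureS IH ?mul1r 1?ltnW // (alg_map1 (phiP nm)).
Qed.

Lemma pure_at m i y : (m <= n.+1)%N -> (i < m)%N -> pure m (subst (fun=> 1) i y) = phi i y.
Proof.
elim: m => // m IH nm im; rewrite pureS {2}/subst.
have [->|ne] := eqVneq m i.
  rewrite (@eq_pure _ _ (fun=> 1)) => [|j ji]; first by rewrite pure1 ?mul1r // ltnW //; lia.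
  by rewrite /subst ltn_eqF.
by rewrite IH ?(alg_map1 (phiP nm)) ?mulr1 //; lia.
Qed.

Lemma pure_lin m i s y y' a : (m <= n.+1)%N -> (i < m)%N ->
  pure m (subst a i (s *: y + y')) = eta s * pure m (subst a i y) + pure m (subst a i y').
Proof.
elim: m => // m IH nm im; rewrite !pureS /subst; have [e|ne] := eqVneq m i.
  have E w : pure m (subst a i w) = pure m a.
    by apply: eq_pure => j jm; rewrite /subst ltn_eqF //; lia.
  rewrite -!/(subst _ _ _) !E (alg_mapP (phiP nm)) mulrDr; congr (_ + _).
  by rewrite mulrA -etaC mulrA.
rewrite -!/(subst _ _ _) IH; try lia.
by rewrite mulrDl mulrA.
Qed.

Lemma pureD m i y y' a : (m <= n.+1)%N -> (i < m)%N ->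
  pure m (subst a i (y + y')) = pure m (subst a i y) + pure m (subst a i y').
Proof.
by move=> nm im; have := pure_lin 1 y y' a nm im; rewrite scale1r rmorph1 mul1r.
Qed.

Lemma phi_pure l m c (pl : bool) y q : (m <= l)%N -> (l <= n)%N -> homog pl y ->
  (forall i, homog (q i) (c i)) ->
  phi l y * pure m c = (-1) ^+ (\sum_(0 <= j < m) (pl && q j)) * (pure m c * phi l y).
Proof.
move=> ml ln hy hc; elim: m ml => [|m IH] ml.
  by rewrite /pure !big_geq // mulr1 !mul1r.
rewrite pureS big_nat_recr //= exprD mulrA IH ?(ltnW ml) // -!mulrA; congr (_ * _).
rewrite (phi_sc _ _ _ hy (hc m)); try lia.
by rewrite [LHS]mulrA (comm_sign (pure m c)) -!mulrA.
Qed.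

Lemma pureM m a c p q : (m <= n.+1)%N ->
  (forall i, homog (p i) (a i)) -> (forall i, homog (q i) (c i)) ->
  pure m a * pure m c =
  (-1) ^+ (\sum_(0 <= i < m) \sum_(0 <= j < i) (p i && q j)) * pure m (fun i => a i * c i).
Proof.
move=> nm ha hc; elim: m nm => [|m IH] nm.
  by rewrite /pure !big_geq // !mul1r.
rewrite !pureS big_nat_recr //= exprD (alg_mapM (phiP nm)) -!mulrA.
rewrite [phi m (a m) * _]mulrA (phi_pure (leqnn m) _ (ha m) hc) //.
rewrite !mulrA (comm_sign (pure m a)) -!mulrA (mulrA (pure m a)) (IH (ltnW nm)).
by rewrite !mulrA -!exprD addnC.
Qed.

Lemma pure_commM y m a : (forall i, (i < m)%N -> GRing.comm y (phi i (a i))) ->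
  GRing.comm y (pure m a).
Proof.
elim: m => [|m IH] H; first by rewrite /pure big_geq //; apply: commr1.
by rewrite pureS; apply: commrM; [apply: IH => i im; apply/H/ltnW|apply: H].
Qed.

Definition swapn i j : nat := if j == i then i.+1 else if j == i.+1 then i else j.

(** The sign comes from reordering the two adjacent factors i and i+1. The factors before them
    commute with [y], and the later ones are appended one by one. *)
Lemma pure_swap (y : R) i (p q : bool) a :
  (i < n)%N -> homog p (a i) -> homog q (a i.+1) ->
  (forall w, y * phi i w = phi i.+1 w * y) ->
  (forall w, y * phi i.+1 w = phi i w * y) ->
  (forall j w, (j <= n)%N -> j != i -> j != i.+1 -> y * phi j w = phi j w * y) ->
  y * pure n.+1 a = (-1) ^+ (p && q) * pure n.+1 (fun j => a (swapn i j)) * y.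
Proof.
move=> ni hp hq yl yu yj.
suff H l : (i.+2 + l <= n.+1)%N ->
    y * pure (i.+2 + l) a = (-1) ^+ (p && q) * pure (i.+2 + l) (fun j => a (swapn i j)) * y.
  by have := H (n.+1 - i.+2)%N; rewrite subnKC //; apply.
elim: l => [|l IH] nl.
  rewrite addn0 !pureS /swapn eqxx eqn_leq ltnn /= eqxx.
  rewrite [in RHS](@eq_pure _ _ a) => [|j ji]; last by rewrite !ltn_eqF // leqW.
  have c : GRing.comm y (pure i a) by apply: pure_commM => j ji; apply: yj; lia.
  rewrite !mulrA c -(mulrA (pure i a)) yl -!mulrA yu.
  rewrite (mulrA (phi i.+1 _)) (phi_sc _ _ _ hp hq) //; try lia.
  by rewrite !mulrA (comm_sign (pure i a)).
rewrite addnS !(pureS (i.+2 + l)) mulrA IH -?mulrA; last by lia.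
rewrite yj; try lia.
rewrite {3}/swapn !ifN //; lia.
Qed.

End TensorProduct.

(** * Universal property of the cyclotomic quotients *)

Lemma sign_exponent n (p q : 'I_n.+1 -> bool) :
  (\sum_(0 <= i < n.+1) \sum_(0 <= j < i) (p (inord i) && q (inord j))
   = \sum_(i < n.+1) \sum_(j < n.+1 | (j < i)%N) (p i && q j))%N.
Proof.
rewrite big_mkord; apply: eq_bigr => i _.
rewrite (big_nat_widen _ _ n.+1) 1?ltnW ?ltn_ord // big_mkord.
by apply: eq_big => [j|j _] //; rewrite !inord_val.
Qed.

Lemma swapn_tperm n (l u j : 'I_n) i : l = i :> nat -> u = i.+1 :> nat ->
  swapn i j = tperm l u j.
Proof.
rewrite /swapn => li ui; case: tpermP => [->|->|/eqP nl /eqP nu].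
- by rewrite li eqxx ui.
- by rewrite ui eqxx li; case: eqP => // e; lia.
- by rewrite -!val_eqE /= in nl nu; rewrite -ui -li !ifN.
Qed.

Section UniversalProperty.
Variables (k : comNzRingType) (A : superalgType k).
Variables (tr : {scalar A}) (symA : symmetric_superalgebra tr).
Variables (B : finType) (b bd : B -> A) (basis_b : homogeneous_basis b).
Hypothesis dual_bd : forall i j, tr (bd i * b j) = (i == j)%:R.
Variables (z : k) (d : nat) (f : 'I_d -> A).
Variables (R : pzRingType) (eta : {rmorphism k -> R}) (n : nat).
Variables (phi : nat -> A -> R) (T : nat -> R) (x : R).
Hypothesis rep : wreath_rep b bd z f eta n phi T x.

Local Notation JMx := (JM T x).
Local Notation TI := (Tinv b bd z eta phi T).
Local Notation free := (free_alg k (aff_gens A n.+1)).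

Lemma rep_JM_phi i j y : (i <= n)%N -> (j <= n)%N -> GRing.comm (JMx i) (phi j y).
Proof.
elim: i j y => [|i IH] j y ni nj; first exact: (rep_xphi rep).
rewrite /GRing.comm /=; have [->|ne] := eqVneq j i.
  rewrite -!mulrA (rep_Tl rep) // (mulrA (JMx i)) IH ?(ltnW ni) //.
  by rewrite mulrA mulrA (rep_Tu rep) // -!mulrA.
have [->|ne'] := eqVneq j i.+1.
  rewrite -!mulrA (rep_Tu rep) // (mulrA (JMx i)) IH ?(ltnW ni) //.
  by rewrite mulrA mulrA (rep_Tl rep) // -!mulrA.
have c : GRing.comm (phi j y) (T i) by apply/esym/(rep_Tphi rep).
by apply/commr_sym/commrM => //; apply: commrM => //; apply/commr_sym/IH => //; apply: ltnW.
Qed.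

Fixpoint JMi (y : R) i : R := if i is j.+1 then TI j * JMi y j * TI j else y.

Lemma JM_JMi y i : x * y = 1 -> (i <= n)%N -> JMx i * JMi y i = 1.
Proof.
move=> xy; elim: i => //= i IH ni.
rewrite -!mulrA (mulrA (T i) (TI i)) (T_Tinv symA basis_b dual_bd rep ni) mul1r.
by rewrite (mulrA (JMx i)) IH ?mul1r ?(T_Tinv symA basis_b dual_bd rep ni) // ltnW.
Qed.

Lemma JMi_JM y i : y * x = 1 -> (i <= n)%N -> JMi y i * JMx i = 1.
Proof.
move=> yx; elim: i => //= i IH ni.
rewrite -!mulrA (mulrA (TI i) (T i)) (Tinv_T rep ni) mul1r.
by rewrite (mulrA (JMi y i)) IH ?mul1r ?(Tinv_T rep ni) // ltnW.
Qed.

Definition lift_gen y (g : aff_gens A n.+1) : R :=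
  match g with
  | gen_ten a => pure phi n.+1 (fun i => a (inord i))
  | gen_X i => JMx i
  | gen_Xinv i => JMi y i
  | gen_T i => T i
  end.

Section Evaluation.
Variables (y : R) (xy : x * y = 1) (yx : y * x = 1).

Definition lift_ev : free -> R := free_eval eta (lift_gen y).
Lemma lift_ev_morph : zmod_morphism lift_ev /\ monoid_morphism lift_ev.
Proof. by apply: free_eval_morph; apply: (rep_eta rep). Qed.
HB.instance Definition _ := GRing.isZmodMorphism.Build _ _ lift_ev lift_ev_morph.1.
HB.instance Definition _ := GRing.isMonoidMorphism.Build _ _ lift_ev lift_ev_morph.2.

Lemma lift_evZ c g : lift_ev (c *: g) = eta c * lift_ev g.
Proof. exact: free_evalZ. Qed.

Lemma lift_ev_gen g : lift_ev (free_gen k g) = lift_gen y g.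
Proof. exact: free_eval_gen. Qed.

Lemma pure_upd (a : 'I_n.+1 -> A) (i : 'I_n.+1) w :
  pure phi n.+1 (fun j => upd a i w (inord j)) =
  pure phi n.+1 (subst (fun j => a (inord j)) i w).
Proof.
apply: eq_pure => j nj; rewrite /upd /subst.
by rewrite -(inj_eq val_inj) /= inordK.
Qed.

Lemma lift_ev_at i w : lift_ev (free_gen k (gen_ten (at_pos i w))) = phi i w.
Proof. by rewrite lift_ev_gen /= pure_upd (pure_at (rep_alg rep)). Qed.

Lemma lift_ev2 g h : lift_ev (free_gen k g * free_gen k h) = lift_gen y g * lift_gen y h.
Proof. by apply: etrans (rmorphM lift_ev _ _) _; congr (_ * _); apply: lift_ev_gen. Qed.

Lemma lift_ev3 g h l : lift_ev (free_gen k g * free_gen k h * free_gen k l) =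
  lift_gen y g * lift_gen y h * lift_gen y l.
Proof.
apply: etrans (rmorphM lift_ev _ _) _; congr (_ * _); last exact: lift_ev_gen.
exact: lift_ev2.
Qed.

Lemma lift_ev1 : lift_ev 1 = 1.
Proof. exact: (rmorph1 lift_ev). Qed.

Lemma lift_evD u v : lift_ev (u + v) = lift_ev u + lift_ev v.
Proof. exact: (rmorphD lift_ev). Qed.

Lemma lift_evM u v : lift_ev (u * v) = lift_ev u * lift_ev v.
Proof. exact: (rmorphM lift_ev). Qed.

Lemma lift_ev_tele (l u : 'I_n.+1) :
  lift_ev (teleporter b bd l u) = tele b bd (phi l) (phi u).
Proof. by rewrite rmorph_sum; apply: eq_bigr => i _; rewrite rmorphM /= !lift_ev_at. Qed.

(** The affine relations for all X_j follow from those for [x], because [gen_X] is evaluated on the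
    Jucys-Murphy elements and [gen_Xinv] on their explicit inverses. *)
Lemma lift_ev_rel u v : aff_rel b bd z u v -> lift_ev u = lift_ev v.
Proof.
case.
- move=> i c w w' a.
  rewrite [LHS]lift_ev_gen [RHS]lift_evD [X in _ = X + _]lift_evZ 2!lift_ev_gen /= !pure_upd.
  exact: (pure_lin (rep_eta rep) (rep_alg rep)).
- rewrite [LHS]lift_ev_gen [RHS]lift_ev1; exact: (pure1 (rep_alg rep)).
- move=> p q a c ha hc.
  rewrite [LHS]lift_ev2 [RHS]lift_evZ lift_ev_gen /= rmorphXn rmorphN1.
  have E := @pureM k A R eta n phi (rep_alg rep) (rep_sc rep) n.+1 (fun i => a (inord i))
    (fun i => c (inord i)) (fun i => p (inord i)) (fun i => q (inord i)) (leqnn _)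
    (fun i => ha (inord i)) (fun i => hc (inord i)).
  by rewrite [LHS]E {E} sign_exponent.
- move=> i j ij; rewrite [LHS]lift_ev2 [RHS]lift_ev2.
  by apply: (rep_TT rep); rewrite ?ltn_ord.
- move=> i j ij; rewrite [LHS]lift_ev3 [RHS]lift_ev3 /= ij.
  by apply: (rep_braid rep); rewrite -ij; apply: (ltn_ord j).
- move=> i l u' li ui.
  rewrite expr2 [LHS]lift_ev2 [RHS]lift_evD lift_ev1 [X in _ = X + _]lift_evZ.
  rewrite [X in _ * X + _]lift_evM lift_ev_gen lift_ev_tele li ui /=.
  exact: (rep_quad rep (ltn_ord i)).
- move=> i l u' p q a li ui pa qa.
  rewrite [LHS]lift_ev2 [RHS]lift_evM [X in _ = X * _]lift_evZ 2!lift_ev_gen /= rmorphXn rmorphN1.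
  have ni := ltn_ord i; rewrite /= in ni.
  have pa' : homog p (a (inord i)) by rewrite -li inord_val.
  have qa' : homog q (a (inord i.+1)) by rewrite -ui inord_val.
  have E := pure_swap (a := fun j => a (inord j)) (rep_sc rep) ni pa' qa'
    (fun w => rep_Tl rep w ni) (fun w => rep_Tu rep w ni)
    (fun j w nj ji ji1 => rep_Tphi rep w ni nj ji ji1).
  rewrite [LHS]E {E}; congr (_ * _ * _); apply: eq_pure => j nj; congr a; apply: val_inj.
  rewrite /= inordK; first by rewrite -(swapn_tperm _ li ui) /= inordK.
  by rewrite /swapn; do 2?case: eqP => //; lia.
- by move=> j; rewrite [LHS]lift_ev2 [RHS]lift_ev1 /= JM_JMi // -ltnS.
- by move=> j; rewrite [LHS]lift_ev2 [RHS]lift_ev1 /= JMi_JM // -ltnS.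
- move=> i j; rewrite [LHS]lift_ev2 [RHS]lift_ev2 /=.
  by apply: (JM_JM (rep_TT rep) (rep_braid rep) (rep_xT rep) (rep_xTx rep)); rewrite -ltnS ltn_ord.
- move=> i j ji ji1; rewrite [LHS]lift_ev2 [RHS]lift_ev2 /=.
  apply: (JM_T (rep_TT rep) (rep_braid rep) (rep_xT rep)).
  + by rewrite -ltnS ltn_ord.
  + exact: (ltn_ord i).
  + by apply/eqP => e; apply: ji.
  + by apply/eqP => e; apply: ji1.
- by move=> i l u' li ui; rewrite [LHS]lift_ev3 [RHS]lift_ev_gen /= li ui.
- move=> j a; rewrite [LHS]lift_ev2 [RHS]lift_ev2 /=.
  by apply: pure_commM => i ni; apply: rep_JM_phi; rewrite -ltnS ?ltn_ord.
Qed.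

Lemma lift_ev_relator u : aff_relator b bd z u -> lift_ev u = 0.
Proof.
move=> [v [w [vw ->]]]; apply: etrans (rmorphB lift_ev _ _) _.
by rewrite /= (lift_ev_rel vw) subrr.
Qed.

Definition lift_aff : aff_alg b bd z n.+1 -> R := quot_lift lift_ev.
Lemma lift_aff_morph : zmod_morphism lift_aff /\ monoid_morphism lift_aff.
Proof. exact/quot_lift_morph/lift_ev_relator. Qed.
HB.instance Definition _ := GRing.isZmodMorphism.Build _ _ lift_aff lift_aff_morph.1.
HB.instance Definition _ := GRing.isMonoidMorphism.Build _ _ lift_aff lift_aff_morph.2.

Lemma lift_aff_gen g : lift_aff (aff_gen b bd z g) = lift_gen y g.
Proof. exact: etrans (quot_liftE lift_ev_relator _) (lift_ev_gen g). Qed.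

Lemma lift_aff_relator u : cyc_relator f u -> lift_aff u = 0.
Proof.
move=> [i0 i00 ->]; rewrite -(rep_f rep) /cyc_poly.
rewrite (rmorphD lift_aff) (rmorph_sum lift_aff) /=; congr (_ + _).
  apply: etrans (rmorphXn lift_aff _ _) _; congr (_ ^+ _).
  by rewrite [LHS]lift_aff_gen /= i00.
apply: eq_bigr => r _; apply: etrans (rmorphM lift_aff _ _) _; congr (_ * _).
  by apply: etrans (lift_aff_gen _) _; rewrite -lift_ev_gen lift_ev_at i00.
apply: etrans (rmorphXn lift_aff _ _) _; congr (_ ^+ _).
by rewrite [LHS]lift_aff_gen /= i00.
Qed.

Definition lift_cyc : cyc_alg b bd z f n.+1 -> R := quot_lift lift_aff.
Lemma lift_cyc_morph : zmod_morphism lift_cyc /\ monoid_morphism lift_cyc.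
Proof. exact/quot_lift_morph/lift_aff_relator. Qed.
HB.instance Definition _ := GRing.isZmodMorphism.Build _ _ lift_cyc lift_cyc_morph.1.
HB.instance Definition _ := GRing.isMonoidMorphism.Build _ _ lift_cyc lift_cyc_morph.2.

Lemma lift_cyc_pi u : lift_cyc (cyc_pi b bd z f u) = lift_ev u.
Proof.
apply: etrans (quot_liftE lift_aff_relator _) _.
exact: quot_liftE lift_ev_relator _.
Qed.

Lemma lift_cyc_gen g : lift_cyc (cyc_gen b bd z f g) = lift_gen y g.
Proof. exact: etrans (lift_cyc_pi _) (lift_ev_gen g). Qed.

Lemma lift_cyc_scal c : lift_cyc (cyc_scal b bd z f n.+1 c) = eta c.
Proof.
apply: etrans (lift_cyc_pi _) _.
by rewrite [LHS]lift_evZ lift_ev1 mulr1.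
Qed.

End Evaluation.

Hypothesis d_gt0 : (0 < d)%N.
Hypothesis f0_inv : forall i : 'I_d, i = 0%N :> nat -> exists u, f i * u = 1 /\ u * f i = 1.

Lemma cyc_lift : exists L : {rmorphism cyc_alg b bd z f n.+1 -> R},
  [/\ forall c, L (cyc_scal b bd z f n.+1 c) = eta c,
      forall i a, L (cyc_gen b bd z f (gen_ten (at_pos i a))) = phi i a,
      forall i, L (cyc_gen b bd z f (gen_T (n := n.+1) i)) = T i
    & L (cyc_gen b bd z f (gen_X ord0)) = x].
Proof.
have [y xy yx] := rep_x_inv rep d_gt0 f0_inv.
exists (lift_cyc xy yx : {rmorphism _ -> _}); split=> [c|i a|i|].
- exact: lift_cyc_scal.
- by rewrite [LHS]lift_cyc_gen -lift_ev_gen lift_ev_at.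
- by rewrite [LHS]lift_cyc_gen.
- by rewrite [LHS]lift_cyc_gen.
Qed.

End UniversalProperty.

(** * The cyclotomic algebra satisfies the reduced presentation *)

Section CyclotomicRep.
Variables (k : comNzRingType) (A : superalgType k).
Variables (B : finType) (b bd : B -> A) (z : k) (d : nat) (f : 'I_d -> A) (n : nat).

Local Notation H := (cyc_alg b bd z f n.+1).
Local Notation gen g := (cyc_gen b bd z f g : H).
Local Notation free := (free_alg k (aff_gens A n.+1)).

Definition cyc_phi (i : nat) (a : A) : H := gen (gen_ten (at_pos (inord i) a)).
Definition cyc_T (i : nat) : H :=
  oapp (fun j : 'I_n => gen (gen_T (n := n.+1) j)) 0 (insub i).
Definition cyc_X (i : nat) : H := gen (gen_X (inord i)).

Lemma cyc_genE g : gen g = cyc_pi b bd z f (free_gen k g).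
Proof. by []. Qed.

Lemma cyc_phiE (i : 'I_n.+1) a : cyc_phi i a = gen (gen_ten (at_pos i a)).
Proof. by rewrite /cyc_phi inord_val. Qed.

Lemma cyc_TE (i : 'I_n) : cyc_T i = gen (gen_T (n := n.+1) i).
Proof. by rewrite /cyc_T valK. Qed.

Lemma cyc_XE (i : 'I_n.+1) : cyc_X i = gen (gen_X i).
Proof. by rewrite /cyc_X inord_val. Qed.

Lemma cyc_pi2 g h : cyc_pi b bd z f (free_gen k g * free_gen k h : free) = gen g * gen h.
Proof. exact: cyc_piM. Qed.

Lemma cyc_pi3 g h l :
  cyc_pi b bd z f (free_gen k g * free_gen k h * free_gen k l : free) = gen g * gen h * gen l.
Proof.
rewrite [LHS]cyc_piM.
have -> : cyc_pi b bd z f (free_gen k l) = gen l by [].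
rewrite (cyc_pi2 g h).
reflexivity.
Qed.

Lemma cyc_rel2 g h g' h' :
  aff_rel b bd z (free_gen k g * free_gen k h : free) (free_gen k g' * free_gen k h') ->
  gen g * gen h = gen g' * gen h'.
Proof. by move=> /(cyc_rel_pi f) e; apply: etrans (esym (cyc_pi2 _ _)) (etrans e (cyc_pi2 _ _)). Qed.

Lemma cyc_rel3 g h l g' h' l' :
  aff_rel b bd z (free_gen k g * free_gen k h * free_gen k l : free)
    (free_gen k g' * free_gen k h' * free_gen k l') ->
  gen g * gen h * gen l = gen g' * gen h' * gen l'.
Proof.
by move=> /(cyc_rel_pi f) e; apply: etrans (esym (cyc_pi3 _ _ _)) (etrans e (cyc_pi3 _ _ _)).
Qed.

Lemma cyc_ten_lin i c x y (a : 'I_n.+1 -> A) :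
  gen (gen_ten (upd a i (c *: x + y))) =
  cyc_scal b bd z f n.+1 c * gen (gen_ten (upd a i x)) + gen (gen_ten (upd a i y)).
Proof.
apply: etrans (cyc_rel_pi f (rel_ten_lin b bd z i c x y a)) _.
by apply: etrans (cyc_piD _ _ _ _ _ _) _; congr (_ + _); apply: cyc_piZ.
Qed.

Lemma cyc_ten1 : gen (gen_ten (fun=> 1)) = 1.
Proof. by apply: etrans (cyc_rel_pi f (rel_ten1 b bd z n.+1)) _; apply: cyc_pi1. Qed.

Lemma cyc_scal_sign m : cyc_scal b bd z f n.+1 ((-1) ^+ m) = (-1) ^+ m.
Proof. by rewrite rmorphXn rmorphN1. Qed.

Lemma cyc_tenM (p q : 'I_n.+1 -> bool) (a c : 'I_n.+1 -> A) :
  (forall i, homog (p i) (a i)) -> (forall i, homog (q i) (c i)) ->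
  gen (gen_ten a) * gen (gen_ten c) =
  (-1) ^+ (\sum_(i < n.+1) \sum_(j < n.+1 | (j < i)%N) (p i && q j)) *
  gen (gen_ten (fun i => a i * c i)).
Proof.
move=> ha hc; apply: etrans (esym (cyc_pi2 _ _)) _.
apply: etrans (cyc_rel_pi f (rel_tenM b bd z ha hc)) _.
by apply: etrans (cyc_piZ _ _ _ _ _ _) _; rewrite cyc_scal_sign.
Qed.

Lemma at_pos_homog p (i : 'I_n.+1) (a : A) : homog p a ->
  forall j, homog (p && (j == i)) (at_pos i a j).
Proof.
by move=> pa j; rewrite /at_pos /upd; case: eqP => _; rewrite ?andbT ?andbF //; apply: homog1.
Qed.

Lemma at_pos_sign (p q : bool) (i j : 'I_n.+1) :
  (\sum_(i' < n.+1) \sum_(j' < n.+1 | (j' < i')%N) ((p && (i' == i)) && (q && (j' == j)))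
   = (p && q && (j < i)%N))%N.
Proof.
rewrite (bigD1 i) //= [X in (_ + X)%N]big1 ?addn0; last first.
  by move=> i' /negPf ->; rewrite big1 // => j' _; rewrite andbF.
rewrite big_mkcond (bigD1 j) //= big1 ?addn0; last first.
  by move=> j' /negPf ->; rewrite !andbF if_same.
by rewrite !eqxx !andbT; case: ifP; rewrite ?andbT ?andbF.
Qed.

Lemma cyc_phiM_homog p q (i : 'I_n.+1) x y : homog p x -> homog q y ->
  gen (gen_ten (at_pos i x)) * gen (gen_ten (at_pos i y)) = gen (gen_ten (at_pos i (x * y))).
Proof.
move=> px qy; rewrite (cyc_tenM (at_pos_homog i px) (at_pos_homog i qy)) at_pos_sign.
rewrite ltnn andbF mul1r; congr (gen (gen_ten _)); apply/funext => j.
by rewrite /at_pos /upd; case: eqP => // _; rewrite mulr1.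
Qed.

Lemma cyc_phi_lin (i : 'I_n.+1) c x y :
  gen (gen_ten (at_pos i (c *: x + y))) =
  cyc_scal b bd z f n.+1 c * gen (gen_ten (at_pos i x)) + gen (gen_ten (at_pos i y)).
Proof. exact: cyc_ten_lin. Qed.

Lemma cyc_phi_alg i : alg_map (cyc_scal b bd z f n.+1) (cyc_phi i).
Proof.
apply: alg_map_homog => [c x y||p q x y px qy]; first exact: cyc_phi_lin.
  by rewrite -cyc_ten1; congr (gen (gen_ten _)); apply/funext => j; rewrite /at_pos /upd if_same.
exact/esym/(cyc_phiM_homog _ px qy).
Qed.

Lemma cyc_phi2 i j p q x y : (i <= n)%N -> (j <= n)%N -> homog p x -> homog q y ->
  cyc_phi i x * cyc_phi j y = (-1) ^+ (p && q && (j < i)%N) *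
    gen (gen_ten (fun l => at_pos (inord i) x l * at_pos (inord j) y l)).
Proof.
move=> ni nj px qy.
have E := at_pos_sign p q (inord i) (inord j : 'I_n.+1).
rewrite (inordK (ni : (i < n.+1)%N)) (inordK (nj : (j < n.+1)%N)) in E.
rewrite -E; exact: cyc_tenM (at_pos_homog (inord i) px) (at_pos_homog (inord j) qy).
Qed.

Lemma cyc_phi_sc i j : (i <= n)%N -> (j <= n)%N -> i != j -> supercomm (cyc_phi i) (cyc_phi j).
Proof.
move=> ni nj ij p q x y px qy.
have -> : cyc_phi j y * cyc_phi i x = (-1) ^+ (q && p && (i < j)%N) *
    gen (gen_ten (fun l => at_pos (inord i) x l * at_pos (inord j) y l)).
  apply: etrans (cyc_phi2 nj ni qy px) _; congr (_ * gen (gen_ten _)).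
  have ne : inord i != inord j :> 'I_n.+1 by rewrite -val_eqE /= !inordK.
  apply/funext => l; rewrite /at_pos /upd; case: eqP => [->|_]; case: eqP => [|_] //=.
  - by move=> e; rewrite e eqxx in ne.
  - by rewrite mulr1 mul1r.
  - by rewrite mulr1 mul1r.
rewrite (cyc_phi2 ni nj px qy) [RHS]mulrA -exprD; congr (_ * _).
rewrite -signr_odd -[in RHS]signr_odd; congr (_ ^+ (nat_of_bool _)).
rewrite oddD !oddb; move: ij; case: (ltngtP i j) => // _ _; last by rewrite andbF andbT addbF.
by rewrite andbF andbT andbC addbb.
Qed.

Lemma cyc_tele (l u : 'I_n.+1) :
  cyc_pi b bd z f (teleporter b bd l u) = tele b bd (cyc_phi l) (cyc_phi u).
Proof.
rewrite rmorph_sum /=; apply: eq_bigr => x _.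
by rewrite !cyc_phiE; exact: cyc_pi2.
Qed.

Lemma cyc_T_at (i : 'I_n) (j l u : 'I_n.+1) p x : l = i :> nat -> u = i.+1 :> nat ->
  homog p x -> gen (gen_T (n := n.+1) i) * gen (gen_ten (at_pos j x)) =
               gen (gen_ten (at_pos (tperm l u j) x)) * gen (gen_T (n := n.+1) i).
Proof.
move=> li ui px.
have hl := at_pos_homog j px l; have hu := at_pos_homog j px u.
apply: etrans (esym (cyc_pi2 _ _)) _.
apply: etrans (cyc_rel_pi f (rel_Tten b bd z li ui hl hu)) _.
apply: etrans (cyc_piM _ _ _ _ _ _) _; congr (_ * gen _).
apply: etrans (cyc_piZ _ _ _ _ _ _) _; rewrite cyc_scal_sign.
rewrite (_ : _ && _ = false); last first.
  case: p {px hl hu} => //=; case: eqP => //= lj; case: eqP => // uj.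
  by move: ui; rewrite uj -lj li => /eqP; rewrite ltn_eqF.
rewrite mul1r; congr (gen (gen_ten _)); apply/funext => m; rewrite /at_pos /upd.
by rewrite -(inj_eq (@perm_inj _ (tperm l u))) tpermK.
Qed.

Lemma cyc_T_phi i j l x : (i < n)%N -> (j <= n)%N -> l = swapn i j ->
  cyc_T i * cyc_phi j x = cyc_phi l x * cyc_T i.
Proof.
move=> ni nj ->; move: x; apply: (alg_map_intertwine (cyc_phi_alg _) (cyc_phi_alg _)) => p x px.
have -> : cyc_T i = gen (gen_T (n := n.+1) (Ordinal ni)) by rewrite -cyc_TE.
have li : @inord n i = Ordinal ni :> nat by rewrite inordK //= ltnW.
have ui : @inord n i.+1 = (Ordinal ni).+1 :> nat by rewrite inordK.
have e : tperm (inord i) (inord i.+1) (inord j) = inord (swapn i j) :> 'I_n.+1.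
  apply: val_inj; have := swapn_tperm (inord j) li ui => /= <-; rewrite (inordK (nj : (j < n.+1)%N)).
  by rewrite inordK // /swapn; case: eqP => // _; case: eqP => // _; rewrite ltnW.
by rewrite /cyc_phi -e; apply: cyc_T_at px.
Qed.

Lemma cyc_XX i j : cyc_X i * cyc_X j = cyc_X j * cyc_X i.
Proof. exact/cyc_rel2/rel_XX. Qed.

Lemma cyc_X_ten i a : cyc_X i * gen (gen_ten a) = gen (gen_ten a) * cyc_X i.
Proof. exact/cyc_rel2/rel_Xten. Qed.

Lemma cyc_X_phi i j x : cyc_X i * cyc_phi j x = cyc_phi j x * cyc_X i.
Proof. exact: cyc_X_ten. Qed.

Lemma cyc_T_X i j : (i < n)%N -> (j <= n)%N -> j != i -> j != i.+1 ->
  cyc_T i * cyc_X j = cyc_X j * cyc_T i.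
Proof.
move=> ni nj /eqP ji /eqP ji1.
have -> : cyc_T i = gen (gen_T (n := n.+1) (Ordinal ni)) by rewrite -cyc_TE.
by apply/cyc_rel2/rel_TX; rewrite inordK.
Qed.

Lemma cyc_TXT i : (i < n)%N -> cyc_T i * cyc_X i * cyc_T i = cyc_X i.+1.
Proof.
move=> ni.
have -> : cyc_T i = gen (gen_T (n := n.+1) (Ordinal ni)) by rewrite -cyc_TE.
apply: etrans (esym (cyc_pi3 _ _ _)) _; apply: cyc_rel_pi.
by apply: rel_TXT; rewrite inordK //= ltnW.
Qed.

Lemma cyc_quad i : (i < n)%N -> cyc_T i * cyc_T i =
  cyc_scal b bd z f n.+1 z * (tele b bd (cyc_phi i) (cyc_phi i.+1) * cyc_T i) + 1.
Proof.
move=> ni.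
have -> : cyc_T i = gen (gen_T (n := n.+1) (Ordinal ni)) by rewrite -cyc_TE.
have li : @inord n i = Ordinal ni :> nat by rewrite inordK //= ltnW.
have ui : @inord n i.+1 = (Ordinal ni).+1 :> nat by rewrite inordK.
have := cyc_rel_pi f (rel_quad b bd z li ui); rewrite expr2 => E.
apply: etrans (esym (cyc_pi2 _ _)) _; apply: etrans E _.
apply: etrans (cyc_piD _ _ _ _ _ _) _.
have T2 : tele b bd (cyc_phi i) (cyc_phi i.+1) =
    cyc_pi b bd z f (teleporter b bd (inord i) (inord i.+1 : 'I_n.+1)).
  by rewrite cyc_tele !inordK // ltnW.
have E1 := cyc_piM b bd z f (teleporter b bd (inord i) (inord i.+1 : 'I_n.+1))
  (free_gen k (gen_T (n := n.+1) (Ordinal ni))).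
rewrite T2; have E2 := congr1 ( *%R (cyc_scal b bd z f n.+1 z)) E1.
have E3 := etrans (cyc_piZ b bd z f z _) E2.
by rewrite E3; congr (_ + _).
Qed.

Lemma cyc_TT i j : (i.+1 < j)%N -> (j < n)%N -> cyc_T i * cyc_T j = cyc_T j * cyc_T i.
Proof.
move=> ij jn; have ni : (i < n)%N by rewrite (ltn_trans _ jn) // ltnW.
have -> : cyc_T i = gen (gen_T (n := n.+1) (Ordinal ni)) by rewrite -cyc_TE.
have -> : cyc_T j = gen (gen_T (n := n.+1) (Ordinal jn)) by rewrite -cyc_TE.
exact/cyc_rel2/rel_TT.
Qed.

Lemma cyc_braid i : (i.+1 < n)%N ->
  cyc_T i * cyc_T i.+1 * cyc_T i = cyc_T i.+1 * cyc_T i * cyc_T i.+1.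
Proof.
move=> jn; have ni := ltnW jn.
have -> : cyc_T i = gen (gen_T (n := n.+1) (Ordinal ni)) by rewrite -cyc_TE.
have -> : cyc_T i.+1 = gen (gen_T (n := n.+1) (Ordinal jn)) by rewrite -cyc_TE.
exact/cyc_rel3/rel_braid.
Qed.

Lemma cyc_wreath_rep :
  wreath_rep b bd z f (cyc_scal b bd z f n.+1) n cyc_phi cyc_T (cyc_X 0).
Proof.
split.
- exact: cyc_scal_central.
- by move=> i _; apply: cyc_phi_alg.
- exact: cyc_phi_sc.
- exact: cyc_TT.
- exact: cyc_braid.
- exact: cyc_quad.
- by move=> i a ni; apply: cyc_T_phi; rewrite /swapn ?eqxx //; lia.
- by move=> i a ni; apply: cyc_T_phi => //; rewrite /swapn eqn_leq ltnn eqxx.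
- by move=> i j a ni nj /negPf ji /negPf ji1; apply: cyc_T_phi => //; rewrite /swapn ji ji1.
- by move=> i /andP[i0 ni]; apply/esym/cyc_T_X => //; lia.
- move=> n0; have := cyc_XX 0 1; rewrite -(cyc_TXT n0) !mulrA; exact.
- by move=> i a _; apply: cyc_X_phi.
apply: etrans (cyc_relE b bd z f (inordK (ltn0Sn n))); congr (_ + _).
Qed.

Lemma cyc_X_JM i : (i <= n)%N -> cyc_X i = JM cyc_T (cyc_X 0) i.
Proof. by elim: i => [|i IH] ni //; rewrite -(cyc_TXT ni) (IH (ltnW ni)). Qed.

End CyclotomicRep.

Lemma inverse_unique (R : pzRingType) (u x v : R) : u * x = 1 -> x * v = 1 -> v = u.
Proof. by move=> ux xv; rewrite -[v]mul1r -ux -mulrA xv mulr1. Qed.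

Section FreeAlgebraInduction.
Variables (k : comNzRingType) (G : choiceType).

Lemma free_alg_ind (P : free_alg k G -> Prop) :
  P 0 -> P 1 -> (forall x y, P x -> P y -> P (x + y)) -> (forall c x, P x -> P (c *: x)) ->
  (forall x y, P x -> P y -> P (x * y)) -> (forall g, P (free_gen k g)) -> forall x, P x.
Proof.
move=> P0 P1 PD PZ PM Pg x.
have PU (w : {fmonom G}) : P << w >>.
  case: w => s; elim: s => [|g s IH].
    by have <- : 1 = << FMonom [::] >> :> free_alg k G by rewrite -fmoneE.
  rewrite (_ : << FMonom (g :: s) >> = free_gen k g * << FMonom s >> :> free_alg k G); first exact: PM.
  by rewrite /free_gen [RHS]malgM_def fgmulUU mulr1 fmuE; congr << _ >>; rewrite -[RHS]/(fmmul _ _) fmmulE.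
rewrite [x]monalgE; apply: (big_ind P) => // w _.
rewrite (_ : << x@_w *g w >> = x@_w *: (<< w >> : free_alg k G)); first exact: PZ.
by apply/malgP => v; rewrite mcoeffZ !mcoeffU mulrnAr mulr1.
Qed.

End FreeAlgebraInduction.

Section MultilinearExtension.
Variables (k : comNzRingType) (A : superalgType k) (V : zmodType) (n : nat).

(** Splits the entries into even and odd parts one position at a time: in the induction, the
    positions below [l] are those whose entries may still be inhomogeneous. *)
Lemma multiadditive_ext (F G : ('I_n -> A) -> V) :
  (forall a i x y, F (upd a i (x + y)) = F (upd a i x) + F (upd a i y)) ->
  (forall a i x y, G (upd a i (x + y)) = G (upd a i x) + G (upd a i y)) ->
  (forall p a, (forall i, homog (p i) (a i)) -> F a = G a) -> forall a, F a = G a.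
Proof.
move=> FD GD FG.
have H l : forall a, (forall i : 'I_n, (l <= i)%N -> exists p, homog p (a i)) -> F a = G a.
  elim: l => [|l IH] a ha.
    have {}ha i : {p | homog p (a i)} by apply: cid; apply: ha.
    by apply: (FG (fun i => sval (ha i))) => i; apply: (svalP (ha i)).
  have [nl|ln] := leqP n l; first by apply: IH => i /(leq_trans nl); rewrite leqNgt ltn_ord.
  pose i := Ordinal ln; have aE : a = upd a i (part false (a i) + part true (a i)).
    by apply/funext => j; rewrite part_sum /upd; case: eqP => // ->.
  rewrite aE FD GD; congr (_ + _); apply: IH => j; rewrite /upd; case: eqP => [->|/eqP ji] lj.
  - by exists false; apply: part_homog.
  - by apply: ha; rewrite ltn_neqAle lj andbT eq_sym; apply: contraNneq ji => e; apply/eqP/val_inj.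
  - by exists true; apply: part_homog.
  - by apply: ha; rewrite ltn_neqAle lj andbT eq_sym; apply: contraNneq ji => e; apply/eqP/val_inj.
move=> a; apply: (H n) => i; rewrite leqNgt ltn_ord //.
Qed.

End MultilinearExtension.

(* Unification must not unfold the quotient construction. *)
Opaque cyc_gen cyc_pi cyc_scal cyc_phi cyc_T cyc_X.

Section CyclotomicGenerators.
Variables (k : comNzRingType) (A : superalgType k).
Variables (B : finType) (b bd : B -> A).
Variables (z : k) (d : nat) (f : 'I_d -> A) (n : nat).

Local Notation H := (cyc_alg b bd z f n.+1).
Local Notation gen g := (cyc_gen b bd z f g : H).
Local Notation phi := (@cyc_phi k A B b bd z d f n).
Local Notation eta := (cyc_scal b bd z f n.+1).
Let phiP i (_ : (i <= n)%N) := cyc_phi_alg b bd z f n i.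

Lemma cyc_ten_pure_homog (p : 'I_n.+1 -> bool) (a : 'I_n.+1 -> A) : (forall i, homog (p i) (a i)) ->
  gen (gen_ten a) = pure phi n.+1 (fun i => a (inord i)).
Proof.
move=> ha; pose trunc m (i : 'I_n.+1) := if (i < m)%N then a i else 1.
have tr_h m i : homog (p i && (i < m)%N) (trunc m i).
  by rewrite /trunc; case: ifP; rewrite ?andbT ?andbF // => _; apply: homog1.
suff E m : (m <= n.+1)%N -> gen (gen_ten (trunc m)) = pure phi m (fun i => a (inord i)).
  have e : a = trunc n.+1 by apply/funext => i; rewrite /trunc ltn_ord.
  by rewrite {1}e; apply: E.
elim: m => [|m IH] nm.
  have -> : trunc 0 = fun=> 1 by apply/funext.
  by rewrite [RHS](_ : _ = 1) ?cyc_ten1 // /pure big_geq.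
rewrite pureS -(IH (ltnW nm)).
(* No sign arises: the left tensor is supported on positions below m and the right one on m alone,
   while the exponent counts a left position above a right one. *)
have exp0 : (\sum_(i < n.+1) \sum_(j < n.+1 | (j < i)%N)
    ((p i && (i < m)%N) && (p (inord m) && (j == inord m))) = 0)%N.
  apply: big1 => i _; apply: big1 => j ji; apply/eqP; rewrite eqb0; apply/negP.
  by rewrite -val_eqE /= inordK // => /andP[/andP[_ im] /andP[_ /eqP jm]]; lia.
have := cyc_tenM b bd z f (tr_h m) (at_pos_homog (inord m) (ha (inord m))) => E.
apply/esym/(etrans E); rewrite exp0 mul1r {E}.
have -> // : (fun i => trunc m i * at_pos (inord m) (a (inord m)) i) = trunc m.+1.
apply/funext => i; rewrite /trunc /at_pos /upd -val_eqE /= inordK // ltnS (leq_eqVlt i m).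
case: eqP => [im|_] /=; last by rewrite mulr1.
by rewrite im ltnn mul1r -im inord_val.
Qed.

Lemma cyc_ten_pure (a : 'I_n.+1 -> A) : gen (gen_ten a) = pure phi n.+1 (fun i => a (inord i)).
Proof.
move: a; apply: multiadditive_ext => [a i x y|a i x y|p a].
- by have := cyc_ten_lin b bd z f i 1 x y a; rewrite scale1r rmorph1 mul1r.
- rewrite !pure_upd; apply: (pureD (@cyc_scal_central _ _ _ b bd z d f n.+1) phiP) => //.
- exact: cyc_ten_pure_homog.
Qed.

Hypothesis d_gt0 : (0 < d)%N.
Hypothesis f0_inv : forall i : 'I_d, i = 0%N :> nat -> exists u, f i * u = 1 /\ u * f i = 1.

(** Tensors are products of single copies, each X_i is a Jucys-Murphy element, and each inverse is
    the explicit one built from x^-1 and the inverses of the T_i. All of these lie in the subalgebra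
    generated by the listed elements. *)
Lemma cyc_gen_ind (P : H -> Prop) : alg_closed eta P ->
  (forall i a, (i <= n)%N -> P (phi i a)) ->
  (forall i, (i < n)%N -> P (cyc_T b bd z f n i)) -> P (cyc_X b bd z f n 0) -> forall x, P x.
Proof.
move=> PP Pphi PT PX0.
have rep := cyc_wreath_rep b bd z f n.
have PJM i : (i <= n)%N -> P (JM (cyc_T b bd z f n) (cyc_X b bd z f n 0) i).
  elim: i => // i IH ni; rewrite [JM _ _ _]/=.
  by apply: (alg_closedM PP); [apply: (alg_closedM PP); [exact: PT|exact/IH/ltnW]|exact: PT].
have [y [xy yx Py]] := rep_x_inv_closed rep d_gt0 f0_inv.
have {}Py : P y by apply: Py => // a; apply: Pphi.
have Pt i : (i < n)%N -> P (tele b bd (phi i) (phi i.+1)).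
  move=> ni; apply: (alg_closed_sum PP) => j _.
  by apply: (alg_closedM PP); apply: Pphi => //; apply: ltnW.
have PTi i : (i < n)%N -> P (Tinv b bd z eta phi (cyc_T b bd z f n) i).
  move=> ni; apply: (alg_closedB PP); first exact: PT.
  by apply: (alg_closedM PP); [exact: (alg_closed_scal PP)|exact: Pt].
have PJMi i : (i <= n)%N -> P (JMi b bd z eta phi (cyc_T b bd z f n) y i).
  elim: i => // i IH ni; rewrite [JMi _ _ _ _ _ _ _ _]/=.
  by apply: (alg_closedM PP); [apply: (alg_closedM PP); [exact: PTi|exact/IH/ltnW]|exact: PTi].
have Pgen g : P (gen g).
  case: g => [a|i|i|i].
  - rewrite cyc_ten_pure /pure big_nat; apply: (alg_closed_prod PP) => i /andP[_ ni].
    by apply: Pphi.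
  - have ni : (i <= n)%N by rewrite -ltnS ltn_ord.
    by rewrite -cyc_XE; have -> := cyc_X_JM b bd z f ni; apply: PJM.
  - have ni : (i <= n)%N by rewrite -ltnS ltn_ord.
    have X1 : cyc_X b bd z f n i * gen (gen_Xinv i) = 1.
      rewrite cyc_XE; apply: etrans (esym (cyc_pi2 b bd z f _ _)) _.
      exact: etrans (cyc_rel_pi f (rel_XY b bd z i)) (cyc_pi1 b bd z f n.+1).
    have yX := JMi_JM rep yx ni; rewrite -(cyc_X_JM b bd z f ni) in yX.
    by rewrite (inverse_unique yX X1); apply: PJMi.
  - by rewrite -cyc_TE; apply: PT.
elim/cyc_ind; apply: free_alg_ind => [|||||g].
- have -> : cyc_pi b bd z f (0 : free_alg k (aff_gens A n.+1)) = 0 by apply: rmorph0.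
  exact: alg_closed0 PP.
- have -> : cyc_pi b bd z f (1 : free_alg k (aff_gens A n.+1)) = 1 by apply: cyc_pi1.
  exact: alg_closed1 PP.
- move=> u v Pu Pv.
  by have -> := cyc_piD b bd z f u v; apply: (alg_closedD PP).
- move=> c u Pu; have -> := cyc_piZ b bd z f c u.
  by apply: (alg_closedM PP) => //; apply: (alg_closed_scal PP).
- move=> u v Pu Pv.
  by have -> := cyc_piM b bd z f u v; apply: (alg_closedM PP).
- by have := Pgen g; rewrite cyc_genE.
Qed.

End CyclotomicGenerators.

(** * Twisting by a commuting involution, and the parity of H *)

Section TwistRep.
Variables (k : comNzRingType) (A : superalgType k).
Variables (tr : {scalar A}) (symA : symmetric_superalgebra tr).
Variables (B : finType) (b bd : B -> A) (basis_b : homogeneous_basis b).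
Hypothesis dual_bd : forall i j, tr (bd i * b j) = (i == j)%:R.
Variables (z : k) (d : nat) (f : 'I_d -> A).
Hypothesis f_center : forall i, super_center false (f i).
Variables (R : pzRingType) (eta : {rmorphism k -> R}) (n : nat).
Variables (phi : nat -> A -> R) (T : nat -> R) (x : R).
Hypothesis rep : wreath_rep b bd z f eta n phi T x.
Variables (pi : R) (pi2 : pi * pi = 1).
Hypothesis pi_phi : forall i a, (i <= n)%N -> GRing.comm pi (phi i a).
Hypothesis pi_T : forall i, (i < n)%N -> GRing.comm pi (T i).

(** Multiplies odd elements by an involution commuting with all generators. Both sides of every sign
    rule then acquire the same power of [pi]. *)
Definition twist (i : nat) (a : A) : R := phi i (part false a) + phi i (part true a) * pi.

Lemma twist_homog i p a : (i <= n)%N -> homog p a -> twist i a = phi i a * pi ^+ p.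
Proof.
move=> ni; rewrite /twist; case: p => pa.
  rewrite (part_id pa) (part_neq pa) (alg_map0 (rep_alg rep ni)) add0r.
  by rewrite expr1.
by rewrite (part_id pa) (part_neq pa) (alg_map0 (rep_alg rep ni)) mul0r addr0 mulr1.
Qed.

Lemma pi_addb (p q : bool) : pi ^+ p * pi ^+ q = pi ^+ (p (+) q).
Proof. by case: p; case: q => /=; rewrite ?mulr1 ?mul1r. Qed.

Lemma twist_mul i j p q a c : (i <= n)%N -> (j <= n)%N -> homog p a -> homog q c ->
  twist i a * twist j c = phi i a * phi j c * pi ^+ (p (+) q).
Proof.
move=> ni nj pa qc; rewrite (twist_homog ni pa) (twist_homog nj qc) -pi_addb.
rewrite -mulrA (mulrA (pi ^+ p)) -[pi ^+ p * phi j c]/(pi ^+ p * _).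
have -> : pi ^+ p * phi j c = phi j c * pi ^+ p by apply/esym/commrX/commr_sym/pi_phi.
by rewrite !mulrA.
Qed.

(** The two members of a dual pair have equal parity, so the powers of [pi] cancel and the quadratic
    relation survives the twist. *)
Lemma twist_tele i j : (i <= n)%N -> (j <= n)%N ->
  tele b bd (twist i) (twist j) = tele b bd (phi i) (phi j).
Proof.
move=> ni nj; apply: eq_bigr => l _.
rewrite (twist_mul ni nj (bpar_homog basis_b l) (bd_homog symA basis_b dual_bd l)) addbb.
by rewrite mulr1.
Qed.

Lemma twist_comm i a y : (i <= n)%N -> GRing.comm y pi ->
  (forall a, y * phi i a = phi i a * y) -> y * twist i a = twist i a * y.
Proof.
move=> ni yp yphi; rewrite /twist; apply: commrD; first exact: yphi.
by apply: commrM => //; apply: yphi.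
Qed.

Lemma twist_conj i j a y : (i <= n)%N -> (j <= n)%N -> GRing.comm y pi ->
  (forall a, y * phi i a = phi j a * y) -> y * twist i a = twist j a * y.
Proof.
by move=> ni nj yp yphi; rewrite /twist mulrDr mulrDl !mulrA !yphi -!mulrA yp.
Qed.

Lemma twist_rep : GRing.comm x pi -> wreath_rep b bd z f eta n twist T x.
Proof.
move=> xp; split.
- exact: (rep_eta rep).
- move=> i ni; have phiP := rep_alg rep ni; apply: alg_map_homog => [c u v||p q u v pu qv].
  + rewrite /twist !partP !(alg_mapP phiP) mulrDl mulrDr !mulrA.
    by rewrite addrACA.
  + by rewrite (twist_homog ni (homog1 A)) (alg_map1 phiP) mul1r.
  + by rewrite (twist_mul ni ni pu qv) (twist_homog ni (homogM pu qv)) (alg_mapM phiP).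
- move=> i j ni nj ij p q u v pu qv.
  rewrite (twist_mul ni nj pu qv) (twist_mul nj ni qv pu) (rep_sc rep ni nj ij pu qv).
  by rewrite addbC -!mulrA.
- exact: (rep_TT rep).
- exact: (rep_braid rep).
- by move=> i ni; rewrite (twist_tele (ltnW ni) ni); apply: (rep_quad rep).
- move=> i a ni; apply: (twist_conj a (ltnW ni) ni) => [|c]; first exact/commr_sym/pi_T.
  exact: (rep_Tl rep).
- move=> i a ni; apply: (twist_conj a ni (ltnW ni)) => [|c]; first exact/commr_sym/pi_T.
  exact: (rep_Tu rep).
- move=> i j a ni nj ji ji1; apply: (twist_comm a nj) => [|c]; first exact/commr_sym/pi_T.
  exact: (rep_Tphi rep).
- exact: (rep_xT rep).
- exact: (rep_xTx rep).
- by move=> i a ni; apply: (twist_comm a ni xp) => c; apply: (rep_xphi rep).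
rewrite -[RHS](rep_f rep); congr (_ + _); apply: eq_bigr => r _.
by rewrite (twist_homog (leq0n n) (f_center r).1) mulr1.
Qed.

End TwistRep.

Lemma mulr_parts (R : pzRingType) (u0 u1 v0 v1 : R) :
  (u0 + u1) * (v0 + v1) = (u0 * v0 + u1 * v1) + (u0 * v1 + u1 * v0).
Proof. by rewrite mulrDl mulrDr mulrDr [u1 * v0 + _]addrC addrACA. Qed.

Section ScalarMatrices.
Variables (R : pzRingType) (m : nat).

Definition scal_mx : R -> 'M[R]_m := @scalar_mx R m.

Lemma scal_mx_morph : zmod_morphism scal_mx /\ monoid_morphism scal_mx.
Proof. by split; [exact: raddfB|split=> // u v; rewrite /scal_mx scalar_mxM]. Qed.
HB.instance Definition _ := GRing.isZmodMorphism.Build _ _ scal_mx scal_mx_morph.1.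
HB.instance Definition _ := GRing.isMonoidMorphism.Build _ _ scal_mx scal_mx_morph.2.

Lemma mul_scal_mxE u (M : 'M[R]_m) i j : (scal_mx u *m M) i j = u * M i j.
Proof. by rewrite /scal_mx mul_scalar_mx mxE. Qed.

Lemma mul_mx_scalE u (M : 'M[R]_m) i j : (M *m scal_mx u) i j = M i j * u.
Proof.
rewrite mxE (bigD1 j) //= big1 => [|l /negPf lj]; first by rewrite addr0 mxE eqxx mulr1n.
by rewrite mxE lj mulr0n mulr0.
Qed.

End ScalarMatrices.

Section CyclotomicTwist.
Variables (k : comNzRingType) (A : superalgType k).
Variables (tr : {scalar A}) (symA : symmetric_superalgebra tr).
Variables (B : finType) (b bd : B -> A) (basis_b : homogeneous_basis b).
Hypothesis dual_bd : forall i j, tr (bd i * b j) = (i == j)%:R.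
Variables (z : k) (d : nat) (d_gt0 : (0 < d)%N) (f : 'I_d -> A).
Hypothesis f_center : forall i, super_center false (f i).
Hypothesis f0_inv : forall i : 'I_d, i = 0%N :> nat -> exists u, f i * u = 1 /\ u * f i = 1.
Variable n : nat.

Local Notation H := (cyc_alg b bd z f n.+1).
Local Notation gen g := (cyc_gen b bd z f g : H).
Local Notation phi := (@cyc_phi k A B b bd z d f n).
Local Notation T := (@cyc_T k A B b bd z d f n).
Local Notation X := (@cyc_X k A B b bd z d f n).
Local Notation eta := (cyc_scal b bd z f n.+1).

Lemma cyc_XXinv (i : 'I_n.+1) : X i * gen (gen_Xinv i) = 1.
Proof.
rewrite cyc_XE; apply: etrans (esym (cyc_pi2 b bd z f _ _)) _.
exact: etrans (cyc_rel_pi f (rel_XY b bd z i)) (cyc_pi1 b bd z f n.+1).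
Qed.

Lemma cyc_XinvX (i : 'I_n.+1) : gen (gen_Xinv i) * X i = 1.
Proof.
rewrite cyc_XE; apply: etrans (esym (cyc_pi2 b bd z f _ _)) _.
exact: etrans (cyc_rel_pi f (rel_YX b bd z i)) (cyc_pi1 b bd z f n.+1).
Qed.

Lemma cyc_homog_phi p i a : homog p a -> cyc_homog p (phi i a).
Proof.
move=> pa; have := cyc_homog_ten b bd z f (at_pos_homog (inord i : 'I_n.+1) pa).
rewrite (_ : odd _ = p) //; rewrite (bigD1 (inord i)) //= big1 ?addn0 => [|j /negPf ->].
  by rewrite eqxx andbT oddb.
by rewrite andbF.
Qed.

Lemma cyc_homog_Tn i : cyc_homog false (T i).
Proof.
have [ni|ni] := ltnP i n; first by rewrite -[i]/(val (Ordinal ni)) cyc_TE; apply: cyc_homog_T.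
Transparent cyc_T.
by rewrite /cyc_T insubF ?ltnNge ?ni //; apply: cyc_homog0.
Opaque cyc_T.
Qed.

Section Twist.
Variables (S : pzRingType) (etaS : {rmorphism k -> S}) (l : {rmorphism H -> S}) (pi : S).
Hypothesis etaSC : forall c y, etaS c * y = y * etaS c.
Hypothesis l_eta : forall c, l (eta c) = etaS c.
Hypothesis pi2 : pi * pi = 1.
Hypothesis pi_l : forall h, GRing.comm pi (l h).

(** The formula l(h) pi^p cannot serve as a definition before the parities of H are known to be
    independent. The morphism is therefore defined on generators by the universal property, and the
    formula is verified along the construction of [cyc_homog]. *)
Lemma cyc_twist : exists L : {rmorphism H -> S},
  forall p h, cyc_homog p h -> L h = l h * pi ^+ p.
Proof.
have rep := rep_rmorph l_eta etaSC (cyc_wreath_rep b bd z f n).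
have pi_phi i a : (i <= n)%N -> GRing.comm pi (l (phi i a)) by move=> _.
have pi_T i : (i < n)%N -> GRing.comm pi (l (T i)) by move=> _.
have rep' := twist_rep symA basis_b dual_bd f_center rep pi2 pi_phi pi_T (commr_sym (pi_l _)).
have [L [Leta Lphi LT LX0]] := cyc_lift symA basis_b dual_bd rep' d_gt0 f0_inv.
have LTn i : (i < n)%N -> L (T i) = l (T i).
  by move=> ni; rewrite -[i]/(val (Ordinal ni)) cyc_TE LT -cyc_TE.
have LX i : (i <= n)%N -> L (X i) = l (X i).
  elim: i => [|i IH] ni.
    by have E := cyc_XE b bd z f (ord0 : 'I_n.+1); rewrite E LX0 -E.
  have E := cyc_TXT b bd z f ni; rewrite -E.
  rewrite [LHS](rmorphM L) [RHS](rmorphM l) (rmorphM L (T i)) (rmorphM l (T i)) /=.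
  by rewrite (LTn _ ni) (IH (ltnW ni)).
exists L => p h; elim=> {p h}.
- by move=> p; rewrite !rmorph0 mul0r.
- by move=> p x y _ Lx _ Ly; rewrite !rmorphD Lx Ly mulrDl.
- by move=> c; rewrite Leta l_eta mulr1.
- move=> p q x y _ Lx _ Ly; rewrite !rmorphM Lx Ly -(pi_addb pi2) !mulrA; congr (_ * _).
  by rewrite -!mulrA; congr (_ * _); apply/esym/commrX/commr_sym/pi_l.
- move=> p a pa; rewrite (cyc_ten_pure b bd z f) /pure.
  have E m : (m <= n.+1)%N ->
      L (\prod_(0 <= i < m) phi i (a (inord i))) =
      l (\prod_(0 <= i < m) phi i (a (inord i))) * pi ^+ odd (\sum_(0 <= i < m) p (inord i)).
    elim: m => [|m IH] nm; first by rewrite !big_geq // !rmorph1 mulr1.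
    rewrite !big_nat_recr //= !rmorphM IH ?(ltnW nm) // oddD -(pi_addb pi2) !mulrA oddb.
    have -> : phi m (a (inord m)) = gen (gen_ten (at_pos (inord m) (a (inord m)))).
      by rewrite -cyc_phiE inordK.
    rewrite Lphi inordK // (twist_homog rep pi nm (pa _)) /= !mulrA; congr (_ * _).
    rewrite -cyc_phiE inordK // -!mulrA; congr (_ * _).
    by apply/esym/commrX/commr_sym/pi_l.
  rewrite (E _ (leqnn _)).
  have -> // : (\sum_(0 <= i < n.+1) p (inord i) = \sum_(i < n.+1) p i)%N.
  by rewrite big_mkord; apply: eq_bigr => i _; rewrite inord_val.
- by move=> i; rewrite -cyc_XE LX ?mulr1 // -ltnS.
- move=> i; have ni : (i <= n)%N by rewrite -ltnS.
  have e1 : L (gen (gen_Xinv i)) * l (X i) = 1 by rewrite -LX // -rmorphM cyc_XinvX rmorph1.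
  have e2 : l (X i) * l (gen (gen_Xinv i)) = 1 by rewrite -rmorphM cyc_XXinv rmorph1.
  (* [L] and [l] agree on X_i, so their values on the inverse generator are inverses of the same
     element. *)
  by rewrite mulr1 (inverse_unique e1 e2).
- by move=> i; rewrite LT mulr1 -cyc_TE.
Qed.

End Twist.

(** Twisting with the 2 x 2 flip sends [h] to the scalar matrix of [h] when it is read as even, and
    to that matrix times the flip when it is read as odd. The two have top left entries h and 0. *)
Lemma cyc_homog_direct (h : H) : cyc_homog false h -> cyc_homog true h -> h = 0.
Proof.
move=> h0 h1; pose pi : 'M[H]_2 := \matrix_(i, j) (i != j)%:R.
have pi2 : pi * pi = 1.
  apply/matrixP => i j; rewrite mxE !big_ord_recl big_ord0 !mxE.
  by case: i j => [[|[]]] // ? [[|[]]] // ?; rewrite /= ?mulr1 ?mul0r ?mulr0 ?addr0 ?add0r.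
have piC (u : H) : GRing.comm pi (scal_mx 2 u).
  by apply/matrixP => i j; rewrite [LHS]mul_mx_scalE [RHS]mul_scal_mxE !mxE commr_nat.
have etaC c (y : 'M[H]_2) : (scal_mx 2 \o eta) c * y = y * (scal_mx 2 \o eta) c.
  apply/matrixP => i j; rewrite [LHS]mul_scal_mxE [RHS]mul_mx_scalE.
  exact: cyc_scal_central.
have [L LE] := cyc_twist etaC (fun c => erefl) pi2 piC.
have := LE _ _ h0; rewrite (LE _ _ h1) => /matrixP/(_ ord0 ord0).
rewrite /= mulr1 [LHS]mul_scal_mxE !mxE /= mulr0 => ->.
by rewrite mulr1n.
Qed.

Definition cyc_has_parts (h : H) : Prop :=
  exists h0 h1, [/\ cyc_homog false h0, cyc_homog true h1 & h = h0 + h1].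

Lemma cyc_homog_decomp (h : H) : cyc_has_parts h.
Proof.
move: h; apply: (cyc_gen_ind d_gt0 f0_inv (P := cyc_has_parts)).
- split.
  + move=> c; exists (eta c), 0; split; [exact: cyc_homog_scal|exact: cyc_homog0|].
    by rewrite addr0.
  + move=> _ _ [u0 [u1 [U0 U1 ->]]] [v0 [v1 [V0 V1 ->]]]; exists (u0 + v0), (u1 + v1).
    by split; [exact: cyc_homogD|exact: cyc_homogD|rewrite addrACA].
  + move=> _ _ [u0 [u1 [U0 U1 ->]]] [v0 [v1 [V0 V1 ->]]].
    exists (u0 * v0 + u1 * v1), (u0 * v1 + u1 * v0); split.
    * by apply: cyc_homogD; [exact: (cyc_homogM U0 V0)|exact: (cyc_homogM U1 V1)].
    * by apply: cyc_homogD; [exact: (cyc_homogM U0 V1)|exact: (cyc_homogM U1 V0)].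
    exact: mulr_parts.
- move=> i a _; exists (phi i (part false a)), (phi i (part true a)).
  split; [exact/cyc_homog_phi/part_homog|exact/cyc_homog_phi/part_homog|].
  exact: (alg_map_part (cyc_phi_alg b bd z f n i)).
- move=> i _; exists (T i), 0; split; [exact: cyc_homog_Tn|exact: cyc_homog0|].
  by rewrite addr0.
exists (X 0), 0; split; [|exact: cyc_homog0|by rewrite addr0].
by have -> := cyc_XE b bd z f (ord0 : 'I_n.+1); apply: cyc_homog_X.
Qed.

Lemma cyc_superalgebra : superalgebra eta (@cyc_homog k A B b bd z d f n.+1).
Proof.
split.
- by split; [exact: rmorphB|split; [exact: rmorph1|exact: rmorphM]].
- exact: cyc_scal_central.
- exact: cyc_homog0.
- move=> p c u v hu hv; apply: cyc_homogD => //; rewrite -[p]addFb.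
  exact: cyc_homogM (cyc_homog_scal _ _ _ _ _ _) hu.
- exact: cyc_homog_decomp.
- exact: cyc_homog_direct.
- by rewrite -(rmorph1 eta); apply: cyc_homog_scal.
- exact: cyc_homogM.
Qed.

End CyclotomicTwist.

(** * The model of H_{n+2} as a right H_{n+1}-module *)

Section ColumnOperators.
Variables (R : pzRingType) (n : nat).

Definition ecol (j : nat) (u : R) : 'cV[R]_n := \col_i (if i == j :> nat then u else 0).

Lemma ecolD j u v : ecol j (u + v) = ecol j u + ecol j v.
Proof. by apply/colP => i; rewrite !mxE; case: eqP => // _; rewrite addr0. Qed.

Lemma ecol0 j : ecol j 0 = 0.
Proof. by apply/colP => i; rewrite !mxE; case: eqP. Qed.

Lemma ecolN j u : ecol j (- u) = - ecol j u.
Proof. by apply/colP => i; rewrite !mxE; case: eqP => // _; rewrite oppr0. Qed.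

Lemma ecol_sum (I : Type) (r : seq I) (Q : pred I) j (F : I -> R) :
  ecol j (\sum_(i <- r | Q i) F i) = \sum_(i <- r | Q i) ecol j (F i).
Proof. exact: (big_morph (ecol j) (ecolD j) (ecol0 j)). Qed.

(** Operators are given by the image of each basis column as a list of pairs (row, coefficient).
    Coefficients multiply from the left, so a relation between operators can be checked on the
    columns [ecol j u] by [opmxP]. *)
Definition opmx (l : nat -> seq (nat * R)) : 'M[R]_n :=
  \matrix_(i, j) \sum_(p <- l j) (if i == p.1 :> nat then p.2 else 0).

Lemma opmxE l j u : (j < n)%N -> opmx l *m ecol j u = \sum_(p <- l j) ecol p.1 (p.2 * u).
Proof.
move=> nj; apply/colP => i; rewrite mxE summxE (bigD1 (Ordinal nj)) //= big1 => [|m mj].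
  rewrite addr0 !mxE eqxx mulr_suml; apply: eq_bigr => p _; rewrite mxE.
  by case: eqP => // _; rewrite mul0r.
by rewrite !mxE; case: eqP => [e|_]; rewrite ?mulr0 //; case/eqP: mj; apply: val_inj.
Qed.

Lemma opmxP (F G : 'M[R]_n) :
  (forall j u, (j < n)%N -> F *m ecol j u = G *m ecol j u) -> F = G.
Proof.
move=> H; apply/matrixP => i j; have := H j 1 (ltn_ord j).
move/(congr1 (fun M : 'cV_n => M i 0)); rewrite !mxE (bigD1 j) //= big1 => [|m /negPf mj].
  rewrite [X in _ = X](bigD1 j) //= [X in _ = _ + X]big1 => [|m /negPf mj].
    by rewrite !addr0 !mxE eqxx !mulr1.
  by rewrite mxE val_eqE mj mulr0.
by rewrite mxE val_eqE mj mulr0.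
Qed.

Lemma scal_ecol c j u : scal_mx n c *m ecol j u = ecol j (c * u).
Proof.
by apply/colP => i; rewrite /scal_mx mul_scalar_mx !mxE; case: eqP => // _; rewrite mulr0.
Qed.

Lemma op1_ecol j u : (1 : 'M[R]_n) *m ecol j u = ecol j u.
Proof. by rewrite mul1mx. Qed.

End ColumnOperators.

(** * The action of H_{n+2} on columns, for abstract operators X and ev *)

Section ExtensionRep.
Variables (k : comNzRingType) (A : superalgType k).
Variables (tr : {scalar A}) (symA : symmetric_superalgebra tr).
Variables (B : finType) (b bd : B -> A) (basis_b : homogeneous_basis b).
Hypothesis dual_bd : forall i j, tr (bd i * b j) = (i == j)%:R.
Variables (z : k) (d : nat) (f : 'I_d -> A).
Hypothesis f_center : forall i, super_center false (f i).
Variables (R : pzRingType) (eta : {rmorphism k -> R}) (n : nat).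
Variables (phi : nat -> A -> R) (T : nat -> R) (y : R).
Hypothesis rep : wreath_rep b bd z f eta n phi T y.
Variables (al : A -> R) (X ev G : R).
Hypothesis alP : alg_map eta al.
Hypothesis al_phi : forall i, (i <= n)%N -> supercomm al (phi i).
Hypothesis al_T : forall i a, (i < n)%N -> GRing.comm (T i) (al a).
Hypothesis al_y : forall a, GRing.comm y (al a).
Hypothesis X_al : forall a, GRing.comm X (al a).
Hypothesis X_phi : forall i a, (i <= n)%N -> GRing.comm X (phi i a).
Hypothesis X_T : forall i, (i < n)%N -> GRing.comm X (T i).
Hypothesis X_y : GRing.comm X y.
Hypothesis ev_al : forall a, GRing.comm ev (al a).
Hypothesis ev_phi : forall i a, (i <= n)%N -> GRing.comm ev (phi i a).
Hypothesis ev_T : forall i, (0 < i < n)%N -> GRing.comm ev (T i).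
Hypothesis ev_y : GRing.comm ev y.
Hypothesis ev_ev : ev * ev = ev.
Hypothesis ev_T0_ev : (0 < n)%N -> ev * T 0 * ev = T 0 * ev.
Hypothesis ev_X : tele b bd al (phi 0) * ev * X = tele b bd al (phi 0) * y * ev.
(** Applied to X^r, this is an identity between T_0 and y^r in H, proved as [y_T0_comm]. The
    relation between x and T_0 on the column e_2 rests on it. *)
Hypothesis ev_T0 : (0 < n)%N ->
  y * T 0 * ev * T 0 - T 0 * ev * T 0 * y =
  eta z * tele b bd (phi 0) (phi 1) * (y * T 0 * ev - ev * T 0 * y).
Hypothesis ev_G : ev = 1 - (X - y) * G.
Hypothesis X_f : X ^+ d + \sum_(r < d) al (f r) * X ^+ r = 0.

Let etaC := rep_eta rep.
Local Notation M := 'M[R]_n.+2.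
Local Notation ec := (@ecol R n.+2).
Local Notation t i := (tele b bd (phi i) (phi i.+1)).
Local Notation tau i := (tele b bd al (phi i)).
(** When [ev] is the substitution X := y, this is p(X) |-> X p(y) - y p(X), the correction that
    appears in x T_0 p(x) T_0 ... T_n when x is moved to the far right. *)
Let D := X * ev - y.

(* [ecol j u] stands for e_j u, where e_j = T_{j-1} ... T_0 p T_0 ... T_n (strands
   numbered from 0): on p the strand 0 acts by [al] and [X], and the other n+1
   strands act through [phi], [T] and [y] once moved past T_0 ... T_n.  [ext_phi],
   [ext_T] and [ext_x] are the resulting action of H_{n+2} on the e_j. *)
Definition psi j i : A -> R :=
  if i == j then al else if (i < j)%N then phi i else phi i.-1.

(** T_{j-1} ... T_0. In x e_{j+1} the element x first passes T_j ... T_1; these then act on the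
    correction term in e_0, where T_{i+1} acts through T_i. *)
Fixpoint cox j : R := if j is i.+1 then T i * cox i else 1.

Definition ext_phi i a : M := opmx n.+2 (fun j => [:: (j, psi j i a)]).
Definition ext_T i : M := opmx n.+2 (fun j =>
  if j == i then [:: (i.+1, 1)]
  else if j == i.+1 then [:: (i, 1); (i.+1, eta z * tau i)]
  else [:: (j, T (if (i < j)%N then i else i.-1))]).
Definition ext_x : M := opmx n.+2 (fun j =>
  if j is i.+1 then [:: (j, y); (0%N, eta z * (cox i * tau 0 * D))] else [:: (0%N, X)]).
Definition ext_eta : k -> M := scal_mx n.+2 \o eta.
HB.instance Definition _ := GRing.RMorphism.on ext_eta.

Lemma psi_same i : psi i i = al. Proof. by rewrite /psi eqxx. Qed.

Lemma psi_lt j i : (i < j)%N -> psi j i = phi i.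
Proof. by move=> ij; rewrite /psi ltn_eqF // ij. Qed.

Lemma psi_gt j i : (j < i)%N -> psi j i = phi i.-1.
Proof. by move=> ji; rewrite /psi gtn_eqF // ltnNge ltnW. Qed.

Lemma psiP j i : (j <= n.+1)%N -> (i <= n.+1)%N -> alg_map eta (psi j i).
Proof.
move=> nj ni; rewrite /psi; case: eqP => // ij; case: ltnP => ij'; apply: (rep_alg rep); lia.
Qed.

Lemma psi_sc j i l : (j <= n.+1)%N -> (i <= n.+1)%N -> (l <= n.+1)%N -> i != l ->
  supercomm (psi j i) (psi j l).
Proof.
move=> nj ni nl il; rewrite /psi.
have [ij|ij] := eqVneq i j; have [lj|lj] := eqVneq l j.
- by rewrite ij lj eqxx in il.
- by case: ltnP => h; apply: al_phi; lia.
- by case: ltnP => h; apply/supercomm_sym/al_phi; lia.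
by do 2![case: ltnP => ?]; apply: (rep_sc rep); lia.
Qed.

Lemma ext_phiE i a j u : (j <= n.+1)%N -> ext_phi i a *m ec j u = ec j (psi j i a * u).
Proof. by move=> nj; rewrite opmxE // big_seq1. Qed.

Lemma ext_T_same i u : (i <= n)%N -> ext_T i *m ec i u = ec i.+1 u.
Proof. by move=> nj; rewrite opmxE ?ltnS 1?leqW // eqxx big_seq1 /= mul1r. Qed.

Lemma ext_T_succ i u : (i <= n)%N ->
  ext_T i *m ec i.+1 u = ec i u + ec i.+1 (eta z * (tau i * u)).
Proof.
by move=> nj; rewrite opmxE // eqn_leq ltnn /= eqxx big_cons big_seq1 /= mul1r -mulrA.
Qed.

Lemma ext_T_gt i j u : (j <= n.+1)%N -> (i.+1 < j)%N -> ext_T i *m ec j u = ec j (T i * u).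
Proof.
move=> nj ij; rewrite opmxE // gtn_eqF ?(ltnW ij) // gtn_eqF //.
by rewrite big_seq1.
Qed.

Lemma ext_T_lt i j u : (i <= n)%N -> (j < i)%N -> ext_T i *m ec j u = ec j (T i.-1 * u).
Proof.
move=> ni ij; have ij1 : (j < i.+1)%N by apply: leqW.
have nj : (j < n.+2)%N by apply: (leq_trans ij1); apply: leqW.
by rewrite opmxE // (ltn_eqF ij) (ltn_eqF ij1) ltnNge ltnW //= big_seq1.
Qed.

Lemma ext_x0 u : ext_x *m ec 0 u = ec 0 (X * u).
Proof. by rewrite opmxE // big_seq1. Qed.

Lemma ext_xS j u : (j <= n)%N ->
  ext_x *m ec j.+1 u = ec j.+1 (y * u) + ec 0 (eta z * (cox j * (tau 0 * (D * u)))).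
Proof. by move=> nj; rewrite opmxE // big_cons big_seq1 /= -!mulrA. Qed.

Lemma ext_mulE (F F' : M) (v : 'cV[R]_n.+2) : (F * F') *m v = F *m (F' *m v).
Proof. by rewrite mulmxA. Qed.

Lemma ext_tele i l j u : (j <= n.+1)%N ->
  tele b bd (ext_phi i) (ext_phi l) *m ec j u = ec j (tele b bd (psi j i) (psi j l) * u).
Proof.
move=> nj; rewrite mulmx_suml mulr_suml ecol_sum; apply: eq_bigr => x _.
by rewrite ext_mulE !ext_phiE // mulrA.
Qed.

Lemma ext_eta_ecol c j u : ext_eta c *m ec j u = ec j (eta c * u).
Proof. exact: scal_ecol. Qed.

Lemma ext_phi_alg i : (i <= n.+1)%N -> alg_map ext_eta (ext_phi i).
Proof.
move=> ni; split=> [c u v||u v]; apply: opmxP => j w nj.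
- by rewrite mulmxDl ext_mulE !ext_phiE // ext_eta_ecol (alg_mapP (psiP nj ni)) mulrDl ecolD mulrA.
- by rewrite ext_phiE // (alg_map1 (psiP nj ni)) mul1r op1_ecol.
- by rewrite ext_mulE !ext_phiE // (alg_mapM (psiP nj ni)) mulrA.
Qed.

Lemma sign_ecol m j u : ((-1) ^+ m : M) *m ec j u = ec j ((-1) ^+ m * u).
Proof. by rewrite -[RHS]scal_ecol; congr (_ *m _); rewrite rmorphXn rmorphN1. Qed.

Lemma ext_sc i l : (i <= n.+1)%N -> (l <= n.+1)%N -> i != l -> supercomm (ext_phi i) (ext_phi l).
Proof.
move=> ni nl il p q u v pu qv; apply: opmxP => j w nj.
rewrite !ext_mulE !ext_phiE // sign_ecol mulrA (psi_sc nj ni nl il pu qv).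
by rewrite -!mulrA.
Qed.

Lemma eta_left c u v : u * (eta c * v) = eta c * (u * v).
Proof. by rewrite mulrA -etaC mulrA. Qed.

Lemma quad_left i u : (i < n)%N -> T i * (T i * u) = eta z * (t i * (T i * u)) + u.
Proof. by move=> ni; rewrite mulrA (rep_quad rep ni) mulrDl mul1r -!mulrA. Qed.

Lemma tau_comm_T i j : (i < n)%N -> (j <= n)%N -> j != i -> j != i.+1 -> GRing.comm (T i) (tau j).
Proof.
move=> ni nj ji ji1; apply: (tele_comm0 symA basis_b dual_bd) => a; first exact: al_T.
exact: (rep_Tphi rep).
Qed.

Lemma T_taul i : (i < n)%N -> T i * tau i = tau i.+1 * T i.
Proof. by move=> ni; apply: tele_conj => a; [apply: al_T|apply: (rep_Tl rep)]. Qed.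

Lemma T_tauu i : (i < n)%N -> T i * tau i.+1 = tau i * T i.
Proof. by move=> ni; apply: tele_conj => a; [apply: al_T|apply: (rep_Tu rep)]. Qed.

Lemma phi_tau i a : (i <= n)%N -> phi i a * tau i = tau i * al a.
Proof.
move=> ni; exact: (teleMr symA basis_b dual_bd etaC a alP (rep_alg rep ni) (al_phi ni)).
Qed.

Lemma al_tau i a : (i <= n)%N -> al a * tau i = tau i * phi i a.
Proof. by move=> ni; apply: (teleMl symA basis_b dual_bd etaC _ alP (rep_alg rep ni)). Qed.

Lemma phi_tau_comm i j a : (i <= n)%N -> (j <= n)%N -> i != j -> GRing.comm (phi i a) (tau j).
Proof.
move=> ni nj ij; apply: (supercomm_tele symA basis_b dual_bd a (rep_alg rep ni)).
  exact/supercomm_sym/al_phi.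
exact: (rep_sc rep).
Qed.

Lemma tau_tau i j : (i <= n)%N -> (j <= n)%N -> i != j ->
  tau i * tau j = tele b bd (phi i) (phi j) * tau i.
Proof.
move=> ni nj ij; apply: (tele_tele symA basis_b dual_bd etaC) => //.
- exact: (rep_alg rep).
- exact: (rep_alg rep).
- exact: al_phi.
- exact: al_phi.
- exact: (rep_sc rep).
Qed.

Lemma tau_t i j : (i <= n)%N -> (j <= n)%N -> i != j ->
  tau i * tele b bd (phi i) (phi j) = tau j * tau i.
Proof.
move=> ni nj ij; have [pi pj] := (rep_alg rep ni, rep_alg rep nj).
have sc := supercomm_sym (al_phi ni).
rewrite -(tele_sym symA basis_b dual_bd etaC alP pi (al_phi ni)).
rewrite (tele_tele symA basis_b dual_bd etaC pi alP pj sc) //.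
- exact: (rep_sc rep).
- exact: al_phi.
Qed.

Lemma ext_TT i l : (i.+1 < l)%N -> (l < n.+1)%N -> ext_T i * ext_T l = ext_T l * ext_T i.
Proof.
move=> il nl; apply: opmxP => j u nj; rewrite !ext_mulE.
have [ni l0] : (i <= n)%N /\ (i < l.-1)%N by lia.
have [ln li] : (l.-1 < n)%N /\ (i < n)%N by lia.
case: (ltngtP j i) => [ji|ij|->].
- rewrite (ext_T_lt u nl) ?(ltn_trans ji) ?(ext_T_lt _ ni) //; try lia.
  rewrite (ext_T_lt _ nl) ?(ltn_trans ji) // ?mulrA; try lia.
  by rewrite (rep_TT rep (i := i.-1)) //; lia.
- have [->|ji1] := eqVneq j i.+1.
    rewrite (ext_T_lt _ nl il) !(ext_T_succ _ ni) mulmxDr (ext_T_lt _ nl il).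
    rewrite (ext_T_lt _ nl) 1?ltnW // eta_left !(mulrA _ _ u).
    by rewrite (tau_comm_T ln) //; lia.
  have ij1 : (i.+1 < j)%N by lia.
  rewrite (ext_T_gt u nj ij1).
  case: (ltngtP j l) => [jl|lj|->].
  + by rewrite !(ext_T_lt _ nl jl) (ext_T_gt _ nj ij1) !mulrA (rep_TT rep) //; lia.
  + have [->|jl1] := eqVneq j l.+1.
      have il1 : (i.+1 < l.+1)%N by lia.
      rewrite !(ext_T_succ _ nl) mulmxDr (ext_T_gt _ _ il) ?(ltnW nl) // !(ext_T_gt _ _ il1) //.
      by rewrite eta_left !(mulrA _ _ u) (tau_comm_T li) //; lia.
    have lj1 : (l.+1 < j)%N by lia.
    rewrite !(ext_T_gt _ nj lj1) (ext_T_gt _ nj ij1) !mulrA (rep_TT rep il) //; lia.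
  have il1 : (i.+1 < l.+1)%N by lia.
  by rewrite !(ext_T_same _ nl) (ext_T_gt _ _ il1).
have il0 : (i < l)%N by lia.
by rewrite (ext_T_lt _ nl il0) !(ext_T_same _ ni) (ext_T_lt _ nl il).
Qed.

(** Columns away from i, i+1, i+2 repeat the braid relation of H, with indices shifted when they lie
    below i. On column i+2 two teleporters meet, and the identity [taulu] matches them. *)
Lemma ext_braid i : (i.+1 < n.+1)%N ->
  ext_T i * ext_T i.+1 * ext_T i = ext_T i.+1 * ext_T i * ext_T i.+1.
Proof.
move=> ni1; apply: opmxP => j u nj; rewrite !ext_mulE.
have ni : (i <= n)%N by lia.
have li : (i < n)%N by lia.
have i1 : (i < i.+1)%N by [].
have i2 : (i.+1 < i.+2)%N by [].
have n2 : (i.+2 <= n.+1)%N by [].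
have taulu : tau i * t i = tau i.+1 * tau i by apply: tau_t; lia.
case: (ltngtP j i) => [ji|ij|->].
- have ji1 : (j < i.+1)%N by lia.
  rewrite 2!(ext_T_lt _ ni ji, ext_T_lt _ li ji1) !(ext_T_lt _ ni ji, ext_T_lt _ li ji1) /=.
  case: i ni1 ni li ji {ji1 i1 i2 n2 taulu} => // i ni1 ni li ji /=.
  by rewrite !mulrA (rep_braid rep).
- have [->|ji1] := eqVneq j i.+1.
    rewrite (ext_T_succ _ ni) !mulmxDr (ext_T_lt _ li i1) (ext_T_same _ li).
    rewrite (ext_T_same _ ni) (ext_T_gt _ n2 i2) (ext_T_same _ li) (ext_T_gt _ n2 i2).
    by rewrite (ext_T_succ _ li) eta_left !(mulrA _ _ u) (T_taul li).
  have [->|ji2] := eqVneq j i.+2.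
    rewrite !(mulmxDr, ext_T_same _ ni, ext_T_same _ li, ext_T_succ _ ni, ext_T_succ _ li,
      ext_T_gt _ n2 i2, ext_T_lt _ li i1) /=.
    have E1 w : T i * (eta z * (tau i.+1 * w)) = eta z * (tau i * (T i * w)).
      by rewrite eta_left (mulrA (T i)) (T_tauu li) -mulrA.
    have E2 : eta z * (tau i * (eta z * (t i * (T i * u)) + u)) =
        eta z * (tau i * u) + eta z * (tau i.+1 * (eta z * (tau i * (T i * u)))).
      rewrite mulrDr mulrDr addrC (eta_left z (tau i)) (eta_left z (tau i.+1)).
      by rewrite (mulrA (tau i) (t i)) taulu -mulrA.
    by rewrite !E1 (quad_left _ li) E2 ecolD addrACA.
  have ij2 : (i.+2 < j)%N by lia.
  have ij1 : (i.+1 < j)%N by lia.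
  by rewrite 2!(ext_T_gt _ nj ij1, ext_T_gt _ nj ij2) !(ext_T_gt _ nj ij1, ext_T_gt _ nj ij2)
    !mulrA (rep_braid rep) //; lia.
by rewrite !(ext_T_same _ ni) (ext_T_same _ li) (ext_T_lt _ li i1) (ext_T_same _ ni)
   (ext_T_same _ li) (ext_T_gt _ n2 i2).
Qed.

Lemma ext_quad i : (i < n.+1)%N -> ext_T i * ext_T i =
  ext_eta z * (tele b bd (ext_phi i) (ext_phi i.+1) * ext_T i) + 1.
Proof.
move=> ni; apply: opmxP => j u nj; rewrite mulmxDl op1_ecol !ext_mulE.
have n1 : (i.+1 <= n.+1)%N by [].
have n0 : (i <= n.+1)%N by lia.
have taui : tele b bd (phi i) al = tau i.
  by apply: (tele_sym symA basis_b dual_bd etaC alP); [exact: (rep_alg rep)|exact: al_phi].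
case: (ltngtP j i) => [ji|ij|->].
- have ji1 : (j < i.+1)%N by lia.
  rewrite !(ext_T_lt _ ni ji) ext_tele // ext_eta_ecol -ecolD (psi_gt ji) (psi_gt ji1) /=.
  case: i ni ji {n1 n0 taui ji1} => // i ni ji /=.
  by rewrite quad_left.
- have [->|ji1] := eqVneq j i.+1; last first.
    have ij1 : (i.+1 < j)%N by lia.
    rewrite !(ext_T_gt _ nj ij1) ext_tele // ext_eta_ecol -ecolD (psi_lt ij) (psi_lt ij1).
    by rewrite quad_left //; lia.
  rewrite (ext_T_succ _ ni) !mulmxDr (ext_T_same _ ni) (ext_T_succ _ ni) !ext_tele //.
  rewrite !ext_eta_ecol psi_same (psi_lt (ltnSn i)) psi_same (psi_gt (ltnSn i)) taui /=.
  by rewrite addrC.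
rewrite (ext_T_same _ ni) (ext_T_succ _ ni) ext_tele // ext_eta_ecol addrC.
by rewrite psi_same (psi_lt (ltnSn i)) taui.
Qed.

Lemma T_psi i j l a : (i < n)%N -> (j <= n.+1)%N -> (l <= n.+1)%N ->
  (l < j -> (l != i) && (l != i.+1))%N -> (j < l -> (l != i.+1) && (l != i.+2))%N ->
  T i * psi j l a = psi j l a * T i.
Proof.
move=> ni nj nl lj jl; rewrite /psi; have [_|ne] := eqVneq l j; first exact: al_T.
case: ltnP => h; first by have /andP[l1 l2] := lj h; apply: (rep_Tphi rep) => //; lia.
have h' : (j < l)%N by rewrite ltn_neqAle eq_sym ne.
by have /andP[l1 l2] := jl h'; apply: (rep_Tphi rep) => //; lia.
Qed.

Lemma ext_Tl i a : (i < n.+1)%N -> ext_T i * ext_phi i a = ext_phi i.+1 a * ext_T i.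
Proof.
move=> ni; apply: opmxP => j u nj; rewrite !ext_mulE.
have n1 : (i.+1 <= n.+1)%N by [].
have n0 : (i <= n.+1)%N by lia.
case: (ltngtP j i) => [ji|ij|->].
- have ji1 : (j < i.+1)%N by lia.
  rewrite ext_phiE // !(ext_T_lt _ ni ji) ext_phiE // (psi_gt ji) (psi_gt ji1).
  case: i ni ji {n1 n0 ji1} => // i ni ji /=.
  by rewrite !mulrA (rep_Tl rep).
- have [->|ji1] := eqVneq j i.+1; last first.
    have ij1 : (i.+1 < j)%N by lia.
    rewrite ext_phiE // !(ext_T_gt _ nj ij1) ext_phiE // (psi_lt ij) (psi_lt ij1).
    by rewrite !mulrA (rep_Tl rep) //; lia.
  rewrite ext_phiE // !(ext_T_succ _ ni) mulmxDr !ext_phiE // psi_same (psi_lt (ltnSn i)).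
  by rewrite (psi_gt (ltnSn i)) eta_left !(mulrA _ _ u) al_tau.
by rewrite ext_phiE // !(ext_T_same _ ni) ext_phiE // !psi_same.
Qed.

Lemma ext_Tu i a : (i < n.+1)%N -> ext_T i * ext_phi i.+1 a = ext_phi i a * ext_T i.
Proof.
move=> ni; apply: opmxP => j u nj; rewrite !ext_mulE.
have n1 : (i.+1 <= n.+1)%N by [].
have n0 : (i <= n.+1)%N by lia.
case: (ltngtP j i) => [ji|ij|->].
- have ji1 : (j < i.+1)%N by lia.
  rewrite ext_phiE // !(ext_T_lt _ ni ji) ext_phiE // (psi_gt ji) (psi_gt ji1).
  case: i ni ji {n1 n0 ji1} => // i ni ji /=.
  by rewrite !mulrA (rep_Tu rep).
- have [->|ji1] := eqVneq j i.+1; last first.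
    have ij1 : (i.+1 < j)%N by lia.
    rewrite ext_phiE // !(ext_T_gt _ nj ij1) ext_phiE // (psi_lt ij) (psi_lt ij1).
    by rewrite !mulrA (rep_Tu rep) //; lia.
  rewrite ext_phiE // !(ext_T_succ _ ni) mulmxDr !ext_phiE // !psi_same (psi_lt (ltnSn i)).
  by rewrite eta_left !(mulrA _ _ u) phi_tau.
by rewrite ext_phiE // !(ext_T_same _ ni) ext_phiE // (psi_gt (ltnSn i)) (psi_lt (ltnSn i)).
Qed.

Lemma ext_Tphi i l a : (i < n.+1)%N -> (l <= n.+1)%N -> l != i -> l != i.+1 ->
  ext_T i * ext_phi l a = ext_phi l a * ext_T i.
Proof.
move=> ni nl li li1; apply: opmxP => j u nj; rewrite !ext_mulE.
have n1 : (i.+1 <= n.+1)%N by [].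
have n0 : (i <= n.+1)%N by lia.
have psiE : psi i l = psi i.+1 l.
  by rewrite /psi (negPf li) (negPf li1) ltnS [(l <= i)%N]leq_eqVlt (negPf li).
case: (ltngtP j i) => [ji|ij|->].
- rewrite ext_phiE // !(ext_T_lt _ ni ji) ext_phiE // !mulrA T_psi //; lia.
- have [->|ji1] := eqVneq j i.+1; last first.
    have ij1 : (i.+1 < j)%N by lia.
    by rewrite ext_phiE // !(ext_T_gt _ nj ij1) ext_phiE // !mulrA T_psi //; lia.
  rewrite ext_phiE // !(ext_T_succ _ ni) mulmxDr !ext_phiE // -psiE eta_left !(mulrA _ _ u).
  have -> // : psi i l a * tau i = tau i * psi i l a.
  rewrite /psi (negPf li); case: ltnP => h; apply: phi_tau_comm; lia.
by rewrite ext_phiE // !(ext_T_same _ ni) ext_phiE // psiE.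
Qed.

Lemma D_al a : GRing.comm (al a) D.
Proof.
by apply: commrD; [apply: commrM|apply: commrN]; apply/commr_sym.
Qed.

Lemma D_phi i a : (i <= n)%N -> GRing.comm (phi i a) D.
Proof.
move=> ni; apply: commrD; first by apply: commrM; apply/commr_sym; [apply: X_phi|apply: ev_phi].
by apply/commrN/commr_sym/(rep_xphi rep).
Qed.

Lemma D_T i : (0 < i < n)%N -> GRing.comm (T i) D.
Proof.
move=> ni; have /andP[_ n1] := ni; apply: commrD.
  by apply: commrM; apply/commr_sym; [apply: X_T|apply: ev_T].
by apply/commrN/commr_sym/(rep_xT rep).
Qed.

Lemma D_y : GRing.comm y D.
Proof.
apply: commrD; first by apply: commrM; apply/commr_sym.
exact/commrN/commr_refl.
Qed.

Lemma D_tau i : (i <= n)%N -> GRing.comm D (tau i).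
Proof.
move=> ni; apply: (tele_comm0 symA basis_b dual_bd) => a; apply/commr_sym; first exact: D_al.
exact: D_phi.
Qed.

Lemma y_tau i : (i <= n)%N -> GRing.comm y (tau i).
Proof.
move=> ni; apply: (tele_comm0 symA basis_b dual_bd) => a; first exact: al_y.
exact: (rep_xphi rep).
Qed.

Lemma cox_al j a : (j <= n)%N -> GRing.comm (al a) (cox j).
Proof.
elim: j => [|j IH] nj /=; first exact: commr1.
by apply: commrM; [apply/commr_sym/al_T|apply/IH/ltnW].
Qed.

Lemma cox_phi0 j a : (j <= n)%N -> cox j * phi 0 a = phi j a * cox j.
Proof.
elim: j => [|j IH] nj /=; first by rewrite mul1r mulr1.
by rewrite -mulrA (IH (ltnW nj)) !mulrA (rep_Tl rep).
Qed.

Lemma cox_phi_gt j l a : (j < l)%N -> (l <= n)%N -> GRing.comm (phi l a) (cox j).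
Proof.
elim: j => [|j IH] jl nl /=; first exact: commr1.
apply: commrM; last by apply: IH => //; apply: ltnW.
by apply/esym/(rep_Tphi rep) => //; lia.
Qed.

Lemma cox_phi j l a : (0 < l <= j)%N -> (j <= n)%N -> cox j * phi l a = phi l.-1 a * cox j.
Proof.
elim: j => [|j IH] lj nj /=; first by lia.
have [e|ne] := eqVneq l j.+1.
  by rewrite -mulrA -(cox_phi_gt a (j := j)) ?e // mulrA /= (rep_Tu rep) // mulrA.
rewrite -mulrA IH ?(ltnW nj) //; last by lia.
by rewrite mulrA (rep_Tphi rep) ?mulrA //; lia.
Qed.

Lemma cox_T_gt i j : (j < i)%N -> (i < n)%N -> GRing.comm (T i) (cox j).
Proof.
elim: j => [|j IH] ji ni /=; first exact: commr1.
apply: commrM; last by apply: IH => //; apply: ltnW.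
by apply: (TT_comm (rep_TT rep)); lia.
Qed.

Lemma cox_T i j : (0 < i < j)%N -> (j <= n)%N -> T i.-1 * cox j = cox j * T i.
Proof.
elim: j => [|j IH] ij nj /=; first by lia.
have [e|ne] := eqVneq i j.
  clear IH; subst j; case: i ij nj => // i ij nj /=.
  have c : GRing.comm (T i.+1) (cox i) by apply: cox_T_gt => //; lia.
  by rewrite !mulrA (rep_braid rep) -?mulrA ?c //; lia.
rewrite mulrA (TT_comm (rep_TT rep)); try lia.
by rewrite -mulrA IH ?mulrA //; lia.
Qed.

Lemma tauD_T i u : (0 < i < n)%N -> T i * (tau 0 * (D * u)) = tau 0 * (D * (T i * u)).
Proof.
move=> ni; have c : GRing.comm (T i) (tau 0 * D).
  by apply: commrM; [apply: tau_comm_T; lia|apply: D_T].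
by rewrite !mulrA -(mulrA (T i) (tau 0)) c.
Qed.

Lemma coxD_T_gt i j u : (j < i)%N -> (i < n)%N ->
  T i * (cox j * (tau 0 * (D * u))) = cox j * (tau 0 * (D * (T i * u))).
Proof.
by move=> ji ni; rewrite (mulrA (T i)) cox_T_gt // -mulrA tauD_T //; lia.
Qed.

Lemma coxD_T i j u : (0 < i < j)%N -> (j <= n)%N ->
  T i.-1 * (cox j * (tau 0 * (D * u))) = cox j * (tau 0 * (D * (T i * u))).
Proof.
by move=> ji nj; rewrite (mulrA (T i.-1)) cox_T // -mulrA tauD_T //; lia.
Qed.

(** The correction term goes from e_{j+1} to e_0, where the strands carry different labels. [tau 0]
    exchanges [al] with [phi 0], and [cox j] takes [phi 0] to [phi j] and lowers the indices 1, ...,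
    j by one, which is exactly the change of labels. *)
Lemma cox_psi j l a u : (j <= n)%N -> (l <= n.+1)%N ->
  psi 0 l a * (cox j * (tau 0 * (D * u))) = cox j * (tau 0 * (D * (psi j.+1 l a * u))).
Proof.
move=> nj nl; rewrite !mulrA; congr (_ * _).
have [->|l0] := eqVneq l 0%N.
  rewrite psi_same (psi_lt (ltn0Sn j)) (cox_al a nj) -!mulrA; congr (_ * _).
  by rewrite mulrA (al_tau a (leq0n n)) -mulrA (D_phi a (leq0n n)).
have l1 : (0 < l)%N by rewrite lt0n.
rewrite (psi_gt l1); have [->|lj] := eqVneq l j.+1.
  rewrite psi_same /= -(cox_phi0 a nj) -!mulrA; congr (_ * _).
  by rewrite mulrA (phi_tau a (leq0n n)) -mulrA D_al.
have [lj1|jl1] := ltnP l j.+1.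
  rewrite (psi_lt lj1) -cox_phi // ?l1 // -!mulrA; congr (_ * _).
  by rewrite mulrA phi_tau_comm -?mulrA ?D_phi //; lia.
have jl : (j.+1 < l)%N by lia.
rewrite (psi_gt jl) (cox_phi_gt a (j := j)) -?mulrA; try lia.
congr (_ * _).
by rewrite mulrA phi_tau_comm -?mulrA ?D_phi //; lia.
Qed.

Lemma ext_xphi l a : (l <= n.+1)%N -> ext_x * ext_phi l a = ext_phi l a * ext_x.
Proof.
move=> nl; apply: opmxP => j u nj; rewrite !ext_mulE ext_phiE //.
case: j nj => [|j] nj.
  rewrite !ext_x0 ext_phiE // !mulrA; congr (ec 0 (_ * _)).
  by rewrite /psi; case: eqP => [_|/eqP l0] /=; [apply: X_al|apply: X_phi; lia].
rewrite !ext_xS // mulmxDr !ext_phiE // (eta_left z (psi 0 l a)) cox_psi // !mulrA.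
congr (ec _ (_ * _) + _).
by rewrite /psi; case: eqP => _; [apply: al_y|case: ifP => h; apply: (rep_xphi rep); lia].
Qed.

Lemma ext_xT i : (0 < i < n.+1)%N -> ext_x * ext_T i = ext_T i * ext_x.
Proof.
move=> /andP[i0 ni]; apply: opmxP => j u nj; rewrite !ext_mulE.
have ni1 : (i.-1 < n)%N by lia.
case: j nj => [|j] nj.
  by rewrite ext_x0 !(ext_T_lt _ ni i0) ext_x0 !mulrA X_T.
case: (ltngtP j.+1 i) => [ji|ij|e].
- rewrite ext_xS // mulmxDr !(ext_T_lt _ ni ji) (ext_T_lt _ ni i0) ext_xS // eta_left.
  by rewrite coxD_T_gt ?(mulrA y) ?(rep_xT rep (i := i.-1)) -?mulrA //; lia.
(* The column e_{i+1} itself: T_i splits it into two terms, so a square of T_{i-1} and a product of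
   two teleporters appear. After the shift of [i], [E3] moves the second teleporter to the left
   through [cox]. *)
- have [e|ne] := eqVneq i j.
    subst j; case: i i0 ni ni1 nj ij => // i _ ni ni1 nj ij.
    have ri : (i < n)%N by lia.
    have ni' : (i <= n)%N by lia.
    rewrite (ext_T_succ _ ri) mulmxDr !ext_xS // mulmxDr (ext_T_succ _ ri) (ext_T_lt _ ri (ltn0Sn i)) /=.
    rewrite -!(mulrA (T i) (cox i)) (eta_left z (T i)) (quad_left _ ri) mulrDr ecolD.
    have E1 w : y * (eta z * (tau i.+1 * w)) = eta z * (tau i.+1 * (y * w)).
      by rewrite eta_left (mulrA y) y_tau // -mulrA.
    have E2 w : D * (eta z * (tau i.+1 * w)) = eta z * (tau i.+1 * (D * w)).
      by rewrite eta_left (mulrA D) D_tau // -mulrA.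
    rewrite E1 E2 (eta_left z (tau 0)) (eta_left z (cox i)) (eta_left z (T i)).
    have E3 w : T i * (cox i * (tau 0 * (tau i.+1 * w))) = t i * (T i * (cox i * (tau 0 * w))).
      rewrite (mulrA (tau 0)) (tau_tau (leq0n n) ri) // !mulrA; congr (_ * _ * _).
      rewrite -/(cox i.+1) (tele_conj b bd (g' := phi i.+1) (h' := phi i)) => [|a|a].
      + rewrite mulrA; congr (_ * _ * _).
        by apply: (tele_sym symA basis_b dual_bd etaC);
          [apply: (rep_alg rep)|apply: (rep_alg rep)|apply: (rep_sc rep); lia].
      + exact: cox_phi0.
      + by apply: cox_phi; rewrite ?leqnn.
    by rewrite E3 [X in _ = _ + X]addrC addrACA.
  have nj1 : (j.+1 <= n.+1)%N by lia.
  have ij1 : (i.+1 < j.+1)%N by lia.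
  rewrite ext_xS // mulmxDr !(ext_T_gt _ nj1 ij1) (ext_T_lt _ ni i0) ext_xS // eta_left.
  by rewrite coxD_T ?(mulrA y) ?(rep_xT rep (i := i)) -?mulrA //; lia.
rewrite -e in ni i0 ni1 *; have ri : (j < n)%N by [].
rewrite ext_xS // mulmxDr !(ext_T_same _ ri) (ext_T_lt _ ri i0).
by rewrite ext_xS // eta_left /= -mulrA.
Qed.

Lemma X_tau i : (i <= n)%N -> GRing.comm X (tau i).
Proof. by move=> ni; apply: (tele_comm0 symA basis_b dual_bd) => a; [apply: X_al|apply: X_phi]. Qed.

Lemma ev_tau i : (i <= n)%N -> GRing.comm ev (tau i).
Proof.
by move=> ni; apply: (tele_comm0 symA basis_b dual_bd) => a; [apply: ev_al|apply: ev_phi].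
Qed.

Lemma phi_tele_comm u i j : (i <= n)%N -> (j <= n)%N ->
  (forall l a, (l <= n)%N -> GRing.comm u (phi l a)) -> GRing.comm u (tele b bd (phi i) (phi j)).
Proof. by move=> ni nj H; apply: (tele_comm0 symA basis_b dual_bd) => a; apply: H. Qed.

Lemma D_plus_y : D + y = X * ev. Proof. by rewrite subrK. Qed.

(** Behind [tau 0], evaluation satisfies (X p)(y) = y p(y). Hence D (X p(y)) = X y p(y) - y X p(y) =
    0. *)
Lemma tau_DX : tau 0 * D * X * ev = 0.
Proof.
rewrite mulrBr !mulrBl.
have -> : tau 0 * (X * ev) * X * ev = X * (tau 0 * ev * X) * ev.
  by rewrite !mulrA X_tau.
rewrite ev_X -!mulrA ev_ev !mulrA X_tau // -(mulrA (tau 0) X y) X_y !mulrA.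
exact: subrr.
Qed.

Lemma tau_DyX : tau 0 * (D + y) * X = y * tau 0 * (D + y).
Proof.
rewrite D_plus_y; transitivity (X * (tau 0 * ev * X)); first by rewrite !mulrA X_tau.
rewrite ev_X !mulrA X_tau // y_tau // -(mulrA (tau 0) X y) X_y mulrA.
by [].
Qed.

Lemma tau_DtauDy : tau 0 * D * tau 0 * (D + y) = 0.
Proof.
by rewrite D_plus_y -(mulrA (tau 0) D) D_tau // -!mulrA (mulrA D) (mulrA (tau 0) (D * X)) (mulrA (tau 0) D) tau_DX mulr0.
Qed.

Lemma ext_xTx_ec0 u :
  ext_x *m (ext_T 0 *m (ext_x *m (ext_T 0 *m ec 0 u))) =
  ext_T 0 *m (ext_x *m (ext_T 0 *m (ext_x *m ec 0 u))).
Proof.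
have E0 := ext_T_same _ (leq0n n); have E1 := ext_T_succ _ (leq0n n).
have X1 w : ext_x *m ec 1 w = ec 1 (y * w) + ec 0 (eta z * (tau 0 * (D * w))).
  by rewrite ext_xS //= mul1r.
rewrite !(E0, ext_x0, X1, mulmxDr, E1).
have A1 : y * (eta z * (tau 0 * (y * u))) + y * (eta z * (tau 0 * (D * u))) =
    eta z * (tau 0 * (y * (X * u))) + eta z * (tau 0 * (D * (X * u))).
  rewrite !(eta_left z y) -!mulrDr -!mulrDl [y + D]addrC; congr (_ * _).
  by rewrite !mulrA tau_DyX.
have A0 : eta z * (tau 0 * (D * (eta z * (tau 0 * (y * u))))) +
    eta z * (tau 0 * (D * (eta z * (tau 0 * (D * u))))) = 0.
  rewrite -!mulrDr -!mulrDl [y + D]addrC (eta_left z D) (eta_left z (tau 0)).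
  have -> : tau 0 * (D * (tau 0 * ((D + y) * u))) = 0 by rewrite !mulrA tau_DtauDy mul0r.
  by rewrite !mulr0.
rewrite -[LHS]addrA [X in _ + X = _]addrACA -!ecolD A0 A1 ecol0 addr0 ecolD -[RHS]addrA.
by rewrite (mulrA X) X_y -mulrA.
Qed.

Lemma ext_etaC c (v : M) : ext_eta c * v = v * ext_eta c.
Proof.
apply/matrixP => i j; rewrite [LHS]mul_scal_mxE [RHS]mul_mx_scalE.
exact: etaC.
Qed.

Lemma ext_tele_sym i j : (i <= n.+1)%N -> (j <= n.+1)%N -> i != j ->
  tele b bd (ext_phi j) (ext_phi i) = tele b bd (ext_phi i) (ext_phi j).
Proof.
move=> ni nj ij; apply: (tele_sym symA basis_b dual_bd ext_etaC).
- exact: ext_phi_alg.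
- exact: ext_phi_alg.
- exact: ext_sc.
Qed.

Lemma ext_T0_tele : GRing.comm (ext_T 0) (tele b bd (ext_phi 0) (ext_phi 1)).
Proof.
rewrite /GRing.comm -[in RHS](ext_tele_sym (i := 0) (j := 1)) //.
by apply: tele_conj => a; [apply: ext_Tl|apply: ext_Tu].
Qed.

Lemma ext_x_tele i j : (i <= n.+1)%N -> (j <= n.+1)%N ->
  GRing.comm ext_x (tele b bd (ext_phi i) (ext_phi j)).
Proof.
by move=> ni nj; apply: (tele_comm0 symA basis_b dual_bd) => a; apply: ext_xphi.
Qed.

(** As e_1 = T_0 e_0, the quadratic relation reduces this to the column e_0: the coefficient z
    t_{0,1} commutes with both x and T_0. *)
Lemma ext_xTx_ec1 u :
  ext_x *m (ext_T 0 *m (ext_x *m (ext_T 0 *m ec 1 u))) =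
  ext_T 0 *m (ext_x *m (ext_T 0 *m (ext_x *m ec 1 u))).
Proof.
rewrite -(ext_T_same u (leq0n n)); set v := ec 0 u.
have Q : ext_x *m (ext_T 0 *m (ext_x *m (ext_T 0 *m v))) =
  ext_T 0 *m (ext_x *m (ext_T 0 *m (ext_x *m v))) by apply: ext_xTx_ec0.
set e := ext_eta z * tele b bd (ext_phi 0) (ext_phi 1).
have q (w : 'cV[R]_n.+2) : ext_T 0 *m (ext_T 0 *m w) = e *m (ext_T 0 *m w) + w.
  by rewrite -!ext_mulE ext_quad // mulrA ext_mulE mulmxDl mul1mx !ext_mulE.
have ex (w : 'cV[R]_n.+2) : ext_x *m (e *m w) = e *m (ext_x *m w).
  rewrite -!ext_mulE; congr (_ *m _); apply: commrM; first exact/esym/ext_etaC.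
  exact: ext_x_tele.
have eT (w : 'cV[R]_n.+2) : ext_T 0 *m (e *m w) = e *m (ext_T 0 *m w).
  rewrite -!ext_mulE; congr (_ *m _); apply: commrM; first exact/esym/ext_etaC.
  exact: ext_T0_tele.
by rewrite q !(mulmxDr, ex, eT) Q q.
Qed.

Section Rank2.
Hypothesis n0 : (0 < n)%N.

Lemma tau1_t0 : tau 1 * t 0 = t 0 * tau 0.
Proof.
have sc : supercomm (phi 0) (phi 1) by apply: (rep_sc rep).
rewrite -(tele_sym symA basis_b dual_bd etaC (rep_alg rep (leq0n n)) (rep_alg rep n0) sc).
by rewrite (tau_t n0 (leq0n n)) // (tau_tau (leq0n n) n0) // (tele_sym symA basis_b dual_bd etaC
  (rep_alg rep (leq0n n)) (rep_alg rep n0) sc).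
Qed.

Lemma tau0_tau1 : tau 0 * tau 1 = tau 1 * t 0.
Proof. by rewrite tau1_t0 (tau_tau (leq0n n) n0). Qed.

Lemma tau1_DTD : tau 1 * t 0 * X * ev * T 0 * X * ev = tau 1 * t 0 * X * y * T 0 * ev.
Proof.
have XT := X_T n0; have Xt := X_tau (leq0n n).
have eTe w : w * ev * T 0 * ev = w * T 0 * ev by rewrite -!mulrA (mulrA ev) ev_T0_ev.
by rewrite tau1_t0 -(word2 XT) -(word2 Xt) (word3 ev_X) eTe.
Qed.

(** Substituting D = X ev - y separates an X-part, given by [ev_T0], from a y-part, which is the
    relation [rep_xTx]. The factor [tau 1] is what converts ev X into y ev in the remaining term. *)
Lemma tau1_comm : tau 1 * (y * T 0 * D * T 0) =
  tau 1 * (T 0 * D * T 0 * y) + eta z * (tau 1 * t 0 * X * ev * T 0 * D).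
Proof.
have XT := X_T n0; have Xy := X_y; have yTyT := rep_xTx rep n0.
have e1 : y * T 0 * D * T 0 = X * (y * T 0 * ev * T 0) - y * T 0 * y * T 0.
  by rewrite mulrBr mulrBl; congr (_ - _); rewrite !mulrA -(word2 XT) -Xy.
have e2 : T 0 * D * T 0 * y = X * (T 0 * ev * T 0 * y) - T 0 * y * T 0 * y.
  by rewrite mulrBr !mulrBl; congr (_ - _); rewrite !mulrA XT.
have e3 : y * T 0 * ev * T 0 =
    T 0 * ev * T 0 * y + eta z * t 0 * (y * T 0 * ev - ev * T 0 * y).
  by rewrite -ev_T0 // addrC subrK.
have e4 : tau 1 * t 0 * X * ev * T 0 * D =
    tau 1 * t 0 * X * (y * T 0 * ev - ev * T 0 * y).
  by rewrite !mulrBr; congr (_ - _); rewrite !mulrA ?tau1_DTD.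
rewrite e1 e2 e3 yTyT (mulrDr X) addrAC (mulrDr (tau 1)) e4; congr (_ + _).
rewrite (mulrA X) (mulrA X) -etaC -!mulrA eta_left; congr (_ * _).
have Xt : GRing.comm X (t 0) by apply: phi_tele_comm => // l a; apply: X_phi.
by rewrite !mulrA -(mulrA (tau 1) X) Xt !mulrA.
Qed.

(** Obtained from [tau1_comm] by multiplying by T_0 on the right and replacing the square of T_0. *)
Lemma tau1_comm' : tau 1 * (y * T 0 * D) =
  tau 1 * (T 0 * D * T 0 * y * T 0) + eta z * (tau 1 * t 0 * D * T 0 * D * T 0).
Proof.
have e := congr1 (fun w => w * T 0) tau1_comm.
have Dt : GRing.comm D (t 0).
  by apply: phi_tele_comm => // l a ln; apply/commr_sym/D_phi.
have yt : GRing.comm y (t 0).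
  by apply: phi_tele_comm => // l a ln; apply: (rep_xphi rep).
have Tt : T 0 * t 0 = t 0 * T 0 by apply: (rep_T_t symA basis_b dual_bd rep).
have q : y * T 0 * D * T 0 * T 0 = y * T 0 * D + eta z * (t 0 * (y * T 0 * D * T 0)).
  rewrite -(mulrA (y * T 0 * D)) (rep_quad rep n0) (mulrDr (y * T 0 * D)) mulr1 addrC.
  rewrite eta_left; congr (_ + _ * _).
  have c : GRing.comm (t 0) (y * T 0 * D).
    by apply: commrM; [apply: commrM|]; apply/commr_sym.
  by rewrite mulrA -c !mulrA.
rewrite /= mulrDl -(mulrA (tau 1)) q (mulrDr (tau 1)) -(mulrA (tau 1)) in e.
have e5 : tau 1 * t 0 * D * T 0 * D * T 0 =
    tau 1 * t 0 * X * ev * T 0 * D * T 0 - tau 1 * (t 0 * (y * T 0 * D * T 0)).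
  have e6 : tau 1 * t 0 * D = tau 1 * t 0 * X * ev - tau 1 * t 0 * y by rewrite mulrBr !mulrA.
  transitivity (tau 1 * t 0 * D * (T 0 * D * T 0)); first by rewrite !mulrA.
  by rewrite e6 (mulrBl (T 0 * D * T 0)) !mulrA.
move: e; rewrite eta_left => /(canRL (addrK _)) ->.
by rewrite e5 (mulrBr (eta z)) addrA !mulrA.
Qed.

Lemma tau0_comm : y * T 0 * tau 0 * D * T 0 =
  T 0 * tau 0 * D * T 0 * y + eta z * (tau 0 * (D + y) * T 0 * tau 0 * D).
Proof.
have Tt := T_taul n0; have yt := y_tau n0; have Xt := X_tau n0; have et := ev_tau n0.
rewrite D_plus_y Tt (word2 Tt) yt.
have -> : tau 0 * (X * ev) * T 0 * tau 0 * D = tau 1 * t 0 * X * ev * T 0 * D.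
  by rewrite !mulrA (word2 Tt) (word2 et) (word2 Xt) tau0_tau1.
by have := tau1_comm; rewrite !mulrA.
Qed.

Lemma tau0_comm' : y * T 0 * tau 0 * D =
  T 0 * tau 0 * D * T 0 * y * T 0 + eta z * (tau 0 * D * T 0 * tau 0 * D * T 0).
Proof.
have Tt := T_taul n0; have yt := y_tau n0; have Dt := D_tau n0.
rewrite Tt (word2 Tt) yt.
have -> : tau 0 * D * T 0 * tau 0 * D * T 0 = tau 1 * t 0 * D * T 0 * D * T 0.
  by rewrite (word2 Tt) (word2 Dt) tau0_tau1.
by have := tau1_comm'; rewrite !mulrA.
Qed.

(** Comparing coefficients, e_2 requires [rep_xTx] in H, e_1 requires [tau0_comm] and e_0 requires
    [tau0_comm']. *)
Lemma ext_xTx_ec2 u :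
  ext_x *m (ext_T 0 *m (ext_x *m (ext_T 0 *m ec 2 u))) =
  ext_T 0 *m (ext_x *m (ext_T 0 *m (ext_x *m ec 2 u))).
Proof.
have E0 := ext_T_same _ (leq0n n); have E1 := ext_T_succ _ (leq0n n).
have n2 : (2 <= n.+1)%N by [].
have E2 := ext_T_gt _ n2 (ltnSn 1).
have X1 w : ext_x *m ec 1 w = ec 1 (y * w) + ec 0 (eta z * (tau 0 * (D * w))).
  by rewrite ext_xS //= mul1r.
have X2 w : ext_x *m ec 2 w = ec 2 (y * w) + ec 0 (eta z * (T 0 * (tau 0 * (D * w)))).
  by rewrite ext_xS //= mulr1.
rewrite !(E0, ext_x0, X1, X2, mulmxDr, E1, E2).
have B1 : y * (eta z * (T 0 * (tau 0 * (D * (T 0 * u))))) =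
    eta z * (T 0 * (tau 0 * (D * (T 0 * (y * u))))) +
    (eta z * (tau 0 * (y * (eta z * (T 0 * (tau 0 * (D * u)))))) +
     eta z * (tau 0 * (D * (eta z * (T 0 * (tau 0 * (D * u))))))).
  have /(congr1 (fun w => eta z * (w * u))) := tau0_comm.
  rewrite (eta_left z y) (eta_left z D) (eta_left z y) !(eta_left z (tau 0)).
  rewrite -!(mulrDr (eta z)) -(mulrDr (tau 0)) -mulrDl [y + D]addrC.
  by rewrite (mulrDl _ _ u) -!mulrA.
have B0 : y * (eta z * (T 0 * (tau 0 * (D * u)))) =
    eta z * (T 0 * (tau 0 * (D * (T 0 * (y * (T 0 * u)))))) +
    eta z * (tau 0 * (D * (eta z * (T 0 * (tau 0 * (D * (T 0 * u))))))).
  have /(congr1 (fun w => eta z * (w * u))) := tau0_comm'.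
  rewrite (eta_left z y) (eta_left z D) (eta_left z (tau 0)).
  by rewrite -!(mulrDr (eta z)) (mulrDl _ _ u) -!mulrA.
have B0' := congr1 (ec 0) B0; rewrite ecolD in B0'; rewrite B1 B0' !ecolD.
have -> : y * (T 0 * (y * (T 0 * u))) = T 0 * (y * (T 0 * (y * u))).
  by have := congr1 (fun w => w * u) (rep_xTx rep n0); rewrite -!mulrA.
rewrite -!addrA; congr (_ + _); rewrite [LHS]addrCA; congr (_ + (_ + _)).
by rewrite addrA addrC.
Qed.

End Rank2.

Lemma ext_xTx : ext_x * ext_T 0 * ext_x * ext_T 0 = ext_T 0 * ext_x * ext_T 0 * ext_x.
Proof.
apply: opmxP => j u nj; rewrite !ext_mulE.
case: j nj => [|[|j]] nj; [exact: ext_xTx_ec0|exact: ext_xTx_ec1|].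
(* From e_2 on, e_{j+3} = T_{j+2} e_{j+2}, and T_{j+2} commutes with both x and T_0. *)
elim: j u nj => [|j IH] u nj; first exact: ext_xTx_ec2.
have nj2 : (j.+2 <= n)%N by lia.
rewrite -(ext_T_same u nj2).
have xT (w : 'cV[R]_n.+2) : ext_x *m (ext_T j.+2 *m w) = ext_T j.+2 *m (ext_x *m w).
  by rewrite -!ext_mulE ext_xT //; lia.
have TT (w : 'cV[R]_n.+2) : ext_T 0 *m (ext_T j.+2 *m w) = ext_T j.+2 *m (ext_T 0 *m w).
  by rewrite -!ext_mulE ext_TT //; lia.
by rewrite !(xT, TT) IH //; lia.
Qed.

(** The divided difference (X^r - y^r) / (X - y). *)
Fixpoint geom r : R := if r is s.+1 then X * geom s + y ^+ s else 0.

Lemma geomE r : geom r * (X - y) = X ^+ r - y ^+ r.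
Proof.
elim: r => [|r IH] /=; first by rewrite mul0r subrr.
have c : y ^+ r * X = X * y ^+ r by apply/esym/commrX/X_y.
rewrite mulrDl -mulrA IH !mulrBr -exprS -exprSr c.
by rewrite addrA addrNK.
Qed.

(** D is divisible by X - y, which cancels the denominator of [geom] when f is evaluated at x on the
    column e_1. *)
Lemma D_factor : D = (X - y) * (1 - X * G).
Proof.
rewrite /D {1}ev_G !mulrBr !mulr1 addrAC; congr (_ - _); rewrite !mulrA; congr (_ * _).
by rewrite mulrBr mulrBl X_y.
Qed.

Lemma ext_xX_ec0 r u : ext_x ^+ r *m ec 0 u = ec 0 (X ^+ r * u).
Proof.
elim: r => [|r IH]; first by rewrite op1_ecol mul1r.
by rewrite exprS ext_mulE IH ext_x0 mulrA -exprS.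
Qed.

Lemma ext_xX_ec1 r u :
  ext_x ^+ r *m ec 1 u = ec 1 (y ^+ r * u) + ec 0 (eta z * (tau 0 * (geom r * (D * u)))).
Proof.
elim: r => [|r IH]; first by rewrite op1_ecol mul1r /= !(mul0r, mulr0) ecol0 addr0.
rewrite exprS ext_mulE IH mulmxDr ext_x0 ext_xS //= mul1r (mulrA y) -exprS -addrA -ecolD.
congr (_ + ec 0 _); rewrite (eta_left z X) -mulrDr; congr (_ * _).
rewrite (mulrA X) X_tau // -mulrA -mulrDr; congr (_ * _).
have c : y ^+ r * D = D * y ^+ r by apply/esym/commrX/commr_sym/D_y.
by rewrite (mulrDl _ _ (D * u)) (mulrA (y ^+ r)) c -!mulrA addrC.
Qed.

Lemma tau_center r : al (f r) * tau 0 = tau 0 * al (f r).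
Proof.
have p0 := rep_alg rep (leq0n n); have sc := al_phi (leq0n n).
have e := super_center_tele symA basis_b dual_bd alP p0 sc (f_center r).
by rewrite -(phi_tau _ (leq0n n)) e -al_tau.
Qed.

(** The bracket is (f(X) - f(y)) / (X - y) with coefficients in [al]. The factor X - y of D leaves
    f(X) - f(y); here f(X) = 0, and behind [tau 0] the central coefficients move from [al] to
    [phi 0], where f(y) = 0. *)
Lemma tau_geom : tau 0 * ((geom d + \sum_(r < d) al (f r) * geom r) * D) = 0.
Proof.
have SE : (geom d + \sum_(r < d) al (f r) * geom r) * (X - y) =
    - (y ^+ d + \sum_(r < d) al (f r) * y ^+ r).
  rewrite mulrDl mulr_suml geomE; under eq_bigr do rewrite -mulrA geomE mulrBr.
  by rewrite sumrB addrACA X_f add0r opprD.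
have tauE : tau 0 * (y ^+ d + \sum_(r < d) al (f r) * y ^+ r) = 0.
  transitivity (tau 0 * (y ^+ d + \sum_(r < d) phi 0 (f r) * y ^+ r)).
    rewrite [LHS]mulrDr [RHS]mulrDr; congr (_ + _).
    rewrite [LHS]mulr_sumr [RHS]mulr_sumr; apply: eq_bigr => r _.
    by rewrite (mulrA (tau 0)) -tau_center al_tau // -mulrA.
  by rewrite (rep_f rep) mulr0.
by rewrite D_factor (mulrA _ (X - y)) SE mulNr mulrN (mulrA (tau 0)) tauE mul0r oppr0.
Qed.

Lemma ext_f : ext_x ^+ d + \sum_(r < d) ext_phi 0 (f r) * ext_x ^+ r = 0.
Proof.
apply: opmxP => j u nj; rewrite mul0mx mulmxDl mulmx_suml.
case: j nj => [|j] nj.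
  rewrite ext_xX_ec0; under eq_bigr do rewrite ext_mulE ext_xX_ec0 ext_phiE // psi_same.
  rewrite -ecol_sum -ecolD; under eq_bigr do rewrite mulrA.
  by rewrite -mulr_suml -mulrDl X_f mul0r ecol0.
elim: j u nj => [|j IH] u nj.
  rewrite ext_xX_ec1.
  under eq_bigr do rewrite ext_mulE ext_xX_ec1 mulmxDr !ext_phiE // psi_same (psi_lt (ltnSn 0)).
  rewrite big_split -!ecol_sum addrACA -!ecolD.
  rewrite [X in ec 1 X](_ : _ = 0); last first.
    under eq_bigr do rewrite mulrA; by rewrite -mulr_suml -mulrDl (rep_f rep) mul0r.
  rewrite ecol0 add0r [X in ec 0 X](_ : _ = 0) ?ecol0 //.
  under eq_bigr do rewrite eta_left (mulrA (al _)) tau_center -mulrA.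
  rewrite -!mulr_sumr -mulrDr -mulrDr; under eq_bigr do rewrite (mulrA (al _)).
  by rewrite -mulr_suml -mulrDl (mulrA _ D u) (mulrA (tau 0)) tau_geom mul0r mulr0.
have nj1 : (j.+1 <= n)%N by lia.
(* Further columns are reached by applying T_{j+1}, which commutes with x and with the strand 0 and
   hence with f(x). *)
rewrite -(ext_T_same u nj1) -mulmx_suml -mulmxDl.
have c : GRing.comm (ext_T j.+1) (ext_x ^+ d + \sum_(r < d) ext_phi 0 (f r) * ext_x ^+ r).
  have cx r : GRing.comm (ext_T j.+1) (ext_x ^+ r) by apply/commrX/esym/ext_xT; lia.
  apply: commrD => //; apply: commr_sum => r _; apply: commrM => //.
  by apply: ext_Tphi => //; lia.
rewrite mulmxA -[_ *m ext_T j.+1]/(_ * ext_T j.+1) -c ext_mulE mulmxDl mulmx_suml IH ?mulmx0 //.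
by lia.
Qed.

Lemma ext_rep : wreath_rep b bd z f ext_eta n.+1 ext_phi ext_T ext_x.
Proof.
split.
- exact: ext_etaC.
- exact: ext_phi_alg.
- exact: ext_sc.
- exact: ext_TT.
- exact: ext_braid.
- exact: ext_quad.
- exact: ext_Tl.
- exact: ext_Tu.
- exact: ext_Tphi.
- exact: ext_xT.
- by move=> _; apply: ext_xTx.
- by move=> i a; apply: ext_xphi.
- exact: ext_f.
Qed.

End ExtensionRep.

(** * Polynomials modulo f as operators *)

Section TruncatedPolynomials.
Variables (k : comNzRingType) (A : superalgType k).
Variables (tr : {scalar A}) (symA : symmetric_superalgebra tr).
Variables (B : finType) (b bd : B -> A) (basis_b : homogeneous_basis b).
Hypothesis dual_bd : forall i j, tr (bd i * b j) = (i == j)%:R.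
Variables (z : k) (d : nat) (f : 'I_d -> A).
Hypothesis f_center : forall i, super_center false (f i).
Variables (R : pzRingType) (eta : {rmorphism k -> R}) (n : nat).
Variables (phi : nat -> A -> R) (T : nat -> R) (y : R).
Hypothesis rep : wreath_rep b bd z f eta n phi T y.
Variables (al : A -> R).
Hypothesis alP : alg_map eta al.
Hypothesis al_phi : forall i, (i <= n)%N -> supercomm al (phi i).
Hypothesis al_T : forall i a, (i < n)%N -> GRing.comm (T i) (al a).
Hypothesis al_y : forall a, GRing.comm y (al a).

Local Notation L := (scal_mx d : R -> 'M[R]_d).
Local Notation ec := (@ecol R d).
Local Notation t i := (tele b bd (phi i) (phi i.+1)).
Local Notation tau i := (tele b bd al (phi i)).

(* Polynomials in X modulo f over [R], the column j holding the coefficient of X^j: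
   [evalX] is the substitution X := y, and [dividedX] is P |-> (P(X) - P(y)) / (X - y). *)
Definition shiftX : 'M[R]_d := opmx d (fun j =>
  if (j.+1 < d)%N then [:: (j.+1, 1)] else [seq (nat_of_ord i, - al (f i)) | i <- enum 'I_d]).
Definition evalX : 'M[R]_d := opmx d (fun j => [:: (0%N, y ^+ j)]).
Definition dividedX : 'M[R]_d := opmx d (fun j => [seq (i, y ^+ (j.-1 - i)) | i <- iota 0 j]).
Definition proj0 : 'M[R]_d := opmx d (fun j => if j is 0 then [:: (0%N, 1)] else [::]).

Lemma shiftX_lt j u : (j.+1 < d)%N -> shiftX *m ec j u = ec j.+1 u.
Proof. by move=> jd; rewrite (opmxE _ _ (ltnW jd)) jd big_seq1 mul1r. Qed.

Lemma shiftX_last j u : j.+1 = d -> shiftX *m ec j u = - \sum_(i < d) ec i (al (f i) * u).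
Proof.
move=> jd; have jd' : (j < d)%N by rewrite -jd.
rewrite (opmxE _ _ jd') jd ltnn big_map big_enum -sumrN.
by apply: eq_bigr => i _; rewrite mulNr ecolN.
Qed.

Lemma evalX_ec j u : (j < d)%N -> evalX *m ec j u = ec 0 (y ^+ j * u).
Proof. by move=> jd; rewrite opmxE // big_seq1. Qed.

Lemma dividedX_ec j u : (j < d)%N ->
  dividedX *m ec j u = \sum_(0 <= i < j) ec i (y ^+ (j.-1 - i) * u).
Proof. by move=> jd; rewrite opmxE // big_map /index_iota subn0. Qed.

Lemma proj0_0 u : (0 < d)%N -> proj0 *m ec 0 u = ec 0 u.
Proof. by move=> d0; rewrite opmxE // big_seq1 mul1r. Qed.

Lemma proj0_S j u : (j.+1 < d)%N -> proj0 *m ec j.+1 u = 0.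
Proof. by move=> jd; rewrite opmxE // big_nil. Qed.

Lemma L_ec u j v : L u *m ec j v = ec j (u * v).
Proof. exact: scal_ecol. Qed.

Lemma opM (F F' : 'M[R]_d) (v : 'cV[R]_d) : (F * F') *m v = F *m (F' *m v).
Proof. by rewrite mulmxA. Qed.

Lemma al_f_al r a : GRing.comm (al (f r)) (al a).
Proof.
rewrite /GRing.comm -(part_sum a) (alg_mapD alP) mulrDl mulrDr -!(alg_mapM alP).
by rewrite !((f_center r).2 _ _ (part_homog _ _)) !expr0 !mul1r.
Qed.

Lemma al_f_phi r i a : (i <= n)%N -> GRing.comm (al (f r)) (phi i a).
Proof.
move=> ni; rewrite /GRing.comm (alg_map_part (rep_alg rep ni)) mulrDl mulrDr.
by rewrite !(al_phi ni (f_center r).1 (part_homog _ _)) !expr0 !mul1r.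
Qed.

Lemma shiftX_comm u : (forall r, GRing.comm u (al (f r))) -> GRing.comm shiftX (L u).
Proof.
move=> uf; apply: opmxP => j v jd; rewrite !opM L_ec.
have [j1|j1] := ltnP j.+1 d; first by rewrite !shiftX_lt // L_ec.
have e : j.+1 = d by apply/eqP; rewrite eqn_leq jd.
rewrite !(shiftX_last _ e) mulmxN mulmx_sumr; congr (- _); apply: eq_bigr => r _.
by rewrite L_ec !mulrA uf.
Qed.

Lemma evalX_comm u : GRing.comm u y -> GRing.comm evalX (L u).
Proof.
move=> uy; apply: opmxP => j v jd; rewrite !opM L_ec !evalX_ec // L_ec !mulrA.
by congr (ec 0 (_ * _)); apply/esym/commrX.
Qed.

Lemma proj0_comm u : GRing.comm proj0 (L u).
Proof.
apply: opmxP => j v jd; rewrite !opM L_ec; case: j jd => [|j] jd.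
  by rewrite !proj0_0 // L_ec.
by rewrite !proj0_S // mulmx0.
Qed.

Lemma evalX_L_evalX u : evalX * L u * evalX = L u * evalX.
Proof.
apply: opmxP => j v jd; rewrite !opM evalX_ec // !L_ec evalX_ec ?mul1r //.
exact: leq_ltn_trans jd.
Qed.

Lemma evalX_proj0 : evalX * proj0 = proj0.
Proof.
apply: opmxP => j v jd; rewrite !opM; case: j jd => [|j] jd.
  by rewrite !proj0_0 // evalX_ec // mul1r.
by rewrite !proj0_S // mulmx0.
Qed.

Lemma evalX_divided : evalX = 1 - (shiftX - L y) * dividedX.
Proof.
apply: opmxP => j u jd; rewrite mulmxBl op1_ecol opM dividedX_ec // evalX_ec //.
pose F i := ec i (y ^+ (j - i) * u).
rewrite mulmx_sumr (eq_big_nat _ _ (F2 := fun i => F i.+1 - F i)) => [|i /andP[_ ij]].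
  by rewrite telescope_sumr // /F subn0 subnn expr0 mul1r opprB addrC subrK.
rewrite mulmxBl L_ec shiftX_lt; last by lia.
rewrite mulrA -exprS /F; congr (ec _ (y ^+ _ * u) - ec _ (y ^+ _ * u)); lia.
Qed.

Lemma tele_L g h : tele b bd (L \o g) (L \o h) = L (tele b bd g h).
Proof. by rewrite /tele rmorph_sum; apply: eq_bigr => i _; rewrite rmorphM. Qed.

Lemma tau_al_f r : tau 0 * al (f r) = tau 0 * phi 0 (f r).
Proof.
have p0 := rep_alg rep (leq0n n); have sc := al_phi (leq0n n).
rewrite -(teleMr symA basis_b dual_bd (rep_eta rep) _ alP p0 sc).
exact: (super_center_tele symA basis_b dual_bd alP p0 sc (f_center r)).
Qed.

(** Substitution is compatible with the reduction of X^d only behind [tau 0]: [shiftX] reduces with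
    coefficients in [al], whereas y satisfies f with coefficients in [phi 0], and the teleporter
    identifies the two. *)
Lemma tau_evalX : L (tau 0) * evalX * shiftX = L (tau 0) * L y * evalX.
Proof.
apply: opmxP => j u jd; rewrite !opM (evalX_ec _ jd) !L_ec.
have [j1|j1] := ltnP j.+1 d.
  by rewrite shiftX_lt // evalX_ec // L_ec exprS -!mulrA.
have e : j.+1 = d by apply/eqP; rewrite eqn_leq jd.
rewrite (shiftX_last _ e) mulmxN mulmx_sumr.
under eq_bigr do rewrite evalX_ec //.
rewrite -ecol_sum -ecolN L_ec; congr (ec 0 _); rewrite (mulrA y) -exprS e.
have /eqP := rep_f rep; rewrite addr_eq0 => /eqP ->.
have -> : - (\sum_(r < d) phi 0 (f r) * y ^+ r) * u = - \sum_(r < d) phi 0 (f r) * y ^+ r * u.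
  by rewrite mulNr mulr_suml.
rewrite !mulrN; congr (- _); rewrite [LHS]mulr_sumr [RHS]mulr_sumr.
apply: eq_bigr => r _.
have c : y ^+ r * al (f r) = al (f r) * y ^+ r by apply/esym/commrX/commr_sym/al_y.
by rewrite (mulrA (y ^+ r)) c !mulrA tau_al_f.
Qed.

(** Induction on r. The element W = T_0 y T_0 plays the part of X_1 in H: it commutes with y and
    with e = z t_{0,1}. [W0] expresses T_0 y^(s+1) T_0 through T_0 y^s T_0, and [WT] evaluates W on
    the commutator of T_0 with y^s. *)
Lemma y_T0_comm r : (0 < n)%N ->
  y * T 0 * y ^+ r * T 0 - T 0 * y ^+ r * T 0 * y =
  eta z * t 0 * (y * T 0 * y ^+ r - y ^+ r * T 0 * y).
Proof.
move=> n0; have q := rep_quad rep n0.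
(* Introduced as opaque names so that reassociation does not open them up. *)
have [e eE] : exists e, e = eta z * t 0 by exists (eta z * t 0).
have [W WE] : exists W, W = T 0 * y * T 0 by exists (T 0 * y * T 0).
have Wy : GRing.comm W y by rewrite /GRing.comm WE !mulrA (rep_xTx rep n0).
have Wyr s : W * y ^+ s = y ^+ s * W by apply: commrX.
have TT : T 0 * T 0 = e * T 0 + 1 by rewrite q mulrA -eE.
have et : GRing.comm (T 0) (t 0) by apply: (rep_T_t symA basis_b dual_bd rep).
have yt : GRing.comm y (t 0).
  by apply: (tele_comm0 symA basis_b dual_bd) => a; apply: (rep_xphi rep).
have eT : GRing.comm (T 0) e by rewrite eE; apply: commrM => //; apply/esym/(rep_eta rep).
have ey : GRing.comm y e by rewrite eE; apply: commrM => //; apply/esym/(rep_eta rep).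
have eW : GRing.comm e W.
  by rewrite WE; apply: commrM; [apply: commrM|]; apply/commr_sym.
have WT s : W * (T 0 * y ^+ s - y ^+ s * T 0) = T 0 * y ^+ s.+1 - y ^+ s * T 0 * y.
  have -> : W * (T 0 * y ^+ s - y ^+ s * T 0) =
      T 0 * y * (T 0 * T 0) * y ^+ s - y ^+ s * (T 0 * y * (T 0 * T 0)).
    rewrite mulrBr; congr (_ - _); first by rewrite WE !mulrA.
    by rewrite mulrA (commrX s Wy) WE !mulrA.
  have U0 : T 0 * y * (e * T 0) * y ^+ s = y ^+ s * (T 0 * y * (e * T 0)).
    have -> : T 0 * y * (e * T 0) = e * W.
      by rewrite -(mulrA (T 0)) (mulrA y) ey !mulrA eT WE !mulrA.
    rewrite -mulrA Wyr (mulrA e) (commrX s (commr_sym ey)).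
    by rewrite mulrA.
  rewrite TT (mulrDr (T 0 * y)) !mulr1 (mulrDr (y ^+ s)) mulrDl U0 opprD addrACA subrr.
  by rewrite add0r exprS !mulrA.
have W0 s : T 0 * y ^+ s.+1 * T 0 = W * (T 0 * y ^+ s * T 0) - e * (W * (y ^+ s * T 0)).
  have -> : W * (T 0 * y ^+ s * T 0) = T 0 * y * (T 0 * T 0) * y ^+ s * T 0.
    by rewrite WE !mulrA.
  rewrite TT mulrDr mulr1 !mulrDl exprS.
  have -> : T 0 * y * (e * T 0) = e * W.
    by rewrite -(mulrA (T 0)) (mulrA y) ey !mulrA eT WE !mulrA.
  by rewrite !mulrA [X in _ = X - _]addrC addrK.
rewrite -eE; elim: r => [|r IH].
  by rewrite expr0 !mulr1 mul1r -mulrA TT mulrDr mulrDl !mulr1 mul1r opprD addrACA subrr addr0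
    (mulrA y) ey mulrBr !mulrA.
set P := T 0 * y ^+ r * T 0 in W0.
have IH' : y * P - P * y = e * (y * T 0 * y ^+ r - y ^+ r * T 0 * y).
  by rewrite -IH /P !mulrA.
have -> : y * T 0 * y ^+ r.+1 * T 0 = y * (T 0 * y ^+ r.+1 * T 0) by rewrite !mulrA.
have E : y * (W * P - e * (W * (y ^+ r * T 0))) - (W * P - e * (W * (y ^+ r * T 0))) * y =
    W * (y * P - P * y) - e * (W * (y ^+ r * (y * T 0 - T 0 * y))).
  rewrite mulrBr mulrBl opprD addrACA -opprD; congr (_ - _).
  - by rewrite mulrBr (mulrA y) -Wy !mulrA.
  - rewrite (mulrBr (y ^+ r)) (mulrBr W) mulrBr !mulrA; congr (_ - _).
    by rewrite ey -(mulrA e y W) -Wy mulrA -!(mulrA (e * W)) -exprS exprSr.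
rewrite (W0 r) E IH' (mulrA W e) -eW -(mulrA e) -mulrBr -mulrBr.
have -> : y * T 0 * y ^+ r - y ^+ r * T 0 * y - y ^+ r * (y * T 0 - T 0 * y) =
    y * (T 0 * y ^+ r - y ^+ r * T 0).
  by rewrite !mulrBr !mulrA -exprSr exprS opprB addrA subrK.
by rewrite (mulrA W) Wy -mulrA WT mulrBr !mulrA -exprS.
Qed.

Local Notation trunc_eta := (L \o eta : {rmorphism k -> 'M[R]_d}).
Local Notation trunc_phi := (fun i => L \o phi i).
Local Notation trunc_T := (L \o T).
Local Notation trunc_al := (L \o al).

Lemma trunc_etaC c (v : 'M[R]_d) : trunc_eta c * v = v * trunc_eta c.
Proof.
apply/matrixP => i j; rewrite [LHS]mul_scal_mxE [RHS]mul_mx_scalE.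
exact: (rep_eta rep).
Qed.

Lemma evalX_T0 : (0 < n)%N ->
  L y * L (T 0) * evalX * L (T 0) - L (T 0) * evalX * L (T 0) * L y =
  L (eta z) * tele b bd (L \o phi 0) (L \o phi 1) * (L y * L (T 0) * evalX - evalX * L (T 0) * L y).
Proof.
move=> n0; apply: opmxP => j u jd; have d0 : (0 < d)%N by apply: leq_ltn_trans jd.
rewrite tele_L !opM !mulmxBl !opM.
rewrite !(L_ec, evalX_ec _ jd) -!ecolN -!ecolD !L_ec; congr (ec 0 _).
have := congr1 (fun v => v * u) (y_T0_comm j n0).
by rewrite /= mulrBl -!mulrA mulrBl -!mulrA.
Qed.

Hypothesis d_gt0 : (0 < d)%N.

Lemma shiftX_pow r u : (r < d)%N -> shiftX ^+ r *m ec 0 u = ec r u.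
Proof.
elim: r => [|r IH] rd; first by rewrite op1_ecol.
by rewrite exprS opM IH ?shiftX_lt // ltnW.
Qed.

Lemma shiftX_pow_d u : shiftX ^+ d *m ec 0 u = - \sum_(i < d) ec i (al (f i) * u).
Proof.
have e : d.-1.+1 = d by rewrite prednK.
have -> : shiftX ^+ d = shiftX * shiftX ^+ d.-1 by rewrite -exprS e.
by rewrite opM shiftX_pow ?ltn_predL // (shiftX_last _ e).
Qed.

Lemma shiftX_f : shiftX ^+ d + \sum_(r < d) L (al (f r)) * shiftX ^+ r = 0.
Proof.
set F := LHS; have cF : GRing.comm shiftX F.
  apply: commrD; first exact/commrX.
  apply: commr_sum => r _; apply: commrM; last exact/commrX.
  by apply: shiftX_comm => r'; apply: al_f_al.
have F0 u : F *m ec 0 u = 0.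
  rewrite /F mulmxDl mulmx_suml shiftX_pow_d addrC; apply/eqP; rewrite subr_eq0; apply/eqP.
  by apply: eq_bigr => r _; rewrite opM shiftX_pow // L_ec.
apply: opmxP => j u jd; rewrite mul0mx -(shiftX_pow u jd) -opM.
by rewrite (commrX j (commr_sym cF)) opM F0 mulmx0.
Qed.

Lemma trunc_rep :
  wreath_rep b bd z f (ext_eta trunc_eta n) n.+1 (ext_phi n trunc_phi trunc_al)
    (ext_T b bd z trunc_eta n trunc_phi trunc_T trunc_al)
    (ext_x b bd z trunc_eta n trunc_phi trunc_T (L y) trunc_al shiftX evalX).
Proof.
have Le c : L (eta c) = trunc_eta c by [].
have LC u v : GRing.comm u v -> GRing.comm (L u) (L v) by move=> uv; rewrite /GRing.comm -!rmorphM uv.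
have r' := rep_rmorph Le trunc_etaC rep.
apply: (ext_rep symA basis_b dual_bd f_center r' (G := dividedX)).
- exact: alg_map_rmorph alP.
- by move=> i ni; apply/supercomm_rmorph/al_phi.
- by move=> i a ni; apply/LC/al_T.
- by move=> a; apply/LC/al_y.
- by move=> a; apply: shiftX_comm => r; apply/commr_sym/al_f_al.
- by move=> i a ni; apply: shiftX_comm => r; apply/commr_sym/al_f_phi.
- by move=> i ni; apply: shiftX_comm => r; apply: al_T.
- by apply: shiftX_comm => r; apply: al_y.
- by move=> a; apply: evalX_comm; apply/commr_sym.
- by move=> i a ni; apply: evalX_comm; apply/commr_sym/(rep_xphi rep).
- by move=> i /andP[i0 ni]; apply: evalX_comm; apply/commr_sym/(rep_xT rep); lia.
- exact: evalX_comm.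
- by have := evalX_L_evalX 1; rewrite rmorph1 mulr1 mul1r.
- by move=> _; apply: evalX_L_evalX.
- by rewrite tele_L; apply: tau_evalX.
- exact: evalX_T0.
- exact: evalX_divided.
- exact: shiftX_f.
Qed.

End TruncatedPolynomials.

(** * Ascending and descending products of the T_i *)

Section Products.
Variables (R : pzRingType) (T : nat -> R).

Definition asc i j : R := \prod_(l <- index_iota i j) T l.
Definition dsc i j : R := \prod_(l <- rev (index_iota i j)) T l.

Lemma asc_nil i : asc i i = 1.
Proof. by rewrite /asc big_geq. Qed.

Lemma dsc_nil i : dsc i i = 1.
Proof. by rewrite /dsc /index_iota subnn big_nil. Qed.

Lemma asc_ltn i j : (i < j)%N -> asc i j = T i * asc i.+1 j.
Proof. by move=> ij; rewrite /asc big_ltn. Qed.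

Lemma asc_recr i j : (i <= j)%N -> asc i j.+1 = asc i j * T j.
Proof. by move=> ij; rewrite /asc big_nat_recr. Qed.

Lemma dsc_ltn i j : (i < j)%N -> dsc i j = dsc i.+1 j * T i.
Proof.
move=> ij; rewrite /dsc /index_iota; have -> : (j - i = (j - i.+1).+1)%N by lia.
by rewrite /= rev_cons big_rcons.
Qed.

Lemma dsc_recr i j : (i <= j)%N -> dsc i j.+1 = T j * dsc i j.
Proof.
move=> ij; rewrite /dsc /index_iota subSn // -addn1 iotaD rev_cat big_cat /= big_seq1.
by rewrite subnKC.
Qed.

Lemma asc_comm u i j : (forall l, (i <= l < j)%N -> GRing.comm (T l) u) -> GRing.comm (asc i j) u.
Proof.
move=> H; apply/commr_sym; rewrite /asc big_nat; apply: commr_prod => l il.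
exact/commr_sym/H.
Qed.

Lemma asc_cat i l j : (i <= l)%N -> (l <= j)%N -> asc i j = asc i l * asc l j.
Proof. by move=> il lj; rewrite /asc (big_cat_nat il lj). Qed.

Lemma asc_shift u v i l j : (i <= l < j)%N ->
  (forall m, (l < m < j)%N -> GRing.comm (T m) u) -> (forall m, (i <= m < l)%N -> GRing.comm (T m) v) ->
  T l * u = v * T l -> asc i j * u = v * asc i j.
Proof.
move=> /andP[il lj] cu cv e; rewrite (asc_cat il (ltnW lj)) (asc_ltn lj).
by rewrite -!mulrA (asc_comm cu) (mulrA (T l)) e !mulrA (asc_comm cv).
Qed.

(** Used for generators that need two adjacent factors to pass: by the braid relation, T_l T_{l+1}
    carries T_l to T_{l+1}. *)
Lemma asc_shift2 u v i l j : (i <= l)%N -> (l.+1 < j)%N ->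
  (forall m, (l.+1 < m < j)%N -> GRing.comm (T m) u) ->
  (forall m, (i <= m < l)%N -> GRing.comm (T m) v) ->
  T l * T l.+1 * u = v * (T l * T l.+1) -> asc i j * u = v * asc i j.
Proof.
move=> il lj cu cv e; rewrite (asc_cat il (ltnW (ltnW lj))) (asc_ltn (ltnW lj)) (asc_ltn lj).
rewrite (mulrA (T l)) -!(mulrA (asc i l)) -(mulrA (T l * T l.+1)) (asc_comm cu).
by rewrite (mulrA (T l * T l.+1)) e !mulrA (asc_comm cv).
Qed.

End Products.

Lemma asc_rmorph (R S : pzRingType) (L : {rmorphism R -> S}) (T : nat -> R) (T' : nat -> S) i j :
  (forall l, (i <= l < j)%N -> L (T l) = T' l) -> L (asc T i j) = asc T' i j.
Proof.
move=> LT; rewrite /asc (rmorph_prod L) !big_nat.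
by apply: eq_bigr => l /LT.
Qed.

Section RepProducts.
Variables (k : comNzRingType) (A : superalgType k).
Variables (tr : {scalar A}) (symA : symmetric_superalgebra tr).
Variables (B : finType) (b bd : B -> A) (basis_b : homogeneous_basis b).
Hypothesis dual_bd : forall i j, tr (bd i * b j) = (i == j)%:R.
Variables (z : k) (d : nat) (f : 'I_d -> A).
Variables (R : pzRingType) (eta : {rmorphism k -> R}) (n : nat).
Variables (phi : nat -> A -> R) (T : nat -> R) (x : R).
Hypothesis rep : wreath_rep b bd z f eta n phi T x.

Lemma asc_unit i j : (j <= n)%N -> exists V, asc T i j * V = 1 /\ V * asc T i j = 1.
Proof.
move=> nj; have [ij|ij] := leqP i j; last first.
  by exists 1; rewrite /asc big_geq ?(ltnW ij) // mulr1.
elim: j nj ij => [|j IH] nj ij.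
  by exists 1; move: ij; rewrite leqn0 => /eqP ->; rewrite asc_nil mulr1.
case: (ltngtP i j.+1) ij => // [ij|->] _; last by exists 1; rewrite asc_nil mulr1.
have [V [V1 V2]] := IH (ltnW nj) ij; exists (Tinv b bd z eta phi T j * V).
have t1 := T_Tinv symA basis_b dual_bd rep nj; have t2 := Tinv_T rep nj.
rewrite asc_recr //; split.
- by rewrite !mulrA -(mulrA _ (T j)) t1 mulr1.
- by rewrite !mulrA -(mulrA _ V) V2 mulr1.
Qed.

Lemma asc_phi_shift i l j a : (j <= n)%N -> (i <= l < j)%N ->
  asc T i j * phi l a = phi l.+1 a * asc T i j.
Proof.
move=> nj ilj; apply: (asc_shift ilj) => [m ?|m ?|]; last by apply: (rep_Tl rep); lia.
- by apply: (rep_Tphi rep); lia.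
- by apply: (rep_Tphi rep); lia.
Qed.

Lemma asc_T_shift i l j : (j <= n)%N -> (i <= l)%N -> (l.+1 < j)%N ->
  asc T i j * T l = T l.+1 * asc T i j.
Proof.
move=> nj il lj; apply: (asc_shift2 il lj) => [m ?|m ?|]; last first.
- by rewrite (rep_braid rep) ?mulrA //; lia.
- by apply: (TT_comm (rep_TT rep)); lia.
- by apply: (TT_comm (rep_TT rep)); lia.
Qed.

End RepProducts.

(** * The trace as a coefficient of the representation *)

Section TraceFunctional.
Variables (k : comNzRingType) (A : superalgType k).
Variables (tr : {scalar A}) (symA : symmetric_superalgebra tr).
Variables (B : finType) (b bd : B -> A) (basis_b : homogeneous_basis b).
Hypothesis dual_bd : forall i j, tr (bd i * b j) = (i == j)%:R.
Variables (z : k) (d : nat) (f : 'I_d -> A).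
Hypothesis f_center : forall i, super_center false (f i).
Variables (H : pzRingType) (eta : {rmorphism k -> H}) (n : nat).
Variables (phi : nat -> A -> H) (T : nat -> H) (x : H).
Hypothesis rep : wreath_rep b bd z f eta n phi T x.
Hypothesis ind : forall P : H -> Prop, alg_closed eta P ->
  (forall i a, (i <= n)%N -> P (phi i a)) -> (forall i, (i < n)%N -> P (T i)) -> P x ->
  forall h, P h.
Variables (H' : pzRingType) (eta' : {rmorphism k -> H'}).
Variables (phi' : nat -> A -> H') (T' : nat -> H') (x' : H').
Hypothesis rep' : wreath_rep b bd z f eta' n.+1 phi' T' x'.
Variable incl : {rmorphism H -> H'}.
Hypothesis incl_eta : forall c, incl (eta c) = eta' c.
Hypothesis incl_phi : forall i a, (i <= n)%N -> incl (phi i a) = phi' i a.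
Hypothesis incl_T : forall i, (i < n)%N -> incl (T i) = T' i.
Hypothesis incl_x : incl x = x'.
Variables (R : pzRingType) (lam : {rmorphism H -> R}) (al : A -> R) (om : R -> H).
Hypothesis lamC : forall c v, lam (eta c) * v = v * lam (eta c).
Hypothesis alP : alg_map (lam \o eta) al.
Hypothesis al_phi : forall i, (i <= n)%N -> supercomm al (lam \o phi i).
Hypothesis omD : {morph om : u v / u + v}.
Hypothesis omMl : forall h u, om (lam h * u) = h * om u.
Hypothesis omMr : forall h u, om (u * lam h) = om u * h.
Hypothesis om_al : forall a, om (al a) = eta (tr a).

Local Notation eta1 := (lam \o eta : {rmorphism k -> R}).
Local Notation phi1 := (fun i => lam \o phi i).
Local Notation T1 := (lam \o T).
Local Notation x1 := (lam x).
Local Notation L := (scal_mx d : R -> 'M[R]_d).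
Local Notation ec := (@ecol 'M[R]_d n.+2).
Local Notation X := (shiftX f al).
Local Notation ev := (evalX d x1).
Local Notation eta2 := (L \o eta1 : {rmorphism k -> 'M[R]_d}).
Local Notation phi2 := (fun i => L \o phi1 i).
Local Notation T2 := (L \o T1).
Local Notation al2 := (L \o al).
Local Notation p0 := (@proj0 d R).
Local Notation tau i := (tele b bd al2 (phi2 i)).
Local Notation rphi := (ext_phi n phi2 al2).
Local Notation rT := (ext_T b bd z eta2 n phi2 T2 al2).
Local Notation rx := (ext_x b bd z eta2 n phi2 T2 (L x1) al2 X ev).
Local Notation E := 'M['M[R]_d]_n.+2.

Variable rho : {rmorphism H' -> E}.
Hypothesis rho_eta : forall c, rho (eta' c) = ext_eta eta2 n c.
Hypothesis rho_phi : forall i a, (i <= n.+1)%N -> rho (phi' i a) = rphi i a.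
Hypothesis rho_T : forall i, (i < n.+1)%N -> rho (T' i) = rT i.
Hypothesis rho_x : rho x' = rx.

Local Notation top v := ((v : 'cV['M[R]_d]_n.+2) ord_max 0).

Lemma ecol_decomp (v : 'cV['M[R]_d]_n.+2) : v = \sum_(j < n.+2) ec j (v j 0).
Proof.
apply/colP => i; rewrite summxE (bigD1 i) //= mxE eqxx big1 ?addr0 // => j /negPf ji.
by rewrite mxE val_eqE eq_sym ji.
Qed.

Lemma top_ec j u : (j <= n.+1)%N -> top (ec j u) = if j == n.+1 then u else 0.
Proof. by move=> nj; rewrite mxE /= eq_sym. Qed.

Lemma top_scalP (F : E) (c : 'M[R]_d) :
  (forall j u, (j <= n)%N -> top (F *m ec j u) = 0) ->
  (forall u, top (F *m ec n.+1 u) = c * u) -> forall v, top (F *m v) = c * top v.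
Proof.
move=> H0 H1 v; rewrite [in LHS](ecol_decomp v) mulmx_sumr summxE.
rewrite (bigD1 ord_max) //= big1 ?addr0 => [|j /negPf jn].
  exact: H1.
by apply: H0; have := ltn_ord j; rewrite ltnS leq_eqVlt => /orP[/eqP e|//];
  rewrite -val_eqE /= e eqxx in jn.
Qed.

(** The columns e_0, ..., e_n span a submodule stable under H. Modulo it, H acts on e_{n+1} as on
    the right factor, because the new strand stands in the last place there. *)
Lemma top_incl h v : top (rho (incl h) *m v) = L (lam h) * top v.
Proof.
elim/ind: h v => [|i a ni|i ni|].
- split=> [c v|g h Pg Ph v|g h Pg Ph v].
  + rewrite incl_eta rho_eta; apply: top_scalP => [j u nj|u]; rewrite ext_eta_ecol !top_ec ?eqxx //.
    * by rewrite ltn_eqF.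
    * exact: leqW.
  + by rewrite !rmorphD /= mulmxDl mxE Pg Ph mulrDl.
  + by rewrite (rmorphM incl) (rmorphM rho) (rmorphM lam) (rmorphM L) ext_mulE Pg Ph mulrA.
- rewrite incl_phi // rho_phi 1?leqW //.
  apply: top_scalP => [j u nj|u]; rewrite ext_phiE // ?top_ec ?eqxx // 1?leqW //.
  + by rewrite ltn_eqF.
  + by rewrite psi_lt.
- have ni' : (i <= n)%N by apply: ltnW.
  rewrite incl_T // rho_T //; apply: top_scalP => [j u nj|u]; last first.
    have [e|e] := eqVneq i.+1 n; last by rewrite ext_T_gt ?top_ec ?eqxx //; lia.
    by rewrite ext_T_gt ?top_ec ?eqxx // ltnS.
  case: (ltngtP j i) => [ji|ij|->].
  + rewrite ext_T_lt // top_ec ?leqW // ltn_eqF //.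
  + have [->|ji1] := eqVneq j i.+1.
      by rewrite ext_T_succ // mxE !top_ec ?leqW //; rewrite !ltn_eqF ?addr0 //; lia.
    by rewrite ext_T_gt ?top_ec ?ltn_eqF //; lia.
  + by rewrite ext_T_same // top_ec ?ltn_eqF //; lia.
- rewrite incl_x rho_x; apply: top_scalP => [[|j] u nj|u].
  + by rewrite ext_x0 top_ec.
  + by rewrite ext_xS ?(ltnW nj) // mxE !top_ec ?leqW // (ltn_eqF (nj : (j.+1 < n.+1)%N)) addr0.
  + by rewrite ext_xS // mxE !top_ec // eqxx addr0.
Qed.

Let repR : wreath_rep b bd z f eta1 n phi1 T1 x1.
Proof.
have e c : lam (eta c) = eta1 c by [].
exact: (rep_rmorph e lamC rep).
Qed.

Lemma shiftX_eta c : X * eta2 c = eta2 c * X.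
Proof. by apply: shiftX_comm => r; apply: lamC. Qed.

Lemma shiftX_tau : X * tau 0 = tau 0 * X.
Proof.
rewrite tele_L; apply: shiftX_comm => r; apply/commr_sym/(tele_comm0 symA basis_b dual_bd) => a.
- exact: (al_f_al f_center alP).
- exact: (al_f_phi f_center repR al_phi).
Qed.

Lemma rho_Tinv0 u : rho (Tinv b bd z eta' phi' T' 0) *m ec 0 u = ec 1 u - ec 0 (eta2 z * (tau 0 * u)).
Proof.
have e : rho (T' 0) *m (ec 1 u - ec 0 (eta2 z * (tau 0 * u))) = ec 0 u.
  by rewrite rho_T // mulmxBr ext_T_succ // ext_T_same // addrK.
rewrite -e mulmxA -[_ *m rho (T' 0)]/(_ * rho (T' 0)) -(rmorphM rho).
by rewrite (Tinv_T rep') // (rmorph1 rho) mul1mx.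
Qed.

Local Notation U := (asc T' 0 n.+1).

Section Conjugation.
Variable V : H'.
Hypotheses (UV : U * V = 1) (VU : V * U = 1).

Let conjE g g' : U * g = g' * U -> U * g * V = g'.
Proof. by move=> ->; rewrite -mulrA UV mulr1. Qed.

(** Conjugation by T_0 ... T_n raises the strands of H by one, and these act on e_0 through [lam].
    For x the conjugate is T_0 x T_0^-1; its corrections cancel when D u = (X - y) u, which is the
    condition that [u] is fixed by [ev]. *)
Lemma rho_conj_incl h u : ev * u = u ->
  rho (U * incl h * V) *m ec 0 u = ec 0 (L (lam h) * u).
Proof.
elim/ind: h u => [|i a ni|i ni|].
- split=> [c u _|g h Pg Ph u eu|g h Pg Ph u eu].
  + rewrite incl_eta (conjE (g' := eta' c)); last by rewrite (rep_eta rep').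
    by rewrite rho_eta ext_eta_ecol.
  + rewrite (rmorphD incl) mulrDr mulrDl (rmorphD rho) mulmxDl Pg // Ph //.
    by rewrite (rmorphD lam) (rmorphD L) mulrDl ecolD.
  + have -> : U * incl (g * h) * V = (U * incl g * V) * (U * incl h * V).
      by rewrite (rmorphM incl) -!mulrA (mulrA V) VU mul1r.
    rewrite (rmorphM rho) ext_mulE Ph // Pg; first by rewrite (rmorphM lam) (rmorphM L) mulrA.
    by rewrite -[in RHS]eu !mulrA -(evalX_L_evalX d x1) -!mulrA eu.
- move=> u _; rewrite incl_phi // (conjE (asc_phi_shift rep' a (leqnn _) _)) ?ltnS //.
  by rewrite rho_phi // ext_phiE // psi_gt.
- move=> u _; rewrite incl_T // (conjE (asc_T_shift rep' (leqnn _) _ _)) ?ltnS //.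
  by rewrite rho_T // ext_T_lt.
- move=> u eu; rewrite incl_x (conjE (g' := T' 0 * x' * Tinv b bd z eta' phi' T' 0)); last first.
    rewrite (asc_ltn _ (ltn0Sn n)) -!mulrA (mulrA _ (T' 0)) (Tinv_T rep') // mul1r.
    congr (_ * _); apply: asc_comm => l ?; apply/commr_sym/(rep_xT rep'); lia.
  rewrite !(rmorphM rho) !ext_mulE rho_Tinv0 rho_x mulmxBr ext_xS // ext_x0 /= mul1r.
  rewrite rho_T // mulmxBr mulmxDr !ext_T_same // ext_T_succ // -!addrA -ecolN -!ecolD.
  rewrite [X in ec 1 X](_ : _ = 0) ?ecol0 ?addr0 //.
  rewrite (mulrA X) shiftX_eta -!mulrA (mulrA X) shiftX_tau -mulrA -mulrBr -mulrDr -mulrBr -mulrDr.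
  by rewrite mulrBl -!mulrA eu addrAC subrr sub0r subrr !mulr0.
Qed.

End Conjugation.

Hypothesis d_gt0 : (0 < d)%N.
Let o : 'I_d := Ordinal d_gt0.
Let om2 (u : 'M[R]_d) : H := om (u o o).

Let om2Ml h u : om2 (L (lam h) * u) = h * om2 u.
Proof. by rewrite /om2 mul_scal_mxE omMl. Qed.

Let om2Mr h u : om2 (u * L (lam h)) = om2 u * h.
Proof. by rewrite /om2 mul_mx_scalE omMr. Qed.

Let entry0 (u : 'M[R]_d) : u o o = (u *m @ecol R d 0 1) o 0.
Proof.
rewrite mxE (bigD1 o) //= big1 ?addr0 => [|j /negPf jo]; first by rewrite mxE /= mulr1.
by rewrite mxE -[0%N]/(val o) val_eqE jo mulr0.
Qed.

Let om0 : om 0 = 0.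
Proof. by have := omMl 0 0; rewrite mulr0 mul0r. Qed.

Let omN u : om (- u) = - om u.
Proof. by apply/eqP; rewrite -addr_eq0 -omD addNr om0. Qed.

Lemma om2_pow r a : (r < d)%N -> om2 (X ^+ r * L (al a) * p0) = if r == 0%N then eta (tr a) else 0.
Proof.
move=> rd; rewrite /om2 entry0 !opM proj0_0 // L_ec mulr1 shiftX_pow // mxE /= eq_sym.
by case: eqP.
Qed.

(** Modulo f the constant term of X^d is - f_0. *)
Lemma om2_pow_d (i0 : 'I_d) a : i0 = 0%N :> nat -> om2 (X ^+ d * L (al a) * p0) = - eta (tr (f i0 * a)).
Proof.
move=> i00; rewrite /om2 entry0 !opM proj0_0 // L_ec mulr1 shiftX_pow_d // mxE summxE omN.
have e : i0 = o by apply: val_inj.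
rewrite (bigD1 o) //= big1 ?addr0 => [|j /negPf jo].
  by rewrite mxE /= -(alg_mapM alP) om_al e.
by rewrite mxE -[X in X == _]/(val o) eq_sym val_eqE jo.
Qed.

(* With e_0 = p T_0 ... T_n, the trace of h is the p-coefficient of e_{n+1} in
   h (T_0 ... T_n)^-1 e_0, where p is the constant polynomial 1 in X. *)
Theorem trace_functional : exists theta : H' -> H,
  [/\ {morph theta : u v / u + v}, forall h u, theta (incl h * u) = h * theta u,
      forall h u, theta (u * incl h) = theta u * h, theta (T' n) = 0 &
      (forall r a, (r < d)%N -> theta (dsc T' 0 n.+1 * x' ^+ r * phi' 0 a * U) =
         if r == 0%N then eta (tr a) else 0) /\
      (forall (i0 : 'I_d) a, i0 = 0%N :> nat -> theta (dsc T' 0 n.+1 * x' ^+ d * phi' 0 a * U) =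
         - eta (tr (f i0 * a)))].
Proof.
have [V0 [UV0 VU0]] := asc_unit symA basis_b dual_bd rep 0 (leqnn n).
pose Ti := Tinv b bd z eta' phi' T' n.
have TTi : T' n * Ti = 1 by apply: (T_Tinv symA basis_b dual_bd rep').
have TiT : Ti * T' n = 1 by apply: (Tinv_T rep').
have UE : U = incl (asc T 0 n) * T' n.
  by rewrite asc_recr // (asc_rmorph (L := incl) (T' := T')) // => l /andP[_]; apply: incl_T.
have [V [UV VU TV]] : exists V, [/\ U * V = 1, V * U = 1 & T' n * V = incl V0].
  (* With this inverse, T_n V lies in the image of H. Hence theta(T_n) is the last coordinate of an
     element of H applied to e_0, which vanishes by [top_incl]. *)
  exists (Ti * incl V0); rewrite UE; split.
  - by rewrite -mulrA (mulrA (T' n)) TTi mul1r -(rmorphM incl) UV0 (rmorph1 incl).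
  - by rewrite -mulrA (mulrA (incl V0)) -(rmorphM incl) VU0 (rmorph1 incl) mul1r.
  - by rewrite mulrA TTi mul1r.
pose theta u := om2 (top (rho (u * V) *m ec 0 p0)).
have ev_p0 : ev * p0 = p0 by apply: evalX_proj0.
have rho_dsc j u : (j <= n.+1)%N -> rho (dsc T' 0 j) *m ec 0 u = ec j u.
  elim: j => [|j IH] nj; first by rewrite dsc_nil (rmorph1 rho) mul1mx.
  by rewrite dsc_recr // (rmorphM rho) ext_mulE IH 1?ltnW // rho_T // ext_T_same.
have rho_x0 r u : rho (x' ^+ r) *m ec 0 u = ec 0 (X ^+ r * u).
  elim: r => [|r IH]; first by rewrite (rmorph1 rho) mul1mx mul1r.
  by rewrite exprS (rmorphM rho) ext_mulE IH rho_x ext_x0 mulrA -exprS.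
have val r a : theta (dsc T' 0 n.+1 * x' ^+ r * phi' 0 a * U) = om2 (X ^+ r * L (al a) * p0).
  rewrite /theta -!mulrA UV mulr1 !(rmorphM rho) !ext_mulE rho_phi // ext_phiE //.
  by rewrite rho_x0 rho_dsc // top_ec // eqxx psi_same mulrA.
exists theta; split; last split.
- by move=> u v; rewrite /theta mulrDl (rmorphD rho) mulmxDl mxE /om2 mxE omD.
- by move=> h u; rewrite /theta -mulrA (rmorphM rho) ext_mulE top_incl om2Ml.
- move=> h u; rewrite /theta.
  have -> : u * incl h * V = u * V * (U * incl h * V).
    by rewrite -!mulrA (mulrA V) VU mul1r.
  (* The projection [p0] onto constants is fixed by [ev], and commuting it with the scalars from H
     turns the action of [h] into multiplication on the right. *)
  rewrite (rmorphM rho) ext_mulE rho_conj_incl // -(proj0_comm d (lam h)).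
  rewrite -om2Mr; congr om2; rewrite !mxE mulr_suml; apply: eq_bigr => j _.
  by rewrite -mulrA !mxE; case: eqP => // _; rewrite mul0r.
- rewrite /theta TV top_incl top_ec //= mulr0 /om2 mxE; exact: om0.
- by move=> r a rd; rewrite val om2_pow.
- by move=> i0 a i00; rewrite val (om2_pow_d _ i00).
Qed.

End TraceFunctional.

(** * A in its regular representation over H *)

Section RegularRep.
Variables (k : comNzRingType) (A : superalgType k).
Variables (tr : {scalar A}) (symA : symmetric_superalgebra tr).
Variables (B : finType) (b bd : B -> A) (basis_b : homogeneous_basis b).
Hypothesis dual_bd : forall i j, tr (bd i * b j) = (i == j)%:R.
Variables (H : pzRingType) (eta : {rmorphism k -> H}).
Hypothesis etaC : forall c h, eta c * h = h * eta c.

Local Notation m := #|B|.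
Local Notation L := (scal_mx m : H -> 'M[H]_m).
Local Notation bi i := (b (enum_val (i : 'I_m))).
Local Notation bdi i := (bd (enum_val (i : 'I_m))).
Local Notation sg i := ((-1) ^+ bpar b (enum_val (i : 'I_m)) : H).

(* Left multiplication on A in the coordinates of [b], the parity operator, and the
   functional u |-> tr (u 1). *)
Definition reg_al (a : A) : 'M[H]_m := \matrix_(i, j) eta (tr (bdi i * a * bi j)).
Definition reg_pi : 'M[H]_m := \matrix_(i, j) (if i == j then sg i else 0).
Definition reg_om (u : 'M[H]_m) : H := \sum_i \sum_j eta (tr (bi i)) * u i j * eta (tr (bdi j)).

Lemma sum_enum_val (V : nmodType) (F : B -> V) : \sum_(i < m) F (enum_val i) = \sum_i F i.
Proof. by rewrite [RHS](reindex _ (onW_bij _ (@enum_val_bij B))). Qed.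

Lemma reg_alP : alg_map (L \o eta) reg_al.
Proof.
split=> [c u v||u v]; apply/matrixP => i j.
- rewrite [RHS]mxE [X in _ = X + _]mul_scal_mxE !mxE -rmorphM -rmorphD.
  by rewrite mulrDr mulrDl -scalerAr -scalerAl linearP.
- by rewrite !mxE mulr1 dual_bd (inj_eq enum_val_inj); case: eqP; rewrite ?rmorph1 ?rmorph0.
- rewrite !mxE; under eq_bigr do rewrite !mxE -rmorphM.
  rewrite -rmorph_sum (sum_enum_val (fun x => tr (bdi i * u * b x) * tr (bd x * v * bi j))).
  congr (eta _); rewrite -mulrA -mulrA mulrA [in LHS](basis_coord basis_b dual_bd (v * bi j)).
  rewrite mulr_sumr (tr_sum tr); apply: eq_bigr => y _.
  by rewrite -scalerAr (trZ tr) mulrC mulrA.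
Qed.

Lemma reg_piE u i j : (reg_pi * u) i j = sg i * u i j.
Proof.
rewrite mxE (bigD1 i) //= mxE eqxx big1 ?addr0 // => l /negPf li.
by rewrite mxE eq_sym li mul0r.
Qed.

Lemma reg_Epi u i j : (u * reg_pi) i j = u i j * sg j.
Proof.
rewrite mxE (bigD1 j) //= mxE eqxx big1 ?addr0 // => l /negPf li.
by rewrite mxE li mulr0.
Qed.

Lemma reg_pi2 : reg_pi * reg_pi = 1.
Proof.
apply/matrixP => i j; rewrite reg_piE !mxE.
by case: eqP => [->|_]; rewrite ?mulr0 // -signr_addb addbb.
Qed.

Lemma sign_comm (h : H) p : GRing.comm ((-1) ^+ p) h.
Proof. by apply/commr_sym/commr_sign. Qed.

Lemma reg_pi_L h : GRing.comm reg_pi (L h).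
Proof.
apply/matrixP => i j; rewrite reg_piE reg_Epi !mxE.
by case: eqP => [->|_]; rewrite ?mulr0 ?mul0r ?mulr0n ?mulr0 ?mul0r // sign_comm.
Qed.

Lemma reg_al_L a h : GRing.comm (reg_al a) (L h).
Proof. by apply/matrixP => i j; rewrite mul_mx_scalE mul_scal_mxE mxE etaC. Qed.

Lemma tr_parity p q r x y w : homog p x -> homog q y -> homog r w ->
  p (+) q (+) r -> tr (x * y * w) = 0.
Proof. by move=> px qy rw; apply: (tr_odd symA); apply: (parM homogP) => //; apply: (parM homogP). Qed.

(** An entry of [reg_al a] vanishes unless the parities of row, [a] and column add up to zero,
    because [tr] is zero on odd elements. *)
Lemma reg_pi_al p a : homog p a -> reg_pi * reg_al a = (-1) ^+ p * (reg_al a * reg_pi).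
Proof.
move=> pa; apply/matrixP => i j; rewrite reg_piE.
have -> : (-1) ^+ p = L ((-1) ^+ p) by rewrite rmorphXn rmorphN1.
rewrite mul_scal_mxE reg_Epi mxE.
set x := enum_val i; set y := enum_val j.
have [|e] := boolP (bpar b x (+) p (+) bpar b y).
  move=> /(tr_parity (bd_homog symA basis_b dual_bd x) pa (bpar_homog basis_b y)) ->.
  by rewrite rmorph0 mul0r !mulr0.
rewrite -[eta _ * _]sign_comm mulrA; congr (_ * _).
by move: e; case: p pa => _; do 2![case: bpar] => //= _; rewrite ?expr0 ?expr1 ?mulr1 ?mul1r ?mulrNN ?mulr1.
Qed.

Lemma reg_omD : {morph reg_om : u v / u + v}.
Proof.
move=> u v; rewrite -big_split; apply: eq_bigr => i _; rewrite -big_split; apply: eq_bigr => j _.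
by rewrite mxE mulrDr mulrDl.
Qed.

Lemma reg_omL h u : reg_om (L h * u) = h * reg_om u.
Proof.
rewrite mulr_sumr; apply: eq_bigr => i _; rewrite mulr_sumr; apply: eq_bigr => j _.
by rewrite mul_scal_mxE (mulrA (eta _)) etaC !mulrA.
Qed.

Lemma reg_omR h u : reg_om (u * L h) = reg_om u * h.
Proof.
rewrite mulr_suml; apply: eq_bigr => i _; rewrite mulr_suml; apply: eq_bigr => j _.
by rewrite mul_mx_scalE -!mulrA (etaC _ h).
Qed.

(** The coefficients tr(b_i) vanish for odd b_i, so the signs in the parity operator are invisible.
    Likewise on the right with the dual basis. *)
Lemma reg_om_pil u : reg_om (reg_pi * u) = reg_om u.
Proof.
apply: eq_bigr => i _; apply: eq_bigr => j _; rewrite reg_piE.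
have [e|e] := boolP (bpar b (enum_val i)); last by rewrite mul1r.
by rewrite (tr_odd symA (bpar_homog basis_b _) e) rmorph0 !mul0r.
Qed.

Lemma reg_om_pir u : reg_om (u * reg_pi) = reg_om u.
Proof.
apply: eq_bigr => i _; apply: eq_bigr => j _; rewrite reg_Epi.
have [e|e] := boolP (bpar b (enum_val j)); last by rewrite mulr1.
by rewrite (tr_odd symA (bd_homog symA basis_b dual_bd _) e) rmorph0 !mulr0.
Qed.

Lemma reg_om_al a : reg_om (reg_al a) = eta (tr a).
Proof.
have -> : tr a = \sum_(i < m) \sum_(j < m) tr (bi i) * tr (bdi i * a * bi j) * tr (bdi j).
  under eq_bigr do rewrite (sum_enum_val (fun y => tr (bi _) * tr (bdi _ * a * b y) * tr (bd y))).
  rewrite (sum_enum_val (fun x => \sum_y tr (b x) * tr (bd x * a * b y) * tr (bd y))).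
  rewrite [in LHS](basis_coord basis_b dual_bd a) (tr_sum tr); apply: eq_bigr => x _.
  rewrite (trZ tr) mulrC -[in LHS](mulr1 (bd x * a)) (basis_coord basis_b dual_bd 1).
  rewrite mulr_sumr (tr_sum tr) mulr_sumr; apply: eq_bigr => y _.
  by rewrite -scalerAr (trZ tr) mulr1 mulrA mulrAC.
rewrite rmorph_sum; apply: eq_bigr => i _; rewrite rmorph_sum; apply: eq_bigr => j _.
by rewrite mxE !rmorphM.
Qed.

End RegularRep.

Section TraceExistence.
Variables (k : comNzRingType) (A : superalgType k).
Variables (tr : {scalar A}) (symA : symmetric_superalgebra tr).
Variables (B : finType) (b bd : B -> A) (basis_b : homogeneous_basis b).
Hypothesis dual_bd : forall i j, tr (bd i * b j) = (i == j)%:R.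
Variables (z : k) (d : nat) (f : 'I_d -> A).
Hypothesis f_center : forall i, super_center false (f i).
Hypothesis d_gt0 : (0 < d)%N.
Variables (H : pzRingType) (eta : {rmorphism k -> H}) (n : nat).
Variables (phi : nat -> A -> H) (T : nat -> H) (x : H).
Hypothesis rep : wreath_rep b bd z f eta n phi T x.
Hypothesis ind : forall P : H -> Prop, alg_closed eta P ->
  (forall i a, (i <= n)%N -> P (phi i a)) -> (forall i, (i < n)%N -> P (T i)) -> P x ->
  forall h, P h.
Variables (par : bool -> H -> Prop) (lam : {rmorphism H -> 'M[H]_#|B|}).
Hypothesis par_decomp : forall h, exists h0 h1, [/\ par false h0, par true h1 & h = h0 + h1].
Hypothesis par_eta : forall c, par false (eta c).
Hypothesis par_phi : forall p i a, homog p a -> par p (phi i a).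
Hypothesis par_T : forall i, par false (T i).
Hypothesis par_x : par false x.
Hypothesis lamE : forall p h, par p h -> lam h = scal_mx #|B| h * reg_pi b H ^+ p.
Variables (H' : pzRingType) (eta' : {rmorphism k -> H'}).
Variables (phi' : nat -> A -> H') (T' : nat -> H') (x' : H').
Hypothesis rep' : wreath_rep b bd z f eta' n.+1 phi' T' x'.
Hypothesis lift' : forall (R : pzRingType) (etaR : {rmorphism k -> R}) phiR TR xR,
  wreath_rep b bd z f etaR n.+1 phiR TR xR -> exists L : {rmorphism H' -> R},
  [/\ forall c, L (eta' c) = etaR c, forall i a, (i <= n.+1)%N -> L (phi' i a) = phiR i a,
      forall i, (i < n.+1)%N -> L (T' i) = TR i & L x' = xR].
Variable incl : {rmorphism H -> H'}.
Hypothesis incl_eta : forall c, incl (eta c) = eta' c.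
Hypothesis incl_phi : forall i a, (i <= n)%N -> incl (phi i a) = phi' i a.
Hypothesis incl_T : forall i, (i < n)%N -> incl (T i) = T' i.
Hypothesis incl_x : incl x = x'.

Local Notation al := (reg_al tr b bd eta).
Local Notation om := (reg_om tr b bd eta).
Local Notation pi := (reg_pi b H).
Local Notation L := (scal_mx #|B| : H -> 'M[H]_#|B|).

Lemma lam_even h : par false h -> lam h = L h.
Proof. by move=> /lamE ->; rewrite mulr1. Qed.

(** An odd part of [h] acts with an extra parity operator, which [om] absorbs on either side; what
    remains is linearity over H. *)
Lemma lam_om h u : om (lam h * u) = h * om u /\ om (u * lam h) = om u * h.
Proof.
have etaC := rep_eta rep.
have [h0 [h1 [p0 p1 ->]]] := par_decomp h.
rewrite (rmorphD lam) (lam_even p0) (lamE p1) mulrDl mulrDr !(reg_omD tr b bd eta) !mulrA.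
rewrite -(mulrA (L h1)) !(reg_omL tr b bd etaC) (reg_om_pil symA bd basis_b).
by rewrite (reg_om_pir symA basis_b dual_bd) !(reg_omR tr b bd etaC) mulrDl mulrDr.
Qed.

Theorem trace_exists : exists theta : H' -> H,
  [/\ {morph theta : u v / u + v}, forall h u, theta (incl h * u) = h * theta u,
      forall h u, theta (u * incl h) = theta u * h, theta (T' n) = 0 &
      (forall r a, (r < d)%N -> theta (dsc T' 0 n.+1 * x' ^+ r * phi' 0 a * asc T' 0 n.+1) =
         if r == 0%N then eta (tr a) else 0) /\
      (forall (i0 : 'I_d) a, i0 = 0%N :> nat ->
         theta (dsc T' 0 n.+1 * x' ^+ d * phi' 0 a * asc T' 0 n.+1) = - eta (tr (f i0 * a)))].
Proof.
have etaC := rep_eta rep.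
have lam_eta c : lam (eta c) = L (eta c) by apply/lam_even.
have lamC c v : lam (eta c) * v = v * lam (eta c).
  rewrite lam_eta; apply/matrixP => i j; rewrite [LHS]mul_scal_mxE [RHS]mul_mx_scalE.
  exact: etaC.
have alP' : alg_map (lam \o eta) al.
  have aP := reg_alP basis_b dual_bd eta; split.
  - by move=> c u v; rewrite (alg_mapP aP) /= lam_eta.
  - exact: alg_map1 aP.
  - exact: alg_mapM aP.
have al_phi i : (i <= n)%N -> supercomm al (lam \o phi i).
  move=> _ p q u v pu qv; rewrite /= (lamE (par_phi i qv)) mulrA (reg_al_L tr b bd etaC).
  have -> : (-1) ^+ (p && q) * (L (phi i v) * pi ^+ q * al u) =
      L (phi i v) * ((-1) ^+ (p && q) * (pi ^+ q * al u)).
    by rewrite [RHS]mulrA [X in _ = X * _]commr_sign !mulrA.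
  rewrite -mulrA; congr (_ * _); case: (q); last by rewrite andbF mulr1 !mul1r.
  by rewrite andbT (reg_pi_al symA basis_b dual_bd eta pu) mulrA -signr_addb addbb mul1r.
have al_T i a : (i < n)%N -> GRing.comm (lam (T i)) (al a).
  by move=> _; rewrite lam_even //; apply/commr_sym/(reg_al_L tr b bd etaC).
have al_x a : GRing.comm (lam x) (al a).
  by rewrite lam_even //; apply/commr_sym/(reg_al_L tr b bd etaC).
pose eta1 := lam \o eta : {rmorphism k -> 'M[H]_#|B|}.
have e c : lam (eta c) = eta1 c by [].
have repR := rep_rmorph e lamC rep.
have rep2 := trunc_rep symA basis_b dual_bd f_center repR alP' al_phi al_T al_x d_gt0.
have [rho [rho_eta rho_phi rho_T rho_x]] := lift' rep2.
apply: (trace_functional symA basis_b dual_bd f_center rep ind rep' incl_eta incl_phi incl_T incl_x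
  lamC alP' al_phi (reg_omD tr b bd eta) _ _ _ rho_eta rho_phi rho_T rho_x d_gt0).
- by move=> h u; have [] := lam_om h u.
- by move=> h u; have [] := lam_om h u.
- exact: (reg_om_al basis_b dual_bd).
Qed.

End TraceExistence.

(** * Spanning sets *)

Section Demazure.
Variables (R : pzRingType) (T X X' e : R).
Hypotheses (TT : T * T = e * T + 1) (XX : GRing.comm X X') (TXT : T * X * T = X').
Hypotheses (eT : GRing.comm e T) (eX : GRing.comm e X) (eX' : GRing.comm e X').

(** For r = 1, T X' = T^2 X T = (e T + 1) X T = e X' + X T; induction on r accumulates the divided
    difference. *)
Lemma demazure_l r : T * X' ^+ r = X ^+ r * T + e * \sum_(s < r) X ^+ s * X' ^+ (r - s).
Proof.
have e1 : T * X' = X * T + e * X'.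
  by rewrite -[in LHS]TXT !mulrA TT mulrDl mulrDl mul1r addrC -(mulrA e) -(mulrA e) TXT.
elim: r => [|r IH]; first by rewrite big_ord0 mulr0 mulr1 mul1r addr0.
rewrite exprSr mulrA IH mulrDl -(mulrA _ T) e1 mulrDr -addrA mulrA -exprSr; congr (_ + _).
rewrite mulrA -(commrX r eX) -!mulrA -mulrDr; congr (_ * _).
rewrite big_ord_recr /= subSnn expr1 addrC; congr (_ + _); rewrite mulr_suml.
by apply: eq_bigr => s _; rewrite -mulrA -exprSr subSn // ltnW.
Qed.

Lemma demazure_r r : X' ^+ r * T = T * X ^+ r + e * \sum_(s < r) X ^+ s * X' ^+ (r - s).
Proof.
have e1 : X' * T = T * X + e * X'.
  rewrite -[in LHS]TXT -mulrA TT mulrDr mulr1 addrC; congr (_ + _).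
  by rewrite !mulrA -(mulrA T X e) -eX mulrA -eT -!mulrA (mulrA T) TXT.
elim: r => [|r IH]; first by rewrite big_ord0 mulr0 mulr1 mul1r addr0.
rewrite exprS -mulrA IH mulrDr (mulrA _ T) e1 mulrDl -addrA -(mulrA T) -exprS; congr (_ + _).
rewrite (mulrA X') -eX' -!mulrA -mulrDr; congr (_ * _).
rewrite big_ord_recr /= subSnn expr1 addrC; congr (_ + _); first exact: (commrX r (commr_sym XX)).
rewrite mulr_sumr; apply: eq_bigr => s _.
rewrite mulrA; have -> : X' * X ^+ s = X ^+ s * X' by apply/commrX/commr_sym.
by rewrite -mulrA -exprS subSn // ltnW.
Qed.

End Demazure.

(* The relations of the affine algebra that are stable under reversing products,
   so that a spanning statement for right multiples yields one for left multiples. *)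
Record wreath_frame (R : pzRingType) (A : zmodType) (d n : nat)
    (phi : nat -> A -> R) (T X e : nat -> R) : Prop := WreathFrame {
  frame_D : forall i a c, (i <= n)%N -> phi i (a + c) = phi i a + phi i c;
  frame_1 : forall i, (i <= n)%N -> exists a, phi i a = 1;
  frame_M : forall i a c, (i <= n)%N -> exists a', phi i a * phi i c = phi i a';
  frame_sc : forall i j a c, (i <= n)%N -> (j <= n)%N -> i != j ->
    exists s : seq (A * A), phi i a * phi j c = \sum_(p <- s) phi j p.1 * phi i p.2;
  frame_TT : forall i j, (i < n)%N -> (j < n)%N -> j != i -> j.+1 != i -> i.+1 != j ->
    T i * T j = T j * T i;
  frame_braid : forall i, (i.+1 < n)%N -> T i * T i.+1 * T i = T i.+1 * T i * T i.+1;
  frame_quad : forall i, (i < n)%N -> T i * T i = e i * T i + 1;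
  frame_eT : forall i, (i < n)%N -> e i * T i = T i * e i;
  frame_eX : forall i j, (i < n)%N -> (j <= n)%N -> e i * X j = X j * e i;
  frame_e : forall i, (i < n)%N -> forall P : R -> Prop, (forall u v, P u -> P v -> P (u + v)) ->
    (forall u v, P u -> P v -> P (u * v)) -> (forall a, P (phi i a)) -> (forall a, P (phi i.+1 a)) ->
    P (e i);
  frame_Tl : forall i a, (i < n)%N -> T i * phi i a = phi i.+1 a * T i;
  frame_Tu : forall i a, (i < n)%N -> T i * phi i.+1 a = phi i a * T i;
  frame_Tphi : forall i j a, (i < n)%N -> (j <= n)%N -> j != i -> j != i.+1 ->
    T i * phi j a = phi j a * T i;
  frame_TX : forall i j, (i < n)%N -> (j <= n)%N -> j != i -> j != i.+1 -> T i * X j = X j * T i;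
  frame_TXT : forall i, (i < n)%N -> T i * X i * T i = X i.+1;
  frame_XX : forall i j, (i <= n)%N -> (j <= n)%N -> X i * X j = X j * X i;
  frame_Xphi : forall i j a, (i <= n)%N -> (j <= n)%N -> X i * phi j a = phi j a * X i;
  frame_X0 : exists c : nat -> A, X 0 ^+ d = \sum_(r < d) phi 0%N (c r) * X 0 ^+ r;
  frame_ind : forall P : R -> Prop, (forall u v, P u -> P v -> P (u + v)) ->
    (forall u v, P u -> P v -> P (u * v)) -> (forall i a, (i <= n)%N -> P (phi i a)) ->
    (forall i, (i < n)%N -> P (T i)) -> P (X 0) -> forall u, P u
}.

Section FrameSpan.
Variables (R : pzRingType) (A : zmodType) (d n : nat).
Variables (phi : nat -> A -> R) (T X e : nat -> R).
Hypothesis fr : wreath_frame d n.+1 phi T X e.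
Hypothesis d_gt0 : (0 < d)%N.
Variable P : R -> Prop.
Hypothesis PM : forall u v, P u -> P v -> P (u * v).
Hypothesis P_phi : forall i a, (i <= n)%N -> P (phi i a).
Hypothesis P_T : forall i, (i < n)%N -> P (T i).
Hypothesis P_X0 : P (X 0).

Local Notation asc := (asc T).
Local Notation N := n.+1.

(** [P] stands for the image of H. The generators are the X_j^r a_j T_j ... T_n before [a] is
    expanded in a basis, so A enters only as an additive group and reversal of products remains
    possible. *)
Inductive span : R -> Prop :=
| span0 : span 0
| spanD u v : span u -> span v -> span (u + v)
| span_elt j r a h : (j <= N)%N -> (r < d)%N -> P h -> span (X j ^+ r * phi j a * asc j N * h).

Lemma P_1 : P 1.
Proof. by have [a <-] := frame_1 fr (leq0n N); apply: P_phi. Qed.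

Lemma P_X i : (i <= n)%N -> P (X i).
Proof.
elim: i => [|i IH] ni //; rewrite -(frame_TXT fr (leqW ni)).
by apply: PM; [apply: PM; [exact: P_T|apply: IH; exact: ltnW]|exact: P_T].
Qed.

Lemma P_exp u m : P u -> P (u ^+ m).
Proof. by move=> Pu; elim: m => [|m IH]; [apply: P_1|rewrite exprS; apply: PM]. Qed.

Lemma span_sum (I : Type) (s : seq I) (Q : pred I) F :
  (forall i, Q i -> span (F i)) -> span (\sum_(i <- s | Q i) F i).
Proof. by move=> FS; apply: (big_ind span) => //; [apply: span0|apply: spanD]. Qed.

Lemma asc_commN u j : (forall l, (j <= l < N)%N -> GRing.comm (T l) u) -> GRing.comm u (asc j N).
Proof. by move=> H; apply/commr_sym/asc_comm. Qed.

Lemma span_mulr u h : span u -> P h -> span (u * h).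
Proof.
elim=> {u} [|u v _ IHu _ IHv|j r a h' jN rd Ph'] Ph; rewrite ?mul0r ?mulrDl.
- exact: span0.
- by apply: spanD; [apply: IHu|apply: IHv].
- by rewrite -mulrA; apply: span_elt => //; apply: PM.
Qed.

(** Elements preserving the span under left multiplication are closed under sums and products, so it
    suffices to test generators; applied to 1 this gives the whole ring. *)
Definition stab u := forall v, span v -> span (u * v).

Lemma stabP u :
  (forall j r a, (j <= N)%N -> (r < d)%N -> span (u * (X j ^+ r * phi j a * asc j N))) -> stab u.
Proof.
move=> H v; elim=> {v} [|v w _ IHv _ IHw|j r a h jN rd Ph]; rewrite ?mulr0 ?mulrDr.
- exact: span0.
- exact: spanD.
- by rewrite mulrA; apply: span_mulr => //; apply: H.
Qed.

Lemma stabD u v : stab u -> stab v -> stab (u + v).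
Proof. by move=> su sv w sw; rewrite mulrDl; apply: spanD; [apply: su|apply: sv]. Qed.

Lemma stabM u v : stab u -> stab v -> stab (u * v).
Proof. by move=> su sv w sw; rewrite -mulrA; apply/su/sv. Qed.

Lemma span_X j r h : (j <= N)%N -> (r < d)%N -> P h -> span (X j ^+ r * asc j N * h).
Proof. by move=> jN rd Ph; have [a a1] := frame_1 fr jN; rewrite -(mulr1 (X j ^+ r)) -a1; apply: span_elt. Qed.

Lemma span_gen j r a : (j <= N)%N -> (r < d)%N -> span (X j ^+ r * phi j a * asc j N).
Proof. by move=> jN rd; rewrite -(mulr1 (_ * asc j N)); apply: span_elt => //; apply: P_1. Qed.

Lemma frame_phiN i a : (i <= N)%N -> phi i (- a) = - phi i a.
Proof.
move=> iN; have p0 : phi i 0 = 0.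
  by apply: (addIr (phi i 0)); rewrite -(frame_D fr) // addr0 add0r.
by apply/eqP; rewrite -addr_eq0 -(frame_D fr) // addNr p0.
Qed.

Lemma spanN u : span u -> span (- u).
Proof.
elim=> {u} [|u v _ IHu _ IHv|j r a h jN rd Ph].
- by rewrite oppr0; apply: span0.
- by rewrite opprD; apply: spanD.
- by rewrite -!mulNr mulNr -mulrN -frame_phiN //; apply: span_elt.
Qed.

(** Entries on strands below j pass T_j ... T_n unchanged and those above j drop by one strand;
    either way the result lies in the image of H. *)
Lemma phi_asc i j c : (i <= N)%N -> (j <= N)%N -> i != j ->
  exists2 h, P h & phi i c * asc j N = asc j N * h.
Proof.
move=> iN jN ij; have [lt|ge] := ltnP i j.
  exists (phi i c); first by apply: P_phi; lia.
  by apply: asc_commN => l ?; apply: (frame_Tphi fr); lia.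
case: i iN ij ge => [|i] iN ij ge; first by move: ge; rewrite leqn0 => /eqP e0; rewrite e0 in ij.
exists (phi i c); first by apply: P_phi.
have ji : (j <= i < N)%N by lia.
apply/esym/(asc_shift ji) => [l ?|l ?|]; last by apply: (frame_Tl fr).
- by apply: (frame_Tphi fr); lia.
- by apply: (frame_Tphi fr); lia.
Qed.

Lemma Xr_phi i j r c : (i <= N)%N -> (j <= N)%N -> X j ^+ r * phi i c = phi i c * X j ^+ r.
Proof. by move=> iN jN; apply/esym/commrX/esym/(frame_Xphi fr). Qed.

Lemma stab_phi i c : (i <= N)%N -> stab (phi i c).
Proof.
move=> iN; apply: stabP => j r a jN rd; rewrite !mulrA -Xr_phi //.
have [->|ij] := eqVneq i j.
  by rewrite -(mulrA _ (phi j c)); have [a' ->] := frame_M fr c a jN; apply: span_gen.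
rewrite -(mulrA _ (phi i c)); have [s ->] := frame_sc fr c a iN jN ij.
rewrite mulr_sumr mulr_suml; apply: span_sum => p _.
have [h Ph e'] := phi_asc p.2 iN jN ij.
by rewrite mulrA -(mulrA _ (phi i _)) e' mulrA; apply: span_elt.
Qed.

Lemma stab_e i : (i < N)%N -> stab (e i).
Proof.
move=> iN; apply: (frame_e fr iN (P := stab)); [exact: stabD|exact: stabM| |] => a.
  by apply: stab_phi; apply: ltnW.
exact: stab_phi.
Qed.

Let dem_l i (iN : (i < N)%N) := demazure_l (frame_quad fr iN) (frame_TXT fr iN)
  (frame_eX fr iN (ltnW iN)).
Let dem_r i (iN : (i < N)%N) := demazure_r (frame_quad fr iN) (frame_XX fr (ltnW iN) iN)
  (frame_TXT fr iN) (frame_eT fr iN) (frame_eX fr iN (ltnW iN)) (frame_eX fr iN iN).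

Lemma X_asc i j : (i < j)%N -> (j <= N)%N -> GRing.comm (X i) (asc j N).
Proof. by move=> ij jN; apply: asc_commN => l ?; apply: (frame_TX fr); lia. Qed.

Lemma Xr_comm i j r s : (i <= N)%N -> (j <= N)%N -> GRing.comm (X i ^+ r) (X j ^+ s).
Proof. by move=> iN jN; apply/commrX/commr_sym/commrX/commr_sym/(frame_XX fr). Qed.

(** Moving X_{j+1}^v through T_j lowers its exponent without exceeding v, and the powers of X_j pass
    T_{j+1} ... T_n into the right factor. *)
Lemma span_XX j s v : (j <= n)%N -> (s < d)%N -> (v < d)%N ->
  span (X j ^+ s * X j.+1 ^+ v * asc j N).
Proof.
move=> jn sd vd; have jN : (j < N)%N by [].
have cA m : X j ^+ m * asc j.+1 N = asc j.+1 N * X j ^+ m.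
  by apply/esym/commrX/commr_sym/X_asc.
rewrite (asc_ltn _ jN) -mulrA (mulrA (X j.+1 ^+ v)) (dem_r jN) mulrDl mulrDr; apply: spanD.
  rewrite -(mulrA (T j)) cA (mulrA (T j)) -(asc_ltn T jN) mulrA.
  by apply: span_X => //; [apply: ltnW|apply/P_exp/P_X].
have eX' : X j ^+ s * e j = e j * X j ^+ s by apply/esym/commrX/(frame_eX fr jN)/ltnW.
rewrite -(mulrA (e j)) (mulrA (X j ^+ s)) eX' -mulrA; apply: (stab_e jN).
rewrite mulr_suml mulr_sumr; apply: span_sum => i _.
have -> : X j ^+ s * (X j ^+ i * X j.+1 ^+ (v - i) * asc j.+1 N) =
    X j.+1 ^+ (v - i) * asc j.+1 N * X j ^+ (s + i).
  by rewrite !mulrA -exprD (Xr_comm _ _ (ltnW jN) jN) -mulrA cA mulrA.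
by apply: span_X => //; [lia|apply/P_exp/P_X].
Qed.

(** Far strands only reindex T_i inside the right factor. For j = i+1 the Demazure relation turns
    T_i T_{i+1} ... T_n into a longer product; for j = i it produces T_i^2 and monomials treated by
    [span_XX]. The coefficients e_i are harmless by [stab_e]. *)
Lemma stab_T i : (i < N)%N -> stab (T i).
Proof.
move=> iN; apply: stabP => j r a jN rd.
have far h : P h -> T i * X j ^+ r = X j ^+ r * T i -> T i * phi j a = phi j a * T i ->
    T i * asc j N = asc j N * h -> span (T i * (X j ^+ r * phi j a * asc j N)).
  move=> Ph cX cp cA; have -> : T i * (X j ^+ r * phi j a * asc j N) =
      X j ^+ r * phi j a * asc j N * h.
    by rewrite !mulrA cX -(mulrA _ (T i)) cp !mulrA -(mulrA _ (T i)) cA mulrA.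
  exact: span_elt.
have cX : j != i -> j != i.+1 -> T i * X j ^+ r = X j ^+ r * T i.
  by move=> ji ji1; apply/commrX/(frame_TX fr).
case: (ltngtP i j) => ij.
- have [e'|ji1] := eqVneq j i.+1; last first.
    apply: (far (T i)).
    + by apply: P_T; lia.
    + by apply: cX; lia.
    + by apply: (frame_Tphi fr); lia.
    + by apply: asc_commN => l ?; apply: (frame_TT fr); lia.
  subst j; have ni : (i <= n)%N by lia.
  rewrite !mulrA (dem_l iN) !mulrDl; apply: spanD.
    rewrite -(mulrA _ (T i)) (frame_Tu fr) // mulrA -(mulrA _ (T i)) -asc_ltn //.
    by apply: span_gen => //; apply: ltnW.
  rewrite -!(mulrA (e i)); apply: (stab_e iN); rewrite !mulr_suml; apply: span_sum => s _.
  have -> : X i ^+ s * X i.+1 ^+ (r - s) * phi i.+1 a * asc i.+1 N =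
      X i.+1 ^+ (r - s) * phi i.+1 a * asc i.+1 N * X i ^+ s.
    have cA : X i ^+ s * asc i.+1 N = asc i.+1 N * X i ^+ s.
      by apply/esym/commrX/commr_sym/X_asc.
    rewrite (Xr_comm _ _ (ltnW iN) iN) -(mulrA _ (X i ^+ s)) (Xr_phi _ _ iN (ltnW iN)) mulrA.
    by rewrite -(mulrA _ (X i ^+ s)) cA mulrA.
  by apply: span_elt => //; [lia|apply/P_exp/P_X].
- apply: (far (T i.-1)).
  + by apply: P_T; lia.
  + by apply: cX; lia.
  + by apply: (frame_Tphi fr); lia.
  case: i iN ij {far cX} => // i iN ij.
  apply/esym/(asc_shift2 (l := i)); rewrite //.
  + by move=> l ?; apply: (frame_TT fr); lia.
  + by move=> l ?; apply: (frame_TT fr); lia.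
  + by rewrite (frame_braid fr) // mulrA.
- subst j; have ni : (i <= n)%N by [].
  have TX : T i * X i ^+ r = X i.+1 ^+ r * T i - e i * \sum_(s < r) X i ^+ s * X i.+1 ^+ (r - s).
    by rewrite (dem_r iN) addrK.
  rewrite !mulrA TX !mulrBl; apply: spanD; last first.
    apply: spanN; rewrite -!(mulrA (e i)); apply: (stab_e iN).
    rewrite !mulr_suml; apply: span_sum => s _.
    rewrite -(mulrA _ _ (phi i a)) !Xr_phi // (mulrA (X i ^+ s)) Xr_phi // -!mulrA.
    apply: stab_phi => //; rewrite mulrA; have sr := ltn_ord s; apply: span_XX; lia.
  rewrite -(mulrA _ (T i)) (frame_Tl fr) // mulrA Xr_phi // -!mulrA; apply: stab_phi => //.
  have eX' : X i.+1 ^+ r * e i = e i * X i.+1 ^+ r by apply/esym/commrX/(frame_eX fr).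
  have -> : X i.+1 ^+ r * (T i * asc i N) =
      e i * (X i ^+ 0 * X i.+1 ^+ r * asc i N) + X i.+1 ^+ r * asc i.+1 N * 1.
    rewrite (asc_ltn T iN) (mulrA (T i)) (frame_quad fr iN) mulrDl !mulrDr mul1r mulr1.
    by rewrite mulrA (mulrA _ (e i)) eX' !mulrA mulr1.
  apply: spanD; first by apply/(stab_e iN)/span_XX.
  by apply: span_X => //; apply: P_1.
Qed.

Lemma stab_X0 : stab (X 0).
Proof.
apply: stabP => -[|j] r a jN rd.
  rewrite !mulrA -exprS; have [rd1|rd1] := ltnP r.+1 d; first exact: span_gen.
  have -> : r.+1 = d by lia.
  have [c ->] := frame_X0 fr; rewrite !mulr_suml; apply: span_sum => i _.
  by rewrite -!mulrA; apply: stab_phi => //; rewrite mulrA; apply: span_gen.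
have cA : X 0 * asc j.+1 N = asc j.+1 N * X 0 by apply: X_asc.
have cX : X 0 * X j.+1 ^+ r = X j.+1 ^+ r * X 0 by apply/commrX/(frame_XX fr).
have -> : X 0 * (X j.+1 ^+ r * phi j.+1 a * asc j.+1 N) = X j.+1 ^+ r * phi j.+1 a * asc j.+1 N * X 0.
  by rewrite !mulrA cX -(mulrA _ (X 0)) (frame_Xphi fr) // mulrA -(mulrA _ (X 0)) cA mulrA.
exact: span_elt.
Qed.

Theorem frame_span u : span u.
Proof.
have : stab u.
  move: u; apply: (frame_ind fr); [exact: stabD|exact: stabM|exact: stab_phi|exact: stab_T|].
  exact: stab_X0.
move=> /(_ 1); rewrite mulr1; apply.
(* The unit is the generator on the last strand with r = 0, where the product of the T_i is
   empty. *)
have := span_X (leqnn N) d_gt0 P_1.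
by rewrite asc_nil !mul1r.
Qed.

End FrameSpan.

Section FrameOfRep.
Variables (k : comNzRingType) (A : superalgType k).
Variables (tr : {scalar A}) (symA : symmetric_superalgebra tr).
Variables (B : finType) (b bd : B -> A) (basis_b : homogeneous_basis b).
Hypothesis dual_bd : forall i j, tr (bd i * b j) = (i == j)%:R.
Variables (z : k) (d : nat) (f : 'I_d -> A).
Variables (R : pzRingType) (eta : {rmorphism k -> R}) (n : nat).
Variables (phi : nat -> A -> R) (T : nat -> R) (x : R).
Hypothesis rep : wreath_rep b bd z f eta n phi T x.
Hypothesis ind : forall P : R -> Prop, alg_closed eta P ->
  (forall i a, (i <= n)%N -> P (phi i a)) -> (forall i, (i < n)%N -> P (T i)) -> P x ->
  forall u, P u.

Local Notation X := (JM T x).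
Local Notation t i := (tele b bd (phi i) (phi i.+1)).

(** A frame has no parities, so the sign rule becomes a sum over the four pairs of parts, with the
    odd-odd sign placed on one entry. *)
Lemma rep_sc_swap i j a c : (i <= n)%N -> (j <= n)%N -> i != j ->
  exists s : seq (A * A), phi i a * phi j c = \sum_(p <- s) phi j p.1 * phi i p.2.
Proof.
move=> ni nj ij; have [pi pj] := (rep_alg rep ni, rep_alg rep nj).
exists [:: (part false c, part false a); (part false c, part true a);
  (part true c, part false a); (- part true c, part true a)].
rewrite !big_cons big_nil /= addr0 (alg_map_part pi a) (alg_map_part pj c).
rewrite mulrDr !mulrDl.
have E p q : phi i (part p a) * phi j (part q c) =
    (-1) ^+ (p && q) * (phi j (part q c) * phi i (part p a)).
  by apply: (rep_sc rep ni nj ij); apply: part_homog.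
by rewrite !E /= expr0 expr1 !mul1r mulN1r (alg_mapN pj) mulNr !addrA.
Qed.

Lemma rep_phi_eta c i : (i <= n)%N -> phi i (c%:A) = eta c.
Proof. by move=> ni; rewrite (alg_mapZ (rep_alg rep ni)) (alg_map1 (rep_alg rep ni)) mulr1. Qed.

Lemma frame_of_rep : wreath_frame d n phi T X (fun i => eta z * t i).
Proof.
have TT := rep_TT rep; have br := rep_braid rep; have xT := rep_xT rep; have xTx := rep_xTx rep.
have etaC := rep_eta rep.
split.
- by move=> i a c ni; apply: (alg_mapD (rep_alg rep ni)).
- by move=> i ni; exists 1; apply: (alg_map1 (rep_alg rep ni)).
- by move=> i a c ni; exists (a * c); rewrite (alg_mapM (rep_alg rep ni)).
- by move=> i j a c; apply: rep_sc_swap.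
- by move=> i j *; apply: (TT_comm TT).
- exact: br.
- by move=> i ni; rewrite (rep_quad rep ni) mulrA.
- by move=> i ni; rewrite -mulrA -(rep_T_t symA basis_b dual_bd rep ni) !mulrA etaC.
- move=> i j ni nj; apply/esym; apply: commrM; first exact/esym/etaC.
  by apply: (tele_comm0 symA basis_b dual_bd) => a; apply: (rep_JM_phi rep) => //; apply: ltnW.
- move=> i ni P PD PM Pi Pi1; apply: (PM); first by rewrite -(rep_phi_eta z (ltnW ni)).
  apply: big_ind => //.
    by rewrite -(rmorph0 eta) -(rep_phi_eta 0 (ltnW ni)).
  by move=> y _; apply: (PM).
- exact: (rep_Tl rep).
- exact: (rep_Tu rep).
- exact: (rep_Tphi rep).
- by move=> i j ni nj ji ji1; apply: (JM_T TT br xT) => //; rewrite eq_sym.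
- by [].
- by move=> i j ni nj; apply: (JM_JM TT br xT xTx).
- by move=> i j a ni nj; apply: (rep_JM_phi rep).
(* Solving f(x) = 0 for x^d negates the coefficients; the default 0 concerns indices outside the
   sum. *)
- exists (fun r => oapp (fun i => - f i) 0 (insub r)).
  have := rep_f rep; move/eqP; rewrite addr_eq0 => /eqP ->; rewrite -sumrN.
  apply: eq_bigr => i _; rewrite valK /= (alg_mapN (rep_alg rep (leq0n n))) mulNr.
  by [].
- move=> P PD PM Pphi PT Px; apply: ind => //; split=> // c.
  by rewrite -(rep_phi_eta c (leq0n n)); apply: Pphi.
Qed.

End FrameOfRep.

(** * Reversal of products *)

Section Converse.
Variable R : pzRingType.

Lemma mul_converse (u v : R) : (u : R^c) * (v : R^c) = v * u.
Proof. by []. Qed.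

Lemma exp_converse (u : R) r : (u : R^c) ^+ r = u ^+ r.
Proof. by elim: r => // r IH; rewrite exprS IH mul_converse exprSr. Qed.

Lemma asc_converse (T : nat -> R) i j : (asc (T : nat -> R^c) i j : R) = dsc T i j.
Proof.
have [ij|ij] := leqP i j; last by rewrite /asc /dsc /index_iota (eqP (ltnW ij : _ - _ == 0)%N) !big_nil.
elim: j ij => [|j IH] ij; first by move: ij; rewrite leqn0 => /eqP ->; rewrite asc_nil dsc_nil.
case: (ltngtP i j.+1) ij => // [ij|->] _; last by rewrite asc_nil dsc_nil.
by rewrite asc_recr // dsc_recr // -IH.
Qed.

Lemma frame_converse (A : zmodType) (d n : nat) (phi : nat -> A -> R)
    (T X e : nat -> R) :
  wreath_frame d n phi T X e ->
  wreath_frame (R := R^c) d n (phi : nat -> A -> R^c) (T : nat -> R^c) (X : nat -> R^c) e.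
Proof.
move=> fr; split.
- exact: (frame_D fr).
- exact: (frame_1 fr).
- by move=> i a c ni; apply: (frame_M fr).
- move=> i j a c ni nj ij; have ji : j != i by rewrite eq_sym.
  have [s E] := frame_sc fr c a nj ni ji; exists [seq (p.2, p.1) | p <- s].
  by rewrite big_map /= mul_converse E; apply: eq_bigr.
- by move=> i j ni nj ji ji1 ij; apply/esym/(frame_TT fr).
- by move=> i ni; rewrite !mul_converse !mulrA; apply: (frame_braid fr).
- by move=> i ni; rewrite !mul_converse -(frame_eT fr ni); apply: (frame_quad fr).
- by move=> i ni; rewrite !mul_converse (frame_eT fr).
- by move=> i j ni nj; rewrite !mul_converse (frame_eX fr).
- move=> i ni P PD PM Pi Pi1; apply: (frame_e fr ni (P := P)) => // u v Pu Pv; exact: (PM v u).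
- by move=> i a ni; rewrite !mul_converse (frame_Tu fr).
- by move=> i a ni; rewrite !mul_converse (frame_Tl fr).
- by move=> i j a *; rewrite !mul_converse (frame_Tphi fr).
- by move=> i j *; rewrite !mul_converse (frame_TX fr).
- by move=> i ni; rewrite !mul_converse mulrA (frame_TXT fr).
- by move=> i j *; rewrite !mul_converse (frame_XX fr).
- by move=> i j a *; rewrite !mul_converse (frame_Xphi fr).
- have [c E] := frame_X0 fr; exists (fun r => c r); rewrite exp_converse E.
  apply: eq_bigr => r _; rewrite exp_converse mul_converse.
  have cX : X 0%N * phi 0%N (c r) = phi 0%N (c r) * X 0%N by apply: (frame_Xphi fr).
  exact: (commrX r (esym cX)).
- move=> P PD PM Pphi PT PX u; apply: (frame_ind fr (P := P)) => // v w Pv Pw; exact: (PM w v).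
Qed.

End Converse.

(** * Values of the trace *)

Section TracePairing.
Variables (R : pzRingType) (A : zmodType) (d n : nat).
Variables (phi : nat -> A -> R) (T X e : nat -> R).
Hypothesis fr : wreath_frame d n.+1 phi T X e.
Hypothesis d_gt0 : (0 < d)%N.
Variables (H : pzRingType) (incl : {rmorphism H -> R}).
Hypothesis incl_phi : forall i a, (i <= n)%N -> exists h, incl h = phi i a.
Hypothesis incl_T : forall i, (i < n)%N -> exists h, incl h = T i.
Hypothesis incl_X : forall i, (i <= n)%N -> exists h, incl h = X i.
Variable theta : R -> H.
Hypothesis thetaD : {morph theta : u v / u + v}.
Hypothesis thetaMl : forall h u, theta (incl h * u) = h * theta u.
Hypothesis thetaMr : forall h u, theta (u * incl h) = theta u * h.
Hypothesis theta_T : theta (T n) = 0.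
Variable val : nat -> A -> H.
Hypothesis theta_val : forall r a, (r <= d)%N ->
  theta (dsc T 0 n.+1 * X 0 ^+ r * phi 0 a * asc T 0 n.+1) = val r a.
Hypothesis val0 : forall r a, (0 < r < d)%N -> val r a = 0.

Local Notation N := n.+1.

Lemma theta0 : theta 0 = 0.
Proof. by have := thetaMl 0 0; rewrite rmorph0 !mul0r. Qed.

(** The trace with y placed between T_n ... T_m and T_m ... T_n. At m = n+1 both products are empty
    and it is [theta]. *)
Definition nested m y := theta (dsc T m N * y * asc T m N).

Lemma nestedD m u v : nested m (u + v) = nested m u + nested m v.
Proof. by rewrite /nested mulrDr mulrDl thetaD. Qed.

Lemma nested0 m : nested m 0 = 0.
Proof. by rewrite /nested mulr0 mul0r theta0. Qed.

Lemma nested_sum m (I : Type) (s : seq I) (Q : pred I) F :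
  nested m (\sum_(i <- s | Q i) F i) = \sum_(i <- s | Q i) nested m (F i).
Proof. exact: (big_morph _ (nestedD m) (nested0 m)). Qed.

Lemma dsc_comm u i j : (forall l, (i <= l < j)%N -> GRing.comm (T l) u) -> GRing.comm (dsc T i j) u.
Proof.
move=> cu; apply/commr_sym; rewrite /dsc.
rewrite big_seq; apply: commr_prod => l; rewrite mem_rev mem_index_iota => il.
exact/commr_sym/cu.
Qed.

Lemma nestedMl m h y : (forall l, (m <= l < N)%N -> GRing.comm (T l) (incl h)) ->
  nested m (incl h * y) = h * nested m y.
Proof. by move=> ch; rewrite /nested mulrA (dsc_comm ch) -!mulrA thetaMl. Qed.

Lemma nestedMr m h y : (forall l, (m <= l < N)%N -> GRing.comm (T l) (incl h)) ->
  nested m (y * incl h) = nested m y * h.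
Proof.
by move=> ch; rewrite /nested -mulrA -(mulrA y) -(asc_comm ch) !mulrA thetaMr.
Qed.

Lemma nestedS m y : (m <= n)%N -> nested m.+1 (T m * y * T m) = nested m y.
Proof. by move=> mn; rewrite /nested (dsc_ltn T (mn : (m < N)%N)) (asc_ltn T (mn : (m < N)%N)) !mulrA. Qed.

Lemma incl_asc i j : (j <= n)%N -> exists h, incl h = asc T i j.
Proof.
elim: j => [|j IH] nj; first by exists 1; rewrite /asc /index_iota big_nil rmorph1.
have [ij|ij] := leqP i j; last by exists 1; rewrite /asc big_geq ?rmorph1.
have [h hE] := IH (ltnW nj); have [h' hE'] := incl_T nj.
by exists (h * h'); rewrite asc_recr // rmorphM hE hE'.
Qed.

Lemma incl_dsc i j : (j <= n)%N -> exists h, incl h = dsc T i j.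
Proof.
elim: j => [|j IH] nj; first by exists 1; rewrite /dsc /index_iota sub0n big_nil rmorph1.
have [ij|ij] := leqP i j; last first.
  by exists 1; rewrite /dsc /index_iota (eqP (ij : j.+1 - i == 0)%N) big_nil rmorph1.
have [h hE] := IH (ltnW nj); have [h' hE'] := incl_T nj.
by exists (h' * h); rewrite dsc_recr // rmorphM hE hE'.
Qed.

(** Braid relations turn T_n ... T_{m+1} T_m T_{m+1} ... T_n inside out, into T_m ... T_n ... T_m;
    its outer factors lie in H and [theta_T] applies. *)
Lemma nested_T m : (m <= n)%N -> nested m.+1 (T m) = 0.
Proof.
move=> mn.
have E j : (m <= j)%N -> (j <= n)%N ->
    dsc T m.+1 j.+1 * T m * asc T m.+1 j.+1 = asc T m j * T j * dsc T m j.
  elim: j => [|j IH] mj nj.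
    by move: mj; rewrite leqn0 => /eqP ->; rewrite !asc_nil !dsc_nil !mul1r !mulr1.
  case: (ltngtP m j.+1) mj => // [mj|->] _; last by rewrite !asc_nil !dsc_nil !mul1r !mulr1.
  rewrite dsc_recr // asc_recr // -!(mulrA (T j.+1)) !mulrA -(mulrA (T j.+1)) -(mulrA (T j.+1)).
  have mj' : (m <= j)%N by []; rewrite IH ?(ltnW nj) //.
  have cA : T j.+1 * asc T m j = asc T m j * T j.+1.
    by apply/esym/asc_comm => l ?; apply: (frame_TT fr); lia.
  have cD : dsc T m j * T j.+1 = T j.+1 * dsc T m j.
    by apply/dsc_comm => l ?; apply: (frame_TT fr); lia.
  rewrite (asc_recr T mj') (dsc_recr T mj') !mulrA cA -!mulrA cD.
  by rewrite !mulrA -!(mulrA (asc T m j)) -(frame_braid fr) ?mulrA //; lia.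
rewrite /nested (E n mn (leqnn n)).
have [[h <-] [h' <-]] := (incl_asc m (leqnn n), incl_dsc m (leqnn n)).
by rewrite thetaMr thetaMl theta_T mulr0 mul0r.
Qed.

Lemma frame_Xphi_pow i j r c : (i <= N)%N -> (j <= N)%N -> X i ^+ r * phi j c = phi j c * X i ^+ r.
Proof. by move=> iN jN; apply/esym/commrX/esym/(frame_Xphi fr). Qed.

Section Step.
Variables (m : nat) (mn : (m <= n)%N).

Local Notation X' := (X m.+1).
Local Notation V := (nested m.+1).

(** Elements of H that can be pulled out of [nested m.+1] on either side. *)
Definition low w := exists2 h, incl h = w & forall l, (m.+1 <= l < N)%N -> GRing.comm (T l) w.

Lemma low_phi a : low (phi m a).
Proof.
have [h hE] := incl_phi a mn; exists h => // l ?; apply: (frame_Tphi fr); lia.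
Qed.

Lemma lowX w r : low w -> low (w ^+ r).
Proof.
case=> h <- hw; exists (h ^+ r); first by rewrite rmorphXn.
by move=> l /hw ?; apply: commrX.
Qed.

Lemma low_X r : low (X m ^+ r).
Proof. by apply: lowX; have [h hE] := incl_X mn; exists h => // l ?; apply: (frame_TX fr); lia. Qed.

Lemma low_l w y : low w -> V y = 0 -> V (w * y) = 0.
Proof. by case=> h <- hc y0; rewrite nestedMl // y0 mulr0. Qed.

Lemma low_r w y : low w -> V y = 0 -> V (y * w) = 0.
Proof. by case=> h <- hc y0; rewrite nestedMr // y0 mul0r. Qed.

(** Vanishing is required with every entry of A on strand m+1, since that strand lies outside H;
    this makes the condition stable under the teleporter e_m. *)
Definition vanish y := forall c, V (phi m.+1 c * y) = 0.

Lemma vanishV y : vanish y -> V y = 0.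
Proof. by have [c c1] := frame_1 fr (mn : (m.+1 <= N)%N); move=> /(_ c); rewrite c1 mul1r. Qed.

Lemma vanishD u v : vanish u -> vanish v -> vanish (u + v).
Proof. by move=> u0 v0 c; rewrite mulrDr nestedD u0 v0 addr0. Qed.

Lemma vanish0 : vanish 0.
Proof. by move=> c; rewrite mulr0 nested0. Qed.

Lemma vanishN y : vanish y -> vanish (- y).
Proof. by move=> y0 c; rewrite mulrN -mulrN1 -(rmorphN1 incl) nestedMr ?y0 ?mul0r // => l _; rewrite rmorphN1; apply: commrN1. Qed.

Lemma vanish_sum (I : Type) (s : seq I) (Q : pred I) F :
  (forall i, Q i -> vanish (F i)) -> vanish (\sum_(i <- s | Q i) F i).
Proof. by move=> F0; apply: (big_ind vanish) => //; [apply: vanish0|apply: vanishD]. Qed.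

Lemma vanish_phi' a y : vanish y -> vanish (phi m.+1 a * y).
Proof. by move=> y0 c; have [a' E] := frame_M fr c a (mn : (m.+1 <= N)%N); rewrite mulrA E. Qed.

Lemma vanish_phi a y : vanish y -> vanish (phi m a * y).
Proof.
move=> y0 c; have mN : (m.+1 <= N)%N by [].
have ne : m.+1 != m by rewrite gtn_eqF.
have [s E] := frame_sc fr c a mN (ltnW mN) ne.
by rewrite mulrA E mulr_suml nested_sum big1 // => p _; rewrite -mulrA; apply: low_l; [apply: low_phi|].
Qed.

Lemma vanish_X r y : vanish y -> vanish (X m ^+ r * y).
Proof.
move=> y0 c; have cX : phi m.+1 c * X m ^+ r = X m ^+ r * phi m.+1 c.
  by apply/commrX/esym/(frame_Xphi fr) => //; lia.
by rewrite mulrA cX -mulrA; apply: low_l; [apply: low_X|].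
Qed.

Lemma vanish_e y : vanish y -> vanish (e m * y).
Proof.
move: y; apply: (frame_e fr (mn : (m < N)%N) (P := fun u => forall y, vanish y -> vanish (u * y))).
- by move=> u v u0 v0 y y0; rewrite mulrDl; apply: vanishD; [apply: u0|apply: v0].
- by move=> u v u0 v0 y y0; rewrite -mulrA; apply/u0/v0.
- by move=> a y; apply: vanish_phi.
- by move=> a y; apply: vanish_phi'.
Qed.

Lemma vanish_r w y : low w -> vanish y -> vanish (y * w).
Proof. by move=> lw y0 c; rewrite mulrA; apply: low_r. Qed.

Lemma vanish_T : vanish (T m).
Proof.
move=> c; rewrite -(frame_Tl fr) //; apply: low_r; first exact: low_phi.
exact: nested_T.
Qed.

Let mN : (m < N)%N. Proof. by []. Qed.
Let dem_r := demazure_r (frame_quad fr mN) (frame_XX fr (ltnW mN) mN)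
  (frame_TXT fr mN) (frame_eT fr mN) (frame_eX fr mN (ltnW mN)) (frame_eX fr mN mN).
Let dem_l := demazure_l (frame_quad fr mN) (frame_TXT fr mN) (frame_eX fr mN (ltnW mN)).

Section VanishPowers.
Variable r : nat.
Hypothesis van : forall u, (0 < u < r)%N -> vanish (X' ^+ u).

Lemma vanish_demazure v : (v < r)%N -> vanish (e m * \sum_(s < v) X m ^+ s * X' ^+ (v - s)).
Proof.
move=> vr; apply/vanish_e/vanish_sum => s _; apply/vanish_X/van.
by have := ltn_ord s; lia.
Qed.

Lemma vanish_XT v : (v < r)%N -> vanish (X' ^+ v * T m).
Proof.
move=> vr; rewrite dem_r; apply: vanishD; last exact: vanish_demazure.
by apply: vanish_r; [apply: low_X|apply: vanish_T].
Qed.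

(** Moving T_m past X_m^r and replacing T_m^2 by e_m T_m + 1 leaves X_{m+1}^r and multiples of e_m.
    The s = 0 term of the Demazure sum cancels e_m X_{m+1}^r T_m, so the powers of X_{m+1} that
    remain have exponent below r and are already known to vanish. *)
Lemma TXT_pow : exists2 y, vanish y & T m * X m ^+ r * T m = X' ^+ r + e m * y /\
  forall a, y * phi m.+1 a = phi m a * y.
Proof.
have quad := frame_quad fr mN.
have Tu a : T m * phi m.+1 a = phi m a * T m by apply: (frame_Tu fr).
have TX v : T m * X m ^+ v = X' ^+ v * T m - e m * \sum_(s < v) X m ^+ s * X' ^+ (v - s).
  by rewrite dem_r addrK.
case: r van vanish_XT => [|r'] van' vXT.
  by exists (T m); [exact: vanish_T|rewrite mulr1 quad addrC].
have cX j v a : (j <= N)%N -> X j ^+ v * phi m a = phi m a * X j ^+ v.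
  by move=> jN; apply/esym/commrX/esym/(frame_Xphi fr) => //; apply: leqW.
exists (- \sum_(s < r') X m ^+ s.+1 * (X' ^+ (r' - s) * T m)); last split=> [|a].
- rewrite -sumrN; apply: vanish_sum => s _; rewrite -mulrN; apply: vanish_X.
  by apply: vanishN; apply: vXT; lia.
- have eX' : X' ^+ r'.+1 * e m = e m * X' ^+ r'.+1 by apply/esym/commrX/(frame_eX fr).
  rewrite TX mulrBl -mulrA quad mulrDr mulr1 mulrA eX' -mulrA -mulrA mulr_suml addrAC -mulrBr addrC.
  rewrite big_ord_recl mul1r subn0 opprD addrA subrr add0r; congr (_ + _ * - _).
  by apply: eq_bigr => s _; rewrite subSS mulrA.
rewrite mulNr mulrN; congr (- _); rewrite mulr_suml mulr_sumr; apply: eq_bigr => s _.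
by rewrite -!mulrA Tu (mulrA (X' ^+ _)) cX // -!mulrA (mulrA (X m ^+ _)) cX ?leqW // -mulrA.
Qed.

End VanishPowers.

Hypothesis IHval : forall r a, (r <= d)%N -> nested m (X m ^+ r * phi m a) = val r a.

(** Strong induction on r, since [TXT_pow] needs the vanishing of lower positive powers on strand
    m+1. Its error term vanishes, so strand m+1 inherits the value on strand m. *)
Lemma nested_val_step r a : (r <= d)%N -> V (X' ^+ r * phi m.+1 a) = val r a.
Proof.
elim/ltn_ind: r a => r IH a rd.
have van u : (0 < u < r)%N -> vanish (X' ^+ u).
  move=> /andP[u0 ur] c; rewrite -(frame_Xphi_pow) //.
  by rewrite IH ?val0 ?u0 ?(leq_trans ur) // ltnW // (leq_trans ur).
have [y y0 [TXT yphi]] := TXT_pow van.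
have E : T m * (X m ^+ r * phi m a) * T m = X' ^+ r * phi m.+1 a + e m * (phi m a * y).
  by rewrite -!mulrA -(frame_Tu fr) // !mulrA TXT mulrDl -!mulrA yphi.
have := nestedS (X m ^+ r * phi m a) mn; rewrite E nestedD IHval // => <-.
by rewrite (vanishV (vanish_e (vanish_phi a y0))) addr0.
Qed.

Lemma vanish_pow u : (0 < u < d)%N -> vanish (X' ^+ u).
Proof.
move=> /andP[u0 ud] c; rewrite -frame_Xphi_pow // nested_val_step ?(ltnW ud) // val0 //.
by rewrite u0.
Qed.

Lemma nested_XT s c : (s < d)%N -> V (X' ^+ s * phi m.+1 c * T m) = 0.
Proof.
by move=> sd; rewrite frame_Xphi_pow // -mulrA; apply: (vanish_XT vanish_pow sd).
Qed.

Lemma nested_TX r a : (r < d)%N -> V (T m * X' ^+ r * phi m.+1 a) = 0.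
Proof.
move=> rd; rewrite dem_l mulrDl nestedD.
rewrite -mulrA (frame_Tu fr) // (low_l (low_X r)) ?add0r.
  rewrite -mulrA; apply: vanishV; apply: vanish_e; rewrite mulr_suml; apply: vanish_sum => s _.
  rewrite -mulrA; apply: vanish_X; rewrite frame_Xphi_pow //; apply: vanish_phi'.
  by apply: vanish_pow; have := ltn_ord s; lia.
by apply: low_l; [apply: low_phi|apply: nested_T].
Qed.

End Step.

Lemma nested_val m r a : (m <= N)%N -> (r <= d)%N -> nested m (X m ^+ r * phi m a) = val r a.
Proof.
elim: m r a => [|m IH] r a mN rd; first by rewrite -theta_val // /nested !mulrA.
by apply: nested_val_step => // r' a'; apply: IH; apply: ltnW.
Qed.

Local Notation g i s c := (dsc T i N * X i ^+ s * phi i c).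
Local Notation h j r a := (X j ^+ r * phi j a * asc T j N).

Lemma pair_diag i s c r a a' : (i <= N)%N -> (s + r <= d)%N ->
  phi i c * phi i a = phi i a' -> theta (g i s c * h i r a) = val (s + r) a'.
Proof.
move=> iN srd E; rewrite -(nested_val a' iN srd) /nested exprD -E !mulrA; congr theta; congr (_ * _ * _).
by rewrite -[LHS]mulrA -frame_Xphi_pow // !mulrA.
Qed.

Lemma incl_exp u r : (exists h, incl h = u) -> exists h, incl h = u ^+ r.
Proof. by case=> h' <-; exists (h' ^+ r); rewrite rmorphXn. Qed.

(** Everything on strand i commutes out to the right as an element of H. What remains is T_{j-1}
    X_j^r a_j nested from strand j, whose trace is zero by [nested_TX]. *)
Lemma pair_lt i j s c r a : (i < j)%N -> (j <= N)%N -> (r < d)%N -> theta (g i s c * h j r a) = 0.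
Proof.
case: j => // j ij jN rd; have ji : (i <= j)%N by []; have jn : (j <= n)%N by [].
have iN : (i <= N)%N by lia.
have ne : i != j.+1 by lia.
have [q E] := frame_sc fr c a iN jN ne.
have cXi : GRing.comm (X i ^+ s) (X j.+1 ^+ r).
  by apply/commrX/commr_sym/commrX/commr_sym/(frame_XX fr).
have cA u : (forall l, (j.+1 <= l < N)%N -> GRing.comm (T l) u) ->
    u * asc T j.+1 N = asc T j.+1 N * u by move=> cu; apply/esym/asc_comm.
have AX : X i ^+ s * asc T j.+1 N = asc T j.+1 N * X i ^+ s.
  by apply: cA => l ?; apply: commrX; apply: (frame_TX fr); lia.
have Aphi w : phi i w * asc T j.+1 N = asc T j.+1 N * phi i w.
  by apply: cA => l ?; apply: (frame_Tphi fr); lia.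
have DE : dsc T i N = dsc T j.+1 N * T j * dsc T i j.
  have cat l : (j.+1 <= l)%N -> dsc T i l = dsc T j.+1 l * T j * dsc T i j.
    elim: l => // l IH; rewrite leq_eqVlt => /orP[/eqP <-|jl].
      by rewrite dsc_nil mul1r dsc_recr.
    by rewrite dsc_recr ?IH ?dsc_recr ?mulrA //; lia.
  exact: cat.
have -> : g i s c * h j.+1 r a = \sum_(p <- q)
    dsc T j.+1 N * (T j * X j.+1 ^+ r * phi j.+1 p.1) * asc T j.+1 N * (dsc T i j * X i ^+ s * phi i p.2).
  have D u : (forall l, (i <= l < j)%N -> GRing.comm (T l) u) -> dsc T i j * u = u * dsc T i j.
    exact: dsc_comm.
  have DX : dsc T i j * X j.+1 ^+ r = X j.+1 ^+ r * dsc T i j.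
    by apply: D => l ?; apply: commrX; apply: (frame_TX fr); lia.
  have Dphi w : dsc T i j * phi j.+1 w = phi j.+1 w * dsc T i j.
    by apply: D => l ?; apply: (frame_Tphi fr); lia.
  have DA : dsc T i j * asc T j.+1 N = asc T j.+1 N * dsc T i j.
    by apply: cA => l ?; apply: commr_sym; apply: dsc_comm => l' ?; apply: (frame_TT fr); lia.
  have -> : g i s c * h j.+1 r a = dsc T i N * X j.+1 ^+ r * (X i ^+ s * (phi i c * phi j.+1 a) * asc T j.+1 N).
    rewrite !mulrA -(mulrA _ (phi i c)) -frame_Xphi_pow // !mulrA.
    by rewrite -(mulrA _ (X i ^+ s)) cXi !mulrA.
  rewrite E mulr_sumr mulr_suml mulr_sumr; apply: eq_bigr => p _.
  rewrite DE -(mulrA _ _ (X j.+1 ^+ r)) DX (mulrA (X i ^+ s)) frame_Xphi_pow //.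
  rewrite -(mulrA (phi j.+1 p.1)) -(mulrA (phi j.+1 p.1)) -(mulrA (X i ^+ s)) Aphi (mulrA (X i ^+ s)) AX.
  rewrite !mulrA -(mulrA _ (dsc T i j) (phi j.+1 _)) Dphi !mulrA.
  by rewrite -(mulrA _ (dsc T i j) (asc T _ _)) DA !mulrA.
rewrite (big_morph _ thetaD theta0) big1 // => p _.
have jn' : (j <= n)%N by [].
have [h1 E1] := incl_dsc i jn'.
have il : (i <= n)%N by apply: leq_trans jn'.
have [h2 E2] := incl_exp s (incl_X il); have [h3 E3] := incl_phi p.2 il.
rewrite -E1 -E2 -E3 -!rmorphM thetaMr -[theta _]/(nested j.+1 _).
by rewrite nested_TX ?mul0r // => r' a' r'd; apply: nested_val => //; apply: ltnW.
Qed.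

(** Mirror image of [pair_lt]: the factors on strand j leave to the left and [nested_XT] applies. *)
Lemma pair_gt i j s c r a : (j < i)%N -> (i <= N)%N -> (s < d)%N -> theta (g i s c * h j r a) = 0.
Proof.
case: i => // i ji iN sd; have jl : (j <= i)%N by []; have il : (i <= n)%N by [].
have jN : (j <= N)%N by lia.
have ne : i.+1 != j by lia.
have [q E] := frame_sc fr c a iN jN ne.
have cXi : GRing.comm (X i.+1 ^+ s) (X j ^+ r).
  by apply/commrX/commr_sym/commrX/commr_sym/(frame_XX fr).
have cD u : (forall l, (i.+1 <= l < N)%N -> GRing.comm (T l) u) ->
    dsc T i.+1 N * u = u * dsc T i.+1 N by apply: dsc_comm.
have DX : dsc T i.+1 N * X j ^+ r = X j ^+ r * dsc T i.+1 N.
  by apply: cD => l ?; apply: commrX; apply: (frame_TX fr); lia.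
have Dphi w : dsc T i.+1 N * phi j w = phi j w * dsc T i.+1 N.
  by apply: cD => l ?; apply: (frame_Tphi fr); lia.
have AE : asc T j N = asc T j i * T i * asc T i.+1 N.
  by rewrite (asc_cat T jl (leqW il)) (asc_ltn T (il : (i < N)%N)) mulrA.
have cA u : (forall l, (j <= l < i)%N -> GRing.comm (T l) u) ->
    u * asc T j i = asc T j i * u by move=> cu; apply/esym/asc_comm.
have AX : X i.+1 ^+ s * asc T j i = asc T j i * X i.+1 ^+ s.
  by apply: cA => l ?; apply: commrX; apply: (frame_TX fr); lia.
have Aphi w : phi i.+1 w * asc T j i = asc T j i * phi i.+1 w.
  by apply: cA => l ?; apply: (frame_Tphi fr); lia.
have DA : dsc T i.+1 N * asc T j i = asc T j i * dsc T i.+1 N.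
  by apply: cD => l ?; apply/commr_sym/asc_comm => l' ?; apply: (frame_TT fr); lia.
have -> : g i.+1 s c * h j r a = \sum_(p <- q)
    X j ^+ r * phi j p.1 * asc T j i * (dsc T i.+1 N * (X i.+1 ^+ s * phi i.+1 p.2 * T i) * asc T i.+1 N).
  have -> : g i.+1 s c * h j r a =
      X j ^+ r * (dsc T i.+1 N * X i.+1 ^+ s * (phi i.+1 c * phi j a) * asc T j N).
    rewrite !mulrA -(mulrA _ (phi i.+1 c)) -frame_Xphi_pow // !mulrA.
    by rewrite -(mulrA _ (X i.+1 ^+ s)) cXi !mulrA DX.
  rewrite E mulr_sumr mulr_suml mulr_sumr; apply: eq_bigr => p _.
  rewrite AE -!mulrA; congr (_ * _); rewrite !mulrA.
  rewrite -(mulrA _ _ (phi j _)) frame_Xphi_pow // !mulrA Dphi.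
  rewrite -(mulrA _ (phi i.+1 _)) Aphi !mulrA -(mulrA _ (X i.+1 ^+ s)) AX !mulrA.
  by rewrite -(mulrA _ (dsc T _ _) (asc T j i)) DA !mulrA.
rewrite (big_morph _ thetaD theta0) big1 // => p _.
have [h1 E1] := incl_asc j il; have jn : (j <= n)%N by apply: leq_trans il.
have [h2 E2] := incl_exp r (incl_X jn); have [h3 E3] := incl_phi p.1 jn.
rewrite -E1 -E2 -E3 -!rmorphM thetaMl -[theta _]/(nested i.+1 _).
by rewrite nested_XT ?mulr0 // => r' a' r'd; apply: nested_val => //; apply: ltnW.
Qed.

End TracePairing.

(** * Unitriangular pairings and Frobenius extensions *)

Section DualBases.
Variables (H R : pzRingType) (incl : {rmorphism H -> R}) (theta : R -> H).
Hypothesis thetaD : {morph theta : u v / u + v}.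
Hypothesis thetaMl : forall h u, theta (incl h * u) = h * theta u.
Hypothesis thetaMr : forall u h, theta (u * incl h) = theta u * h.
Variables (I : finType) (e g : I -> R) (rank : I -> nat).
Hypothesis pairing : forall i j, (rank j <= rank i)%N -> theta (g i * e j) = (i == j)%:R.
Hypothesis span_e : forall x, exists h : I -> H, x = \sum_i e i * incl (h i).
Hypothesis span_g : forall x, exists h : I -> H, x = \sum_i incl (h i) * g i.

Lemma trace0 : theta 0 = 0.
Proof. by have := thetaMl 0 0; rewrite rmorph0 !mul0r. Qed.

Lemma trace_sum (J : finType) (F : J -> R) : theta (\sum_i F i) = \sum_i theta (F i).
Proof. exact: (big_morph _ thetaD trace0). Qed.

Lemma traceB u v : theta (u - v) = theta u - theta v.
Proof. by apply/(addIr (theta v)); rewrite -thetaD !subrK. Qed.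

(** Descending induction on the rank, as in Gram-Schmidt: from [g i] the pairings with vectors of
    higher rank are subtracted, using the dual elements already found. [m] bounds the distance to
    the maximal rank. *)
Lemma dual_family : exists s : I -> R, forall i j, theta (s i * e j) = (i == j)%:R.
Proof.
suff dual m i : (\max_j rank j - rank i <= m)%N -> exists s, forall j, theta (s * e j) = (i == j)%:R.
  by have [s sE] := choice (fun i => dual _ i (leqnn _)); exists s.
elim: m i => [|m IH] i im.
  exists (g i) => j; apply: pairing; have := leq_bigmax (F := rank) j; lia.
have H1 l : exists s, (rank i < rank l)%N -> forall j, theta (s * e j) = (l == j)%:R.
  have [il|_] := boolP (rank i < rank l)%N; last by exists 0.
  have [|s sE] := IH l; last by exists s.
  by have := leq_bigmax (F := rank) l; lia.
have [s sE] := choice H1.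
exists (g i - \sum_(l | (rank i < rank l)%N) incl (theta (g i * e l)) * s l) => j.
rewrite mulrBl mulr_suml traceB (big_morph _ thetaD trace0).
under eq_bigr => l il do rewrite -mulrA thetaMl sE //.
have [ij|ij] := ltnP (rank i) (rank j); last first.
  rewrite pairing // big1 ?subr0 // => l il.
  by case: eqP => [lj|]; [move: il; rewrite lj ltnNge ij|rewrite mulr0].
rewrite (bigD1 j) //= eqxx mulr1 big1 ?addr0 => [|l /andP[_ /negPf ->]]; last by rewrite mulr0.
rewrite subrr; case: eqP => // eij.
by rewrite eij ltnn in ij.
Qed.

Lemma dual_expand s : (forall i j, theta (s i * e j) = (i == j)%:R) ->
  forall x, x = \sum_i e i * incl (theta (s i * x)).
Proof.
move=> sE x; have [h ->] := span_e x; apply: eq_bigr => i _; congr (_ * incl _).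
rewrite mulr_sumr trace_sum (bigD1 i) //= mulrA thetaMr sE eqxx mul1r big1 ?addr0 // => j /negPf ji.
by rewrite mulrA thetaMr sE eq_sym ji mul0r.
Qed.

(** Pairing with [e i] in order of increasing rank isolates the coefficient of [g i]: higher or
    equal rank pairs to zero apart from i itself, and lower coefficients vanish by induction. *)
Lemma trace_nondeg x : (forall t, theta (x * t) = 0) -> x = 0.
Proof.
have [h ->] := span_g x => x0.
suff h0 m i : (rank i < m)%N -> h i = 0.
  by rewrite big1 // => i _; rewrite (h0 (rank i).+1) // rmorph0 mul0r.
elim: m i => // m IH i im; have := x0 (e i); rewrite mulr_suml trace_sum (bigD1 i) //=.
rewrite -mulrA thetaMl pairing // eqxx mulr1 big1 ?addr0 // => j /negPf ji.
rewrite -mulrA thetaMl; have [ij|ij] := leqP (rank i) (rank j).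
  by rewrite pairing // ji mulr0.
by rewrite (IH j) ?mul0r //; lia.
Qed.

Lemma incl_injective (i : I) : injective incl.
Proof.
move=> h h' E; have p1 : theta (g i * e i) = 1 by rewrite pairing // eqxx.
by rewrite -[h]mulr1 -[h']mulr1 -p1 -!thetaMl E.
Qed.

Lemma dual_fin_generated : fin_generated (right_restr incl : lmodType H^c).
Proof.
exists #|I|, (fun i => e (enum_val i)) => x; have [h xE] := span_e x.
exists (fun i => h (enum_val i)); rewrite xE.
by rewrite [LHS](reindex _ (onW_bij _ (@enum_val_bij I))).
Qed.

(** Coordinates with respect to [e] are x |-> theta(s_i x), right linear over H; a lift therefore
    sends x to the combination of chosen preimages of the images of the e_i. *)
Lemma dual_projective : projective (right_restr incl : lmodType H^c).
Proof.
have [s sE] := dual_family; have xE := dual_expand sE.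
move=> M M' p q p_surj.
have [l lE] := choice (fun i => p_surj (q (e i))).
pose h x : M := \sum_i (theta (s i * x) : H^c) *: l i.
have h_lin : linear (h : (right_restr incl : lmodType H^c) -> M).
  move=> c x y; rewrite /h scaler_sumr -big_split; apply: eq_bigr => i _ /=.
  rewrite mulrDr thetaD scalerA -scalerDl; congr ((_ + _) *: _).
  by rewrite [c *: x]/(x * incl c) mulrA thetaMr.
pose hL := GRing.isLinear.Build _ _ _ _ (h : (right_restr incl : lmodType H^c) -> M) h_lin.
pose hM : {linear (right_restr incl : lmodType H^c) -> M} := HB.pack h hL.
exists hM => x; rewrite [x in RHS]xE /= /h !linear_sum; apply: eq_bigr => i _.
by rewrite linearZ /= lE -linearZ.
Qed.

Lemma dual_frob_iso (phi : R -> H) : right_linear incl phi ->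
  exists! s, forall t, phi t = theta (s * t).
Proof.
have [s sE] := dual_family; have xE := dual_expand sE => lin.
have phiD u v : phi (u + v) = phi u + phi v.
  by have := lin u v 1; rewrite rmorph1 !mulr1.
have phi0 : phi 0 = 0 by apply: (addIr (phi 0)); rewrite -phiD addr0 add0r.
have phiM u h : phi (u * incl h) = phi u * h.
  by have := lin u 0 h; rewrite phi0 !addr0.
exists (\sum_i incl (phi (e i)) * s i); split=> [t|s' s'E].
  rewrite {1}[t]xE (big_morph _ phiD phi0) mulr_suml trace_sum; apply: eq_bigr => i _.
  by rewrite phiM -mulrA thetaMl.
apply/eqP; rewrite -subr_eq0; apply/eqP/trace_nondeg => t.
rewrite mulrBl traceB -s'E mulr_suml trace_sum {2}[t]xE (big_morph _ phiD phi0).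
by apply/eqP; rewrite subr_eq0; apply/eqP/eq_bigr => i _; rewrite phiM -mulrA thetaMl.
Qed.

End DualBases.

(** * The two spanning families of H_{n+2} over H_{n+1} *)

Section FrobeniusBases.
Variables (k : comNzRingType) (A : superalgType k).
Variables (tr : {scalar A}) (symA : symmetric_superalgebra tr).
Variables (B : finType) (b bd : B -> A) (basis_b : homogeneous_basis b).
Hypothesis dual_bd : forall i j, tr (bd i * b j) = (i == j)%:R.
Variables (z : k) (d : nat) (f : 'I_d -> A).
Hypothesis d_gt0 : (0 < d)%N.
Variables (H : pzRingType) (eta : {rmorphism k -> H}) (n : nat).
Variables (phi : nat -> A -> H) (T : nat -> H) (x : H).
Variables (R : pzRingType) (eta' : {rmorphism k -> R}).
Variables (phi' : nat -> A -> R) (T' : nat -> R) (x' : R).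
Hypothesis rep' : wreath_rep b bd z f eta' n.+1 phi' T' x'.
Hypothesis ind' : forall P : R -> Prop, alg_closed eta' P ->
  (forall i a, (i <= n.+1)%N -> P (phi' i a)) -> (forall i, (i < n.+1)%N -> P (T' i)) -> P x' ->
  forall h, P h.
Variable incl : {rmorphism H -> R}.
Hypothesis incl_eta : forall c, incl (eta c) = eta' c.
Hypothesis incl_phi : forall i a, (i <= n)%N -> incl (phi i a) = phi' i a.
Hypothesis incl_T : forall i, (i < n)%N -> incl (T i) = T' i.
Hypothesis incl_x : incl x = x'.
Variable theta : R -> H.
Hypothesis thetaD : {morph theta : u v / u + v}.
Hypothesis thetaMl : forall h u, theta (incl h * u) = h * theta u.
Hypothesis thetaMr : forall h u, theta (u * incl h) = theta u * h.
Hypothesis theta_T : theta (T' n) = 0.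
Hypothesis theta_lt : forall r a, (r < d)%N ->
  theta (dsc T' 0 n.+1 * x' ^+ r * phi' 0 a * asc T' 0 n.+1) = if r == 0%N then eta (tr a) else 0.
Variables (i0 : 'I_d) (i00 : i0 = 0%N :> nat).
Hypothesis theta_d : forall a,
  theta (dsc T' 0 n.+1 * x' ^+ d * phi' 0 a * asc T' 0 n.+1) = - eta (tr (f i0 * a)).
Variables (u0 : A) (fu : f i0 * u0 = 1) (uf : u0 * f i0 = 1).

Local Notation N := n.+1.
Local Notation X := (JM T' x').
Local Notation I := ('I_N.+1 * 'I_d * B)%type.
Let fr := frame_of_rep symA basis_b dual_bd rep' ind'.

(* For s > 0, X^s is paired with X^(d-s): the trace of X^d a is - tr (f_0 a), hence
   the factor [- u0], with [u0] inverse to f_0, in [gcoef]. *)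
Definition gexp (s : nat) := if s == 0%N then 0%N else (d - s)%N.
Definition gcoef (s : nat) (y : B) : A := if s == 0%N then bd y else - (u0 * bd y).
Definition frob_e (m : I) : R := X m.1.1 ^+ m.1.2 * phi' m.1.1 (b m.2) * asc T' m.1.1 N.
Definition frob_g (m : I) : R := dsc T' m.1.1 N * X m.1.1 ^+ gexp m.1.2 * phi' m.1.1 (gcoef m.1.2 m.2).
Definition frob_rank (m : I) : nat := m.1.2.

Let val r a : H := if r == 0%N then eta (tr a) else if r == d then - eta (tr (f i0 * a)) else 0.

Let theta_val r a : (r <= d)%N ->
  theta (dsc T' 0 n.+1 * X 0 ^+ r * phi' 0 a * asc T' 0 n.+1) = val r a.
Proof.
rewrite leq_eqVlt /val => /orP[/eqP -> | rd]; last by rewrite theta_lt // (ltn_eqF rd).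
by rewrite eqxx gtn_eqF // theta_d.
Qed.

Let val0 r a : (0 < r < d)%N -> val r a = 0.
Proof. by move=> /andP[r0 rd]; rewrite /val gtn_eqF // ltn_eqF. Qed.

Let rng_phi i a : (i <= n)%N -> exists h, incl h = phi' i a.
Proof. by move=> /incl_phi <-; exists (phi i a). Qed.

Let rng_T i : (i < n)%N -> exists h, incl h = T' i.
Proof. by move=> /incl_T <-; exists (T i). Qed.

Lemma incl_JM i : (i <= n)%N -> incl (JM T x i) = X i.
Proof.
elim: i => [|i IH] ni /=; first exact: incl_x.
by rewrite !(rmorphM incl) /= IH ?incl_T // ltnW.
Qed.

Let rng_X i : (i <= n)%N -> exists h, incl h = X i.
Proof. by move=> /incl_JM <-; exists (JM T x i). Qed.

(** On one strand the powers add up to [gexp s + r]. The condition r <= s keeps this at most d, the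
    range in which the trace is known; it is 0 exactly for s = r = 0 and d exactly for s = r > 0,
    and strictly in between the trace is zero. *)
Lemma frob_pairing l m : (frob_rank m <= frob_rank l)%N ->
  theta (frob_g l * frob_e m) = (l == m)%:R.
Proof.
case: l m => [[i s] y] [[j r] y'] /= rs; rewrite /frob_g /frob_e /=.
have gd : (gexp s < d)%N by rewrite /gexp; case: eqP => // ?; lia.
have ij0 : i != j -> ((i, s, y) == (j, r, y')) = false.
  by move=> /negPf ij; rewrite !xpair_eqE ij.
have [iN jN] : (i <= N)%N /\ (j <= N)%N by split; rewrite -ltnS.
case: (ltngtP i j) => ij.
- rewrite ij0; last by rewrite -val_eqE /= ltn_eqF.
  exact: (pair_lt fr d_gt0 rng_phi rng_T rng_X thetaD thetaMl thetaMr theta_T theta_val val0).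
- rewrite ij0; last by rewrite -val_eqE /= gtn_eqF.
  exact: (pair_gt fr d_gt0 rng_phi rng_T rng_X thetaD thetaMl thetaMr theta_T theta_val val0).
have {ij ij0} <- : i = j by apply: val_inj.
rewrite /= /frob_rank /= in rs.
have M c a : phi' i c * phi' i a = phi' i (c * a) by rewrite (alg_mapM (rep_alg rep' iN)).
have sr : (gexp s + r <= d)%N by have := ltn_ord s; rewrite /gexp; case: eqP rs => [->|]; lia.
rewrite (pair_diag fr d_gt0 rng_phi rng_T rng_X thetaD thetaMl thetaMr theta_T theta_val val0 iN sr (M _ _)).
rewrite !xpair_eqE eqxx /= /gexp /gcoef /val in sr *.
have [s0|s0] := eqVneq (s : nat) 0%N.
  have r0 : r = 0%N :> nat by move: rs; rewrite s0; lia.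
  have -> : s = r by apply: val_inj; rewrite /= s0 r0.
  by rewrite r0 /= eqxx dual_bd; case: eqP; rewrite ?rmorph1 ?rmorph0.
rewrite /=; have -> : (d - s + r == 0)%N = false by have := ltn_ord s; lia.
have [sr'|sr'] := eqVneq s r.
  rewrite -sr' subnK ?(ltnW (ltn_ord s)) // eqxx /= mulNr mulrN mulrA mulrA fu mul1r.
  by rewrite raddfN /= rmorphN opprK dual_bd; case: eqP; rewrite ?rmorph1 ?rmorph0.
have nsr : s <> r :> nat by move=> e; case/eqP: sr'; apply: val_inj.
by have -> : (d - s + r == d)%N = false by have := ltn_ord s; lia.
Qed.

Let P (u : R) := exists h, u = incl h.
Let PM u v : P u -> P v -> P (u * v).
Proof. by move=> [h ->] [h' ->]; exists (h * h'); rewrite rmorphM. Qed.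
Let P_phi i a : (i <= n)%N -> P (phi' i a).
Proof. by move=> /(rng_phi a) [h <-]; exists h. Qed.
Let P_T i : (i < n)%N -> P (T' i).
Proof. by move=> /rng_T [h <-]; exists h. Qed.
Let P_X0 : P (X 0).
Proof. by exists x; rewrite incl_x. Qed.

Lemma frob_span_e u : exists h : I -> H, u = \sum_m frob_e m * incl (h m).
Proof.
have := frame_span fr d_gt0 PM P_phi P_T P_X0 u.
elim=> {u} [|u v _ [h ->] _ [h' ->]|j r a _ jN rd [h ->]].
- by exists (fun=> 0); rewrite big1 // => m _; rewrite rmorph0 mulr0.
- exists (fun m => h m + h' m); rewrite -big_split; apply: eq_bigr => m _.
  by rewrite rmorphD mulrDr.
pose j' : 'I_N.+1 := Ordinal (jN : (j < N.+1)%N); pose r' := Ordinal rd.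
exists (fun m => if m.1 == (j', r') then eta (tr (bd m.2 * a)) * h else 0).
rewrite [in LHS](basis_coord basis_b dual_bd a).
have pj := rep_alg rep' jN; rewrite (alg_map_sum pj) mulr_sumr !mulr_suml.
rewrite -(pair_big xpredT xpredT (fun ir y => frob_e (ir, y) *
  incl (if ir == (j', r') then eta (tr (bd y * a)) * h else 0))) /=.
rewrite (bigD1 (j', r')) //= [X in _ = _ + X]big1 ?addr0 => [|ir /negPf irn]; last first.
  by rewrite big1 // => y _; rewrite irn rmorph0 mulr0.
apply: eq_bigr => y _; rewrite eqxx rmorphM incl_eta (alg_mapZ pj) /frob_e /=.
by rewrite !mulrA -!(rep_eta rep') !mulrA.
Qed.

Lemma frob_span_g u : exists h : I -> H, u = \sum_m incl (h m) * frob_g m.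
Proof.
(* In the converse ring the same spanning theorem yields left multiples of T_n ... T_j a_j X_j^r. *)
have PMc (v w : R^c) : P v -> P w -> P (v * w) by move=> Pv Pw; exact: (PM Pw Pv).
have := frame_span (frame_converse fr) d_gt0 PMc P_phi P_T P_X0 u.
elim=> {u} [|u v _ [h ->] _ [h' ->]|j r a _ jN rd [h ->]].
- by exists (fun=> 0); rewrite big1 // => m _; rewrite rmorph0 mul0r.
- exists (fun m => h m + h' m); rewrite -big_split; apply: eq_bigr => m _.
  by rewrite rmorphD mulrDl.
rewrite !mul_converse exp_converse asc_converse.
have sd : ((if r == 0%N then 0 else d - r) < d)%N by case: eqP => // ?; lia.
pose j' : 'I_N.+1 := Ordinal (jN : (j < N.+1)%N); pose s' := Ordinal sd.
(* The factor -f_0 undoes the -u0 in [gcoef], so the coordinates of a' in the dual basis are those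
   of a in [gcoef]. Likewise r |-> d - r inverts [gexp] on positive exponents. *)
pose a' := if r == 0%N then a else - (f i0 * a).
have aE : a = \sum_y tr (a' * b y) *: gcoef s' y.
  rewrite /gcoef /= /a'; case: eqP => r0 /=; first exact: (dual_coord symA basis_b dual_bd).
  have -> : (d - r == 0)%N = false by lia.
  have a'E : - (f i0 * a) = \sum_y tr (- (f i0 * a) * b y) *: bd y.
    exact: (dual_coord symA basis_b dual_bd).
  under eq_bigr do rewrite scalerN scalerAr.
  by rewrite sumrN -mulr_sumr -a'E mulrN opprK mulrA uf mul1r.
have gE : gexp s' = r by rewrite /gexp /=; case: (r =P 0%N) => [->|r0] //=; case: eqP => ?; lia.
exists (fun m => if m.1 == (j', s') then h * eta (tr (a' * b m.2)) else 0).
have pj := rep_alg rep' jN; rewrite [in LHS]aE (alg_map_sum pj) mulr_suml !mulr_sumr.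
rewrite -(pair_big xpredT xpredT (fun ir y =>
  incl (if ir == (j', s') then h * eta (tr (a' * b y)) else 0) * frob_g (ir, y))) /=.
rewrite (bigD1 (j', s')) //= [X in _ = _ + X]big1 ?addr0 => [|ir /negPf irn]; last first.
  by rewrite big1 // => y _; rewrite irn rmorph0 mul0r.
apply: eq_bigr => y _; rewrite eqxx rmorphM incl_eta (alg_mapZ pj) /frob_g /= gE.
rewrite -(mulrA (eta' _)) -(frame_Xphi_pow fr) // -!mulrA; congr (_ * _).
by rewrite mulrA -(rep_eta rep') -mulrA.
Qed.

Lemma span_low j r a : (j <= n)%N ->
  exists h, X j ^+ r * phi' j a * asc T' j N = incl h * T' n.
Proof.
move=> jn; rewrite asc_recr // mulrA.
have [h1 <-] := incl_asc rng_T j (leqnn n); have [h2 <-] := rng_phi a jn; have [h3 <-] := rng_X jn.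
by exists (h3 ^+ r * h2 * h1); rewrite !rmorphM rmorphXn.
Qed.

Lemma theta_span j r a : (j <= N)%N -> (r < d)%N ->
  theta (X j ^+ r * phi' j a * asc T' j N) = if (j == N) && (r == 0%N) then eta (tr a) else 0.
Proof.
rewrite leq_eqVlt => /orP[/eqP -> | jn] rd.
  have := nested_val fr d_gt0 rng_phi rng_T rng_X thetaD thetaMl thetaMr theta_T theta_val val0 a
    (leqnn N) (ltnW rd).
  by rewrite /nested dsc_nil asc_nil mul1r !mulr1 eqxx /val (ltn_eqF rd).
have [h ->] := span_low r a jn.
by rewrite thetaMl theta_T mulr0 ltn_eqF.
Qed.

Lemma theta_last r a : (r < d)%N ->
  theta (X N ^+ r * phi' N a) = if r == 0%N then eta (tr a) else 0.
Proof. by move=> rd; rewrite -(mulr1 (_ * _)) -(asc_nil T' N) theta_span // eqxx. Qed.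

Lemma frob_span u : span d n phi' T' X (fun v => exists h, v = incl h) u.
Proof. exact: (frame_span fr d_gt0 PM P_phi P_T P_X0 u). Qed.

Local Notation AH s := (\sum_(p <- s) phi' N p.1 * incl p.2).
Local Notation HTH t := (\sum_(p <- t) incl p.1 * T' n * incl p.2).

Let theta_big (J : Type) (s : seq J) F : theta (\sum_(i <- s) F i) = \sum_(i <- s) theta (F i).
Proof. exact: (big_morph _ thetaD (theta0 thetaMl)). Qed.

Lemma theta_graph (s0 : seq (A * H)) (s : nat -> seq (A * H)) (t : seq (H * H)) :
  theta (AH s0 + \sum_(1 <= r < d) X N ^+ r * AH (s r) + HTH t) = \sum_(p <- s0) eta (tr p.1) * p.2.
Proof.
have E r s' : (r < d)%N ->
    theta (X N ^+ r * AH s') = \sum_(p <- s') (if r == 0%N then eta (tr p.1) else 0) * p.2.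
  move=> rd; rewrite mulr_sumr theta_big; apply: eq_bigr => p _.
  by rewrite mulrA thetaMr theta_last.
rewrite !thetaD -[AH s0]mul1r (E 0%N) // [theta (HTH t)]theta_big [X in _ + X]big1 ?addr0 => [|p _].
  rewrite theta_big big_nat [X in _ + X]big1 ?addr0 // => r /andP[r1 rd].
  by rewrite E // big1 // => p _; rewrite gtn_eqF // mul0r.
by rewrite -mulrA thetaMl thetaMr theta_T mul0r mulr0.
Qed.

(** Spanning elements on the last strand contribute to the first two summands according to r; on
    earlier strands the product of the T_i ends in T_n and they fall into H T_n H. *)
Lemma graph_total u : exists (s0 : seq (A * H)) (s : nat -> seq (A * H)) (t : seq (H * H)),
  u = AH s0 + \sum_(1 <= r < d) X N ^+ r * AH (s r) + HTH t.
Proof.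
elim: (frob_span u) => {u} [|u v _ [s0 [s [t ->]]] _ [s0' [s' [t' ->]]]|j r a _ jN rd [h ->]].
- exists [::], (fun=> [::]), [::]; rewrite !big_nil add0r addr0 big1 // => r _.
  by rewrite mulr0.
- exists (s0 ++ s0'), (fun r => s r ++ s' r), (t ++ t').
  rewrite !big_cat /= addrACA; congr (_ + _); rewrite addrACA; congr (_ + _).
  by rewrite -big_split; apply: eq_bigr => r _; rewrite big_cat mulrDr.
move: jN; rewrite leq_eqVlt => /orP[/eqP -> | jn].
  rewrite asc_nil mulr1; have [->|r0] := eqVneq r 0%N.
    exists [:: (a, h)], (fun=> [::]), [::]; rewrite !big_seq1 !big_nil addr0 mul1r.
    by rewrite big1 ?addr0 // => r' _; rewrite /= ?big_nil mulr0.
  exists [::], (fun r' => if r' == r then [:: (a, h)] else [::]), [::].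
  rewrite !big_nil add0r addr0 (bigD1_seq r) /= ?iota_uniq ?eqxx //; last first.
    by rewrite mem_index_iota rd lt0n r0.
  rewrite big_seq1 big1 ?addr0 ?mulrA // => r' /negPf ->.
  by rewrite /= ?big_nil mulr0.
have [h' ->] := span_low r a jn.
exists [::], (fun=> [::]), [:: (h', h)]; rewrite !big_seq1 !big_nil add0r.
by rewrite [X in X + _]big1 ?add0r // => r' _; rewrite /= ?big_nil mulr0.
Qed.

Section Parity.
Variables (par : bool -> H -> Prop) (par' : bool -> R -> Prop).
Hypothesis supH : superalgebra eta par.
Hypothesis supR : superalgebra eta' par'.
Hypothesis par_phi' : forall p i a, homog p a -> par' p (phi' i a).
Hypothesis par_T' : forall i, par' false (T' i).
Hypothesis par_X' : par' false x'.
Hypothesis par_incl : forall p h, par p h -> par' p (incl h).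

Let par'M p q u v : par' p u -> par' q v -> par' (p (+) q) (u * v).
Proof. exact: (parM supR). Qed.
Let parD p u v : par p u -> par p v -> par p (u + v).
Proof. by move=> pu pv; have := parZD supH 1 pu pv; rewrite rmorph1 mul1r. Qed.
Let par'D p u v : par' p u -> par' p v -> par' p (u + v).
Proof. by move=> pu pv; have := parZD supR 1 pu pv; rewrite rmorph1 mul1r. Qed.
Let par'B p u v : par' p u -> par' p v -> par' p (u - v).
Proof.
by move=> pu pv; have := parZD supR (- 1) pv pu; rewrite rmorphN1 mulN1r addrC.
Qed.

Lemma parity_X j : par' false (X j).
Proof. by elim: j => //= j IH; have := par'M (par'M (par_T' j) IH) (par_T' j). Qed.

Lemma parity_elt j r p a : homog p a -> par' p (X j ^+ r * phi' j a * asc T' j N).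
Proof.
move=> pa; have pX : par' false (X j ^+ r).
  elim: r => [|r IH]; first exact: (par1 supR).
  by rewrite exprS; exact: (par'M (parity_X j) IH).
have pA : par' false (asc T' j N).
  rewrite /asc; elim: (index_iota j N) => [|l s IH]; first by rewrite big_nil; exact: (par1 supR).
  by rewrite big_cons; exact: (par'M (par_T' l) IH).
by have := par'M (par'M pX (par_phi' j pa)) pA; rewrite addbF.
Qed.

Lemma parity_split u : exists w0 w1,
  [/\ u = w0 + w1, par' false w0, par' true w1, par false (theta w0) & par true (theta w1)].
Proof.
elim: (frob_span u) => {u} [|u v _ [w0 [w1 [-> pu0 pu1 tu0 tu1]]] _ [v0 [v1 [-> pv0 pv1 tv0 tv1]]]|j r a _ jN rd [h ->]].
- exists 0, 0; rewrite addr0 (theta0 thetaMl).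
  by split=> //; [exact: (par0 supR)|exact: (par0 supR)|exact: (par0 supH)|exact: (par0 supH)].
- exists (w0 + v0), (w1 + v1); rewrite !thetaD addrACA.
  by split=> //; [apply: par'D|apply: par'D|apply: parD|apply: parD].
have [h0 [h1 [ph0 ph1 ->]]] := par_decomp supH h.
pose E p q := X j ^+ r * phi' j (part p a) * asc T' j N * incl (if q then h1 else h0).
have pE p q : par' (p (+) q) (E p q).
  apply: par'M; first exact/parity_elt/part_homog.
  by case: q; apply: par_incl.
have tE p q : par (p (+) q) (theta (E p q)).
  rewrite thetaMr theta_span //; case: ifP => _; last by rewrite mul0r; exact: (par0 supH).
  case: p; first by rewrite (tr_odd symA (part_homog true a)) // rmorph0 mul0r; exact: (par0 supH).
  rewrite -[X in par _ X]addr0; apply: (parZD supH); last exact: (par0 supH).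
  by case: q.
exists (E false false + E true true), (E false true + E true false); rewrite !thetaD; split.
- transitivity (E false false + E false true + (E true false + E true true)).
    rewrite /E -!mulrDr -rmorphD -mulrDl -mulrDl -mulrDr -(alg_mapD (rep_alg rep' jN)).
    by rewrite part_sum.
  by rewrite [E true false + _]addrC addrACA.
- exact: (par'D (pE false false) (pE true true)).
- exact: (par'D (pE false true) (pE true false)).
- exact: (parD (tE false false) (tE true true)).
- exact: (parD (tE false true) (tE true false)).
Qed.

Lemma theta_parity p u : par' p u -> par p (theta u).
Proof.
have [w0 [w1 [-> pu0 pu1 tu0 tu1]]] := parity_split u; case: p => pu.
  have e0 : w0 = 0.
    by apply: (par_direct supR) => //; have := par'B pu pu1; rewrite addrK.
  by rewrite e0 add0r.
have e1 : w1 = 0.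
  by apply: (par_direct supR) => //; have := par'B pu pu0; rewrite addrC addKr.
by rewrite e1 addr0.
Qed.

Theorem frobenius_of_trace : frobenius_extension eta eta' par par' incl theta.
Proof.
(* A basis vector exists because 1 is nonzero in A; it supplies a pair with theta(g e) = 1, from
   which injectivity of the inclusion follows. *)
have [y0 _] : exists y : B, true.
  have [y|B0] := pickP (mem B); first by exists y.
  have := oner_neq0 A; rewrite (basis_coord basis_b dual_bd 1) big1 ?eqxx // => y _.
  by have := B0 y.
split=> //.
- exact: (incl_injective thetaMl frob_pairing (ord0, i0, y0)).
- exact: theta_parity.
- exact: (dual_fin_generated frob_span_e).
- exact: (dual_projective thetaD thetaMl (fun u h => thetaMr h u) frob_pairing frob_span_e).
- exact: (dual_frob_iso thetaD thetaMl (fun u h => thetaMr h u) frob_pairing frob_span_e frob_span_g).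
Qed.

End Parity.

End FrobeniusBases.

(** * The partial trace *)

Section CyclotomicInclusion.
Variables (k : comNzRingType) (A : superalgType k).
Variables (B : finType) (b bd : B -> A) (z : k) (d : nat) (f : 'I_d -> A) (n : nat).

Local Notation H := (cyc_alg b bd z f n.+1).
Local Notation H' := (cyc_alg b bd z f n.+2).

Lemma cyc_incl_phi i a : (i <= n)%N ->
  (cyc_incl (cyc_phi b bd z f n i a) : H') = cyc_phi b bd z f n.+1 i a.
Proof.
move=> ni; have ni' : (i < n.+1)%N by [].
pose j := Ordinal ni'.
have E : (lift ord_max j : 'I_n.+2) = i :> nat by rewrite lift_maxE.
apply: etrans (congr1 _ (cyc_phiE b bd z f j a)) _.
apply: etrans (cyc_incl_gen _ _ _ _ _) _.
rewrite /incl_gen ext_at -[in RHS]E.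
exact/esym/cyc_phiE.
Qed.

Lemma cyc_incl_T i : (i < n)%N -> (cyc_incl (cyc_T b bd z f n i) : H') = cyc_T b bd z f n.+1 i.
Proof.
move=> ni; pose j := Ordinal ni.
apply: etrans (congr1 _ (cyc_TE b bd z f j)) _.
apply: etrans (cyc_incl_gen _ _ _ _ _) _.
exact: esym (cyc_TE b bd z f (widen_ord (leq_pred n.+1) j : 'I_n.+1)).
Qed.

Lemma cyc_incl_X0 : (cyc_incl (cyc_X b bd z f n 0) : H') = cyc_X b bd z f n.+1 0.
Proof.
apply: etrans (congr1 _ (cyc_XE b bd z f (ord0 : 'I_n.+1))) _.
apply: etrans (cyc_incl_gen _ _ _ _ _) _.
apply/esym; apply: etrans (cyc_XE b bd z f (ord0 : 'I_n.+2)) _.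
by congr (cyc_gen b bd z f (gen_X _)); apply: val_inj.
Qed.

Lemma cyc_incl_homog p (h : H) : cyc_homog p h -> cyc_homog p (cyc_incl h).
Proof.
pose inc : {rmorphism H -> H'} := cyc_incl (n := n.+1).
elim=> {p h} [p|p u v _ Hu _ Hv|c|p q u v _ Hu _ Hv|p a pa|i|i|i].
- by rewrite (rmorph0 inc); apply: cyc_homog0.
- exact: (eq_ind_r (@cyc_homog _ _ _ _ _ _ _ _ n.+2 p) (cyc_homogD Hu Hv) (rmorphD inc u v)).
- by rewrite cyc_incl_scal; apply: cyc_homog_scal.
- exact: (eq_ind_r (@cyc_homog _ _ _ _ _ _ _ _ n.+2 (p (+) q)) (cyc_homogM Hu Hv) (rmorphM inc u v)).
- rewrite cyc_incl_gen /incl_gen.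
  have -> : (\sum_(i < n.+1) p i = \sum_(i < n.+2) ext_last false p i)%N.
    by rewrite [RHS]big_ord_recr /= ext_max addn0; apply: eq_bigr => i _; rewrite widen_lift ext_lift.
  exact/cyc_homog_ten/ext_homog.
- by rewrite cyc_incl_gen; apply: cyc_homog_X.
- by rewrite cyc_incl_gen; apply: cyc_homog_Xinv.
- by rewrite cyc_incl_gen; apply: cyc_homog_T.
Qed.

End CyclotomicInclusion.

Section CyclotomicLift.
Variables (k : comNzRingType) (A : superalgType k).
Variables (tr : {scalar A}) (symA : symmetric_superalgebra tr).
Variables (B : finType) (b bd : B -> A) (basis_b : homogeneous_basis b).
Hypothesis dual_bd : forall i j, tr (bd i * b j) = (i == j)%:R.
Variables (z : k) (d : nat) (d_gt0 : (0 < d)%N) (f : 'I_d -> A).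
Hypothesis f_center : forall i, super_center false (f i).
Hypothesis f0_inv : forall i : 'I_d, i = 0%N :> nat -> exists u, f i * u = 1 /\ u * f i = 1.
Variable n : nat.

Local Notation H := (cyc_alg b bd z f n.+1).
Local Notation eta := (cyc_scal b bd z f n.+1 : {rmorphism k -> H}).
Local Notation phi := (cyc_phi b bd z f n).
Local Notation T := (cyc_T b bd z f n).
Local Notation x := (cyc_X b bd z f n 0).

Lemma cyc_ind (P : H -> Prop) : alg_closed eta P ->
  (forall i a, (i <= n)%N -> P (phi i a)) -> (forall i, (i < n)%N -> P (T i)) -> P x ->
  forall h, P h.
Proof. exact: (cyc_gen_ind d_gt0 f0_inv). Qed.

Lemma cyc_lift_rep (R : pzRingType) (etaR : {rmorphism k -> R}) phiR TR xR :
  wreath_rep b bd z f etaR n phiR TR xR -> exists L : {rmorphism H -> R},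
  [/\ forall c, L (eta c) = etaR c, forall i a, (i <= n)%N -> L (phi i a) = phiR i a,
      forall i, (i < n)%N -> L (T i) = TR i & L x = xR].
Proof.
move=> r; have [L [Le Lp LT Lx]] := cyc_lift symA basis_b dual_bd r d_gt0 f0_inv.
exists L; split=> //.
- move=> i a ni; have ni' : (i < n.+1)%N by [].
  by have := Lp (Ordinal ni') a; rewrite -cyc_phiE.
- by move=> i ni; have := LT (Ordinal ni); rewrite -cyc_TE.
- by rewrite -Lx; congr (L _); apply: (cyc_XE b bd z f (ord0 : 'I_n.+1)).
Qed.

End CyclotomicLift.

Section CyclotomicTrace.
Variables (k : comNzRingType) (A : superalgType k).
Variables (tr : {scalar A}) (symA : symmetric_superalgebra tr).
Variables (B : finType) (b bd : B -> A) (basis_b : homogeneous_basis b).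
Hypothesis dual_bd : forall i j, tr (bd i * b j) = (i == j)%:R.
Variables (z : k) (d : nat) (d_gt0 : (0 < d)%N) (f : 'I_d -> A).
Hypothesis f_center : forall i, super_center false (f i).
Hypothesis f0_inv : forall i : 'I_d, i = 0%N :> nat -> exists u, f i * u = 1 /\ u * f i = 1.
Variable n : nat.

Local Notation H := (cyc_alg b bd z f n.+1).
Local Notation H' := (cyc_alg b bd z f n.+2).
Local Notation eta := (cyc_scal b bd z f n.+1 : {rmorphism k -> H}).
Local Notation eta' := (cyc_scal b bd z f n.+2 : {rmorphism k -> H'}).
Local Notation phi := (cyc_phi b bd z f n).
Local Notation T := (cyc_T b bd z f n).
Local Notation x := (cyc_X b bd z f n 0).
Local Notation phi' := (cyc_phi b bd z f n.+1).
Local Notation T' := (cyc_T b bd z f n.+1).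
Local Notation x' := (cyc_X b bd z f n.+1 0).
Local Notation incl := (cyc_incl (n := n.+1) : {rmorphism H -> H'}).

Let rep : wreath_rep b bd z f eta n phi T x := cyc_wreath_rep b bd z f n.
Let rep' : wreath_rep b bd z f eta' n.+1 phi' T' x' := cyc_wreath_rep b bd z f n.+1.

Lemma cyc_homog_X0 : cyc_homog false (x : H).
Proof.
have := cyc_homog_X b bd z f (ord0 : 'I_n.+1).
by rewrite -(cyc_XE b bd z f (ord0 : 'I_n.+1)).
Qed.

Lemma cyc_trace : exists theta : H' -> H,
  [/\ {morph theta : u v / u + v}, forall h u, theta (incl h * u) = h * theta u,
      forall h u, theta (u * incl h) = theta u * h, theta (T' n) = 0 &
      (forall r a, (r < d)%N -> theta (dsc T' 0 n.+1 * x' ^+ r * phi' 0 a * asc T' 0 n.+1) =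
         if r == 0%N then eta (tr a) else 0) /\
      (forall (i0 : 'I_d) a, i0 = 0%N :> nat ->
         theta (dsc T' 0 n.+1 * x' ^+ d * phi' 0 a * asc T' 0 n.+1) = - eta (tr (f i0 * a)))].
Proof.
have etaC := rep_eta rep.
pose L := scal_mx #|B| : {rmorphism H -> 'M[H]_#|B|}.
pose etaM := L \o eta : {rmorphism k -> 'M[H]_#|B|}.
have etaMC c y : etaM c * y = y * etaM c.
  apply/matrixP => i j; rewrite [LHS]mul_scal_mxE [RHS]mul_mx_scalE.
  exact: etaC.
have [lam lamE] := cyc_twist symA basis_b dual_bd d_gt0 f_center f0_inv etaMC
  (fun c => erefl : L (eta c) = etaM c) (reg_pi2 b H) (@reg_pi_L _ _ _ b H).
have par_phi p i a : homog p a -> cyc_homog p (phi i a) by apply: cyc_homog_phi.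
have par_T i : cyc_homog false (T i) by apply: cyc_homog_Tn.
have lift' := @cyc_lift_rep k A tr symA B b bd basis_b dual_bd z d d_gt0 f f0_inv n.+1.
have ind := @cyc_ind k A B b bd z d d_gt0 f f0_inv n.
have dec := @cyc_homog_decomp k A B b bd z d d_gt0 f f0_inv n.
have TE := trace_exists symA basis_b dual_bd f_center d_gt0 rep ind (par := @cyc_homog _ _ _ b bd z d f n.+1)
  dec (@cyc_homog_scal _ _ _ b bd z d f n.+1) par_phi par_T cyc_homog_X0 lamE rep' lift'.
exact: (TE incl (@cyc_incl_scal _ _ _ _ _ _ _ _ _) (@cyc_incl_phi _ _ _ _ _ _ _ _ _) (@cyc_incl_T _ _ _ _ _ _ _ _ _) (@cyc_incl_X0 _ _ _ _ _ _ _ _ _)).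
Qed.

End CyclotomicTrace.

Section PartialTraceGraph.
Variables (k : comNzRingType) (A : superalgType k) (tr : {scalar A}).
Variables (B : finType) (b bd : B -> A) (z : k) (d : nat) (f : 'I_d -> A) (n : nat).

Local Notation H := (cyc_alg b bd z f n.+1).
Local Notation H' := (cyc_alg b bd z f n.+2).
Local Notation phi' := (cyc_phi b bd z f n.+1).
Local Notation T' := (cyc_T b bd z f n.+1).
Local Notation x' := (cyc_X b bd z f n.+1 0).
Local Notation incl := (cyc_incl (n := n.+1) : {rmorphism H -> H'}).

Lemma AH_sumE (s : seq (A * H)) :
  (AH_sum s : H') = \sum_(p <- s) phi' n.+1 p.1 * incl p.2.
Proof.
apply: eq_bigr => p _.
by have E := cyc_phiE b bd z f (ord_max : 'I_n.+2) p.1; rewrite -E.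
Qed.

Lemma HTH_sumE (t : seq (H * H)) :
  (HTH_sum t : H') = \sum_(p <- t) incl p.1 * T' n * incl p.2.
Proof.
apply: eq_bigr => p _.
by have E := cyc_TE b bd z f (ord_max : 'I_n.+1); rewrite -E.
Qed.

Lemma cyc_X_last : (cyc_gen b bd z f (gen_X (ord_max : 'I_n.+2)) : H') = JM T' x' n.+1.
Proof.
have E := cyc_XE b bd z f (ord_max : 'I_n.+2); rewrite -E.
exact: (cyc_X_JM b bd z f (leqnn n.+1)).
Qed.

(** Every decomposition of [u] gives the value [theta u], so whichever element [xget] selects from
    the graph is that value, and the graph is nonempty because decompositions exist. The partial
    trace is well defined by the existence of [theta]. *)
Lemma ptraceE (theta : H' -> H) :
  (forall (s0 : seq (A * H)) (s : nat -> seq (A * H)) (t : seq (H * H)),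
     theta (\sum_(p <- s0) phi' n.+1 p.1 * incl p.2 +
       \sum_(1 <= r < d) JM T' x' n.+1 ^+ r * (\sum_(p <- s r) phi' n.+1 p.1 * incl p.2) +
       \sum_(p <- t) incl p.1 * T' n * incl p.2) =
     \sum_(p <- s0) cyc_scal b bd z f n.+1 (tr p.1) * p.2) ->
  (forall u : H', exists (s0 : seq (A * H)) (s : nat -> seq (A * H)) (t : seq (H * H)),
     u = \sum_(p <- s0) phi' n.+1 p.1 * incl p.2 +
       \sum_(1 <= r < d) JM T' x' n.+1 ^+ r * (\sum_(p <- s r) phi' n.+1 p.1 * incl p.2) +
       \sum_(p <- t) incl p.1 * T' n * incl p.2) ->
  ptrace tr (n := n) = theta.
Proof.
move=> theta_graph total; apply/funext => u.
have sumE s0 (s : nat -> seq (A * H)) (t : seq (H * H)) :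
    (AH_sum s0 + \sum_(1 <= r < d) cyc_gen b bd z f (gen_X (ord_max : 'I_n.+2)) ^+ r * AH_sum (s r)
       + HTH_sum t : H') =
    \sum_(p <- s0) phi' n.+1 p.1 * incl p.2 +
       \sum_(1 <= r < d) JM T' x' n.+1 ^+ r * (\sum_(p <- s r) phi' n.+1 p.1 * incl p.2) +
       \sum_(p <- t) incl p.1 * T' n * incl p.2.
  refine (f_equal2 +%R (f_equal2 +%R (AH_sumE s0) _) (HTH_sumE t)).
  apply: eq_bigr => r _.
  exact: (f_equal2 *%R (f_equal (fun v : H' => v ^+ r) cyc_X_last) (AH_sumE (s r))).
have [s0 [s [t uE]]] := total u.
have ex : exists y, ptrace_graph tr u y.
  exists (\sum_(p <- s0) cyc_scal b bd z f n.+1 (tr p.1) * p.2), s0, s, t.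
  exact: (conj (etrans uE (esym (sumE s0 s t))) erefl).
have [s1 [s2 [t1 [uE1 yE]]]] := xgetPex 0 ex.
apply: etrans yE _; apply: etrans (esym (theta_graph s1 s2 t1)) _.
exact: (f_equal theta (etrans (esym (sumE s1 s2 t1)) (esym uE1))).
Qed.

End PartialTraceGraph.

Theorem proposition4p18 (k : comNzRingType) (char_k : 2%N \notin [pchar k]) (z : k)
    (A : superalgType k) (tr : {scalar A}) (symA : symmetric_superalgebra tr)
    (B : finType) (b bd : B -> A) (basis_b : homogeneous_basis b)
    (dual_bd : forall i j, tr (bd i * b j) = (i == j)%:R)
    (d : nat) (d_gt0 : (0 < d)%N) (f : 'I_d -> A)
    (f_center : forall i, super_center false (f i))
    (f0_inv : forall i : 'I_d, i = 0%N :> nat ->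
       exists u, f i * u = 1 /\ u * f i = 1)
    (n : nat) :
  frobenius_extension
    (cyc_scal b bd z f n.+1) (cyc_scal b bd z f n.+2)
    (@cyc_homog k A B b bd z d f n.+1) (@cyc_homog k A B b bd z d f n.+2)
    (cyc_incl (n := n.+1)) (ptrace tr (n := n)).
Proof.
have [theta [tD tMl tMr tT [tlt td]]] := cyc_trace symA basis_b dual_bd z d_gt0 f_center f0_inv n.
pose i0 := Ordinal d_gt0; have [u [fu uf]] := f0_inv i0 erefl.
have rep' := cyc_wreath_rep b bd z f n.+1.
have ind' := @cyc_ind k A B b bd z d d_gt0 f f0_inv n.+1.
have iphi := @cyc_incl_phi k A B b bd z d f n; have iT := @cyc_incl_T k A B b bd z d f n.
have iX := @cyc_incl_X0 k A B b bd z d f n; have ieta := @cyc_incl_scal k A B b bd z d f n.+1.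
have i00 : i0 = 0%N :> nat by [].
have tdi a := td i0 a i00.
have graph := theta_graph symA basis_b dual_bd d_gt0 rep' ind' iphi iT iX tD tMl tMr tT tlt tdi.
have total := graph_total symA basis_b dual_bd d_gt0 rep' ind' iphi iT iX.
have -> : ptrace tr (n := n) = theta := ptraceE graph total.
have par_phi p i a : homog p a -> cyc_homog p (cyc_phi b bd z f n.+1 i a) by apply: cyc_homog_phi.
have par_T i : cyc_homog false (cyc_T b bd z f n.+1 i) by apply: cyc_homog_Tn.
exact: (frobenius_of_trace symA basis_b dual_bd d_gt0 rep' ind' ieta iphi iT iX tD tMl tMr tT tlt i00
  tdi fu uf (cyc_superalgebra symA basis_b dual_bd z d_gt0 f_center f0_inv n)
  (cyc_superalgebra symA basis_b dual_bd z d_gt0 f_center f0_inv n.+1) par_phi par_T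
  (cyc_homog_X0 b bd z f n.+1) (@cyc_incl_homog k A B b bd z d f n)).
Qed.
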